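(* Let $\Omega\subset\mathbb{H}$ be an axially symmetric domain, $m\geq1$, $\Lambda=(\lambda_1,\ldots,\lambda_m)\in\mathbb{H}^m$, and consider the equation $\mathcal{L}_{\lambda_1}\cdots\mathcal{L}_{\lambda_m}f=0$ on $\Omega$ with $f\in\mathcal{AM}(\Omega)$. The axially monogenic function $E^\Delta_\Lambda:=\Delta(E_\Lambda)\in\mathcal{AM}(\mathbb{H})$ is a solution. In general, every function of the form $$\sum_{i=1}^m\Delta\big(h_i\cdot E_{(\lambda_i,\ldots,\lambda_m)}\big),\qquad h_i\in\mathcal{SC}(\Omega),$$ is a solution. If $\lambda_i\neq0$ for every $i=1,\ldots,m$, all the solutions are of this form.
   Context: $\mathbb{H}$ is the skew field of quaternions, with elements $x=x_0+x_1i+x_2j+x_3k$, $\mathbb{S}=\{J\in\mathbb{H}: J^2=-1\}$; $\Delta=\sum_{i=0}^3\partial^2/\partial x_i^2$ is the Laplacian of $\mathbb{R}^4\simeq\mathbb{H}$. The convention $\lambda^0=1$ is used for every $\lambda\in\mathbb{H}$. For an open set $D\subseteq\mathbb{C}$ invariant under complex conjugation, put $\Omega_D=\{\alpha+J\beta:\ \alpha+i\beta\in D,\ J\in\mathbb{S}\}\subseteq\mathbb{H}$. An axially symmetric domain is a connected open set $\Omega=\Omega_D$ of this form. A stem function on $D$ is a map $F=F_1+\imath F_2:D\to\mathbb{H}\otimes_{\mathbb{R}}\mathbb{C}$ ($F_1,F_2$ $\mathbb{H}$-valued, $\imath$ the central imaginary unit of the factor $\mathbb{C}$) with $F(\overline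 z)=\overline{F(z)}$, conjugation acting on the factor $\mathbb{C}$. It induces the slice function $f=\mathcal{I}(F):\Omega_D\to\mathbb{H}$, $f(\alpha+J\beta)=F_1(\alpha+i\beta)+JF_2(\alpha+i\beta)$. $\mathcal{S}^1(\Omega)$ is the set of slice functions induced by $C^1$ stem functions; the slice derivative is $\frac{\partial f}{\partial x}=\mathcal{I}(\frac{\partial F}{\partial z})$ with $\frac{\partial}{\partial z}=\frac12(\partial_\alpha-\imath\partial_\beta)$. $f$ is slice-regular if $F$ is holomorphic. $\mathcal{SC}(\Omega)$ is the set of slice-constant functions: slice-regular $g$ with $\frac{\partial g}{\partial x}=0$. The slice product of $f=\mathcal{I}(F)$, $g=\mathcal{I}(G)$ is $f\cdot g=\mathcal{I}(FG)$, with $FG$ the pointwise product in $\mathbb{H}\otimes\mathbb{C}$. The Cauchy-Riemann-Fueter operator is $\overline\partial=\frac12\left(\frac{\partial}{\partial x_0}+i\frac{\partial}{\partial x_1}+j\frac{\partial}{\partial x_2}+k\frac{\partial}{\partial x_3}\right)$ and its conjugate is $\partial=\frac12\left(\frac{\partial}{\partial x_0}-i\frac{\partial}{\partial x_1}-j\frac{\partial}{\partial x_2}-k\frac{\partial}{\partial x_3}\right)$ ($i,j,k$ acting by left multiplication). $\mathcal{AM}(\Omega)=\{f\in\mathcal{S}^1(\Omega):\overline\partial f=0\}$ is the space of axially monogenic functions. For $\lambda\in\mathbb{H}$ and $f\in\mathcal{AM}(\Omega)$, $\mathcal{L}_\lambda f=\partial f-f\lambda$. For $(\mu_1,\ldots,\mu_p)\in\mathbb{H}^p$,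 $p\ge1$, the generalized exponential function is the entire slice-regular function $$E_{(\mu_1,\ldots,\mu_p)}(x)=\sum_{n=p-1}^{+\infty}\frac{x^n}{n!}\sum_{k_1+\cdots+k_p=n-p+1}\mu_1^{k_1}\cdots\mu_p^{k_p},$$ the inner sum being over non-negative integers $k_1,\ldots,k_p$. *)

(* Defs.v *)
From HB Require Import structures.
From mathcomp Require Import all_boot all_order all_algebra.
From mathcomp Require Import ring.
From mathcomp Require Import all_classical all_reals all_analysis.

Set Implicit Arguments.
Unset Strict Implicit.
Unset Printing Implicit Defensive.

Import Order.TTheory GRing.Theory Num.Theory.
Import numFieldNormedType.Exports.

Local Open Scope classical_set_scope.
Local Open Scope ring_scope.

(** Quaternions are 4-dimensional row vectors in the basis 1, i, j, k.  The
    norm inherited from ['rV[R]_4] is the sup norm; it is only used for the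
    topology and for derivatives. *)
Definition quat (R : realType) : Type := 'rV[R]_4.

HB.instance Definition _ (R : realType) := NormedModule.on (quat R).

Section Quaternions.
Variable R : realType.
Implicit Types x y z : quat R.

Definition mkquat (a b c d : R) : quat R :=
  \row_(l < 4) [:: a; b; c; d]`_l.

Definition qco (l : nat) x : R := x ord0 (inord l).

Definition qmul x y : quat R :=
  let: (a, b, c, d) := (qco 0 x, qco 1 x, qco 2 x, qco 3 x) in
  let: (a', b', c', d') := (qco 0 y, qco 1 y, qco 2 y, qco 3 y) in
  mkquat (a * a' - b * b' - c * c' - d * d')
         (a * b' + b * a' + c * d' - d * c')
         (a * c' - b * d' + c * a' + d * b')
         (a * d' + b * c' - c * b' + d * a').

Lemma quat_eqP x y :
  qco 0 x = qco 0 y -> qco 1 x = qco 1 y ->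
  qco 2 x = qco 2 y -> qco 3 x = qco 3 y -> x = y.
Proof.
move=> h0 h1 h2 h3; apply/rowP => l; rewrite -(inord_val l).
by case: l => -[|[|[|[|]]]].
Qed.

Lemma qco_mkquat a b c d l :
  (l < 4)%N -> qco l (mkquat a b c d) = [:: a; b; c; d]`_l.
Proof. by move=> ll; rewrite /qco mxE inordK. Qed.

Lemma qcoD l x y : qco l (x + y) = qco l x + qco l y.
Proof. by rewrite /qco mxE. Qed.

Lemma qcoZ l a x : qco l (a *: x) = a * qco l x.
Proof. by rewrite /qco mxE. Qed.

Let qE := (qcoD, qcoZ, qco_mkquat).

Fact qmulA : associative qmul.
Proof. by move=> x y z; apply: quat_eqP; rewrite !qE //=; ring. Qed.

Fact qmul1q : left_id (mkquat 1 0 0 0) qmul.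
Proof. by move=> x; apply: quat_eqP; rewrite !qE //=; ring. Qed.

Fact qmulq1 : right_id (mkquat 1 0 0 0) qmul.
Proof. by move=> x; apply: quat_eqP; rewrite !qE //=; ring. Qed.

Fact qmulDl : left_distributive qmul +%R.
Proof. by move=> x y z; apply: quat_eqP; rewrite !qE //=; ring. Qed.

Fact qmulDr : right_distributive qmul +%R.
Proof. by move=> x y z; apply: quat_eqP; rewrite !qE //=; ring. Qed.

Fact qone_neq0 : mkquat 1 0 0 0 != 0.
Proof.
apply/eqP => /(congr1 (qco 0)); rewrite qco_mkquat // /qco mxE /=.
by apply/eqP; rewrite oner_eq0.
Qed.

Fact qscaleAl a x y : a *: qmul x y = qmul (a *: x) y.
Proof. by apply: quat_eqP; rewrite !qE //=; ring. Qed.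

Fact qscaleAr a x y : a *: qmul x y = qmul x (a *: y).
Proof. by apply: quat_eqP; rewrite !qE //=; ring. Qed.

End Quaternions.

HB.instance Definition _ (R : realType) := GRing.Zmodule_isNzRing.Build (quat R)
  (@qmulA R) (@qmul1q R) (@qmulq1 R) (@qmulDl R) (@qmulDr R) (@qone_neq0 R).
HB.instance Definition _ (R : realType) :=
  GRing.Lmodule_isLalgebra.Build R (quat R) (@qscaleAl R).
HB.instance Definition _ (R : realType) :=
  GRing.Lalgebra_isAlgebra.Build R (quat R) (@qscaleAr R).

Lemma quat_mulE (R : realType) (x y : quat R) : x * y = qmul x y.
Proof. by []. Qed.

Lemma quat1E (R : realType) : (1 : quat R) = mkquat 1 0 0 0.
Proof. by []. Qed.

(** H (x)_R C, with the pair [(a, b)] standing for a + iota b.  The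
    multiplication is [qCmul], not the componentwise product of pairs. *)
Notation quatC R := (quat R * quat R)%type.

(** C is identified with R x R, so that real directional derivatives and the
    product topology are available: [(a, b)] stands for a + i b. *)
Notation cplx R := (R * R)%type.

Section SliceFunctions.
Variable R : realType.
Local Notation H := (quat R).
Local Notation HC := (quatC R).
Local Notation C := (cplx R).
Implicit Types (D : set C) (F G : C -> HC) (f g : H -> H) (z : C) (J x : H).

Definition qCmul (u v : HC) : HC :=
  (u.1 * v.1 - u.2 * v.2, u.1 * v.2 + u.2 * v.1).

Definition qCconj (u : HC) : HC := (u.1, - u.2).

Definition iota_ : HC := (0, 1).

Definition cconj z : C := (z.1, - z.2).

Definition imag_unit : set H := [set J | J * J = -1].

Definition conj_invariant D := forall z, D z -> D (cconj z).

Definition Omega D : set H :=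
  [set x | exists z J, [/\ D z, imag_unit J & x = z.1%:A + z.2 *: J]].

Definition axially_symmetric_domain D :=
  [/\ open D, conj_invariant D, open (Omega D) & connected (Omega D)].

(** Functions on D or on [Omega D] are total functions of which only the values
    on the relevant set matter. *)
Definition stem D F := forall z, D z -> F (cconj z) = qCconj (F z).

Definition induces D F f := forall z J, D z -> imag_unit J ->
  f (z.1%:A + z.2 *: J) = (F z).1 + J * (F z).2.

Definition slice_ind D F : H -> H := xget 0 [set f | induces D F f].

Definition stem_of D f : C -> HC :=
  xget (fun=> 0) [set F | stem D F /\ induces D F f].

Definition slice_mul D f g : H -> H :=
  slice_ind D (fun z => qCmul (stem_of D f z) (stem_of D g z)).

Definition dalpha F : C -> HC := 'D_((1, 0) : C) F.
Definition dbeta F : C -> HC := 'D_((0, 1) : C) F.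

Definition C1_on D F := forall z, D z ->
  [/\ derivable F z ((1, 0) : C), derivable F z ((0, 1) : C),
      {for z, continuous (dalpha F)} & {for z, continuous (dbeta F)}].

Definition dz F z : HC := 2^-1 *: (dalpha F z - qCmul iota_ (dbeta F z)).
Definition dzbar F z : HC := 2^-1 *: (dalpha F z + qCmul iota_ (dbeta F z)).

Definition slice_C1 D f := exists F, [/\ stem D F, C1_on D F & induces D F f].

Definition slice_deriv D f : H -> H := slice_ind D (dz (stem_of D f)).

Definition slice_regular D f := exists F,
  [/\ stem D F, C1_on D F, induces D F f & forall z, D z -> dzbar F z = 0].

Definition slice_constant D f :=
  slice_regular D f /\ forall x, Omega D x -> slice_deriv D f x = 0.

Lemma imag_unit_re J : imag_unit J -> qco 0 J = 0.
Proof.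
rewrite /imag_unit /= => JJ; apply/eqP/negPn/negP => J0.
have e l : (l < 4)%N -> qco l (J * J) = qco l (-1 : H) by rewrite JJ.
have := e 0%N isT; have := e 1%N isT; have := e 2%N isT; have := e 3%N isT.
have qN l : qco l (-1 : H) = - qco l (1 : H) by rewrite /qco mxE.
rewrite !qN quat_mulE quat1E /qmul !qco_mkquat //=.
set a := qco 0 J in J0 *; set b := qco 1 J; set c := qco 2 J; set d := qco 3 J.
have z0 (u : R) : a * u + u * a = 0 -> u = 0.
  rewrite (mulrC u) -mulr2n -mulrnAl => /eqP; rewrite mulf_eq0 mulrn_eq0 /=.
  by rewrite (negbTE J0) /= => /eqP.
move=> h3 h2 h1 h0.
rewrite !oppr0 in h1 h2 h3; clear e; clearbody a b c d.
have d0 : d = 0 by apply: z0; rewrite -h3; ring.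
have c0 : c = 0 by apply: z0; rewrite -h2; ring.
have b0 : b = 0 by apply: z0; rewrite -h1; ring.
move: h0; rewrite b0 c0 d0 !mulr0 !subr0 => h0.
by have := sqr_ge0 a; rewrite expr2 h0 oppr_ge0 ler10.
Qed.

Lemma imag_unitN J : imag_unit J -> imag_unit (- J).
Proof. by rewrite /imag_unit /= mulrNN. Qed.

Lemma imag_unit_ex : exists J : H, imag_unit J.
Proof.
exists (mkquat 0 1 0 0); rewrite /imag_unit /=.
have qN l : qco l (-1 : H) = - qco l (1 : H) by rewrite /qco mxE.
apply: quat_eqP; rewrite qN quat_mulE quat1E /qmul !qco_mkquat //=;
  ring.
Qed.

Lemma slice_repr_inj (z z' : C) J J' : imag_unit J -> imag_unit J' ->
  z.1%:A + z.2 *: J = z'.1%:A + z'.2 *: J' ->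
  [/\ z.1 = z'.1, z.2 *: J = z'.2 *: J' & z'.2 = z.2 \/ z'.2 = - z.2].
Proof.
move=> hJ hJ' e.
have one0 : qco 0 (1 : H) = 1 by rewrite quat1E qco_mkquat.
have e1 : z.1 = z'.1.
  have := congr1 (qco 0) e; rewrite !qcoD !qcoZ (imag_unit_re hJ) (imag_unit_re hJ') one0.
  by rewrite !mulr0 !addr0 !mulr1.
move: e; rewrite e1 => /addrI e2; split=> //.
have : (z.2 *: J) * (z.2 *: J) = (z'.2 *: J') * (z'.2 *: J') by rewrite e2.
rewrite -!scalerAl -!scalerAr hJ hJ' !scalerA => /(congr1 (qco 0)).
rewrite !qcoZ -scaleN1r qcoZ one0 mulr1 !mulrN1 => /oppr_inj /eqP.
by rewrite -!expr2 eqf_sqr => /orP[] /eqP ->; [left|right; rewrite opprK].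
Qed.

Lemma slice_indP D F : conj_invariant D -> stem D F ->
  induces D F (slice_ind D F).
Proof.
move=> Dc sF; rewrite /slice_ind; case: xgetP => // /(_ _) hn; exfalso.
pose P x (v : H) := forall z J, D z -> imag_unit J ->
  x = z.1%:A + z.2 *: J -> v = (F z).1 + J * (F z).2.
have exP x : exists v, P x v.
  have [[z [J [Dz hJ ->]]]|nx] := pselect (Omega D x); last first.
    by exists 0 => z J Dz hJ xE; exfalso; apply: nx; exists z, J.
  exists ((F z).1 + J * (F z).2) => z' J' _ hJ' e.
  have [e1 e2] := slice_repr_inj hJ hJ' e.
  have [b0|b0] := eqVneq z.2 0.
    move=> b'; have {b'} zz : z' = z.
      rewrite (surjective_pairing z) (surjective_pairing z') -e1.
      by case: b' => ->; rewrite b0 ?oppr0.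
    have /(congr1 snd)/eqP : F z = qCconj (F z).
      by rewrite -sF // /cconj b0 oppr0 -b0 -surjective_pairing.
    rewrite /= -subr_eq0 opprK -mulr2n -scaler_nat scaler_eq0 pnatr_eq0 /=.
    by move=> /eqP F0; rewrite zz F0 !mulr0.
  case=> b'.
    have -> : z' = z.
      by rewrite (surjective_pairing z) (surjective_pairing z') -e1 b'.
    by move: e2; rewrite b' => /(scalerI b0) ->.
  have -> : z' = cconj z.
    by rewrite /cconj (surjective_pairing z') -e1 b'.
  rewrite sF //=; move: e2; rewrite b' scaleNr -scalerN => /(scalerI b0) ->.
  by rewrite mulNr mulrN.
apply: (hn (fun x => projT1 (cid (exP x)))) => z J Dz hJ.
by case: cid => v /=; apply.
Qed.

Lemma induces_uniq D F G f : induces D F f -> induces D G f ->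
  forall z, D z -> F z = G z.
Proof.
move=> hF hG z Dz; have [J hJ] := imag_unit_ex.
have e1 : (F z).1 + J * (F z).2 = (G z).1 + J * (G z).2.
  by rewrite -hF // hG.
have e2 : (F z).1 - J * (F z).2 = (G z).1 - J * (G z).2.
  by rewrite -!mulNr -hF ?hG //; exact: imag_unitN.
have F1 : (F z).1 = (G z).1.
  apply: (@scalerI _ _ (2 : R)); first by rewrite pnatr_eq0.
  rewrite !scaler_nat !mulr2n.
  have := congr2 +%R e1 e2; rewrite addrACA subrr addr0 => ->.
  by rewrite addrACA subrr addr0.
rewrite (surjective_pairing (F z)) (surjective_pairing (G z)) F1; congr pair.
move: e1; rewrite F1 => /addrI /(congr1 (fun q => - (J * q))).
by rewrite !mulrA hJ !mulN1r !opprK.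
Qed.

Lemma stem_ofP D F f : stem D F -> induces D F f ->
  forall z, D z -> stem_of D f z = F z.
Proof.
move=> sF hF z Dz; rewrite /stem_of; case: xgetP => [G _ [_ hG]|/(_ F)].
  exact: (induces_uniq hG hF).
by case.
Qed.

End SliceFunctions.

Section AxiallyMonogenic.
Variable R : realType.
Local Notation H := (quat R).
Local Notation C := (cplx R).
Implicit Types (D : set C) (f g : H -> H) (x lambda : H).

(** 1, i, j, k for l = 0, 1, 2, 3. *)
Definition qunit (l : 'I_4) : H := delta_mx ord0 l.

Definition pderiv (l : 'I_4) f : H -> H := 'D_(qunit l) f.

Definition laplacian f x : H := \sum_(l < 4) pderiv l (pderiv l f) x.

Definition dbar f x : H := 2^-1 *: \sum_(l < 4) qunit l * pderiv l f x.

Definition dconj f x : H :=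
  2^-1 *: (pderiv ord0 f x
           - \sum_(l < 4 | l != ord0) qunit l * pderiv l f x).

Definition axially_monogenic D f :=
  slice_C1 D f /\ forall x, Omega D x -> dbar f x = 0.

Definition Lop lambda f x : H := dconj f x - f x * lambda.

(** Exponents with sum d are at most d, hence the type ['I_d.+1]. The product is
    taken in increasing order of i. *)
Definition cplt_sum (mu : seq H) (d : nat) : H :=
  \sum_(k : {ffun 'I_(size mu) -> 'I_d.+1} | (\sum_i k i)%N == d)
    \prod_(i < size mu) mu`_i ^+ k i.

Definition gen_exp (mu : seq H) x : H :=
  limn (fun N => \sum_((size mu).-1 <= n < N)
    n`!%:R^-1 *: x ^+ n * cplt_sum mu (n.+1 - size mu)%N).

Definition is_solution D (Lambda : seq H) f :=
  axially_monogenic D f /\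
  forall x, Omega D x -> foldr Lop f Lambda x = 0.

End AxiallyMonogenic.

(* Main.v *)
(** By Fueter's theorem, if [F] is a holomorphic stem and [F_2 = b G], then
    [Delta I(F)] is axially monogenic with stem [(-2 G_a, 2 G_b)].  On axially
    monogenic functions [dconj] acts as [d / dx_0], hence as [d / da] on stems,
    and this commutes with [F |-> (-2 G_a, 2 G_b)].  So [Delta] transports
    solutions of the holomorphic equation [(d - lambda_1) ... (d - lambda_m) F = 0],
    and that equation is solved by the exponentials because the complete symmetric
    sums satisfy [h_(d+1)(mu, lambda) = h_(d+1)(mu) + h_d(mu, lambda) lambda].

    Conversely, write a solution as [f = I(A + iota B)].  A stem is axially
    monogenic iff [A_b = - B_a] and [b (A_a - B_b) = 2 B]; locally this means
    [A = u_a], [B = - u_b] for a solution [u] of [u_aa + u_bb + (2 / b) u_b = 0], and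
    interior gradient estimates for this singular equation make [u], hence [f],
    smooth up to the axis [b = 0].  When all [lambda_i] are nonzero the equation
    expresses a primitive of [f] by [f] and its derivatives in [a], so that there is
    a solution [Y] on all of [D] with [Y_aa = f].  Then
    [F = (- Y_1 / 2 + b Y_(a,2) / 2, - b Y_(a,1) / 2)] is holomorphic, satisfies
    the same equation, and is mapped to [f] by Fueter's theorem.  Variation of
    constants splits off [h E_(lambda_1, ..., lambda_m)] with
    [h = ((d - lambda_2) ... (d - lambda_m) F) exp(- z lambda_1)] slice constant, and
    one concludes by induction on [m]. *)

Require Import Defs.
From mathcomp Require Import all_boot all_order all_algebra.
From mathcomp Require Import ring lra.
From mathcomp Require Import all_classical all_reals all_analysis.
Set Implicit Arguments.
Unset Strict Implicit.
Unset Printing Implicit Defensive.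
Import Order.TTheory GRing.Theory Num.Theory.
Import numFieldNormedType.Exports.
Local Open Scope classical_set_scope.
Local Open Scope ring_scope.

(** Three difficulties shape the proof. A solution has a stem that is only $C^1$, while the equation
    differentiates $m$ times and its system degenerates at $b=0$. The singular equation is invariant
    under translation in $a$, so $u(x+s,y)-u(x-s,y)$ solves an elliptic equation in three variables,
    and a polynomial barrier bounds $u_a$ by a bound of $u$ alone, without any integral kernel.
    Difference quotients and uniform limits then show that $u_a$ solves the equation again, and this
    iterates.

    Next, [D] may have holes, so primitives cannot be path integrals over [D]. They are obtained by
    algebra: dividing by $\lambda_i$ makes each factor of the operator invertible modulo a
    derivative, and two primitives are taken because inverting Fueter's map costs two derivatives.

    Finally, quotients $F_2/b$ must solve the axial equation across $b=0$. They are carried along as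
    functions [G] next to the stem, and facts at the axis are found by differentiating $bG$ in $b$.
    Derivatives along the real axis are carried as sequences of functions, so that an operator
    $\partial-\lambda$ is an algebraic operation on sequences. *)

Section RealCalculus.
Variable R : realType.
Implicit Types (f g : R -> R) (a b x c d : R).

(** The endpoints may come in either order, so that increments of both signs are treated at once. *)
Definition between a b x := (a <= x <= b) || (b <= x <= a).

Lemma between_ball a b c r x : `|a - c| < r -> `|b - c| < r -> between a b x ->
  `|x - c| < r.
Proof.
by rewrite !ltr_norml => /andP[? ?] /andP[? ?] /orP[|] /andP[? ?]; apply/andP; split; lra.
Qed.

Lemma between_le_norm a b x : between a b x -> `|x - a| <= `|b - a|.
Proof.
move=> /orP[] /andP[? ?].
  by rewrite !ger0_norm; lra.
by rewrite !ler0_norm; lra.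
Qed.

Lemma is_derive_cvg f x d : is_derive x 1 f d ->
  (fun h => h^-1 * (f (h + x) - f x)) @ 0^' --> d.
Proof.
case=> df <-; move: df; rewrite /derivable /derive /=.
by under eq_fun do rewrite [_%:A]mulr1 [_ *: _]/(_ * _).
Qed.

Lemma cvg_is_derive f x d :
  (fun h => h^-1 * (f (h + x) - f x)) @ 0^' --> d -> is_derive x 1 f d.
Proof.
move=> h; have e : (fun h0 : R => h0^-1 *: ((f \o shift x) (h0 *: 1) - f x)) =
   (fun h => h^-1 * (f (h + x) - f x)).
  by apply/funext => k /=; rewrite [_%:A]mulr1.
apply: DeriveDef; rewrite /derivable /derive e; first by apply/cvg_ex; exists d.
exact: cvg_lim h.
Qed.

Lemma is_derive_continuous f x d : is_derive x 1 f d -> {for x, continuous f}.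
Proof. by case=> /derivable1_diffP /differentiable_continuous. Qed.

Lemma mvt f df a b : (forall x, between a b x -> is_derive x 1 f (df x)) ->
  exists2 c, between a b c & f b - f a = df c * (b - a).
Proof.
move=> h; have [ab|ba] := leP a b.
  have [||c cab e] := @MVT_segment R f df a b ab.
  - by move=> x; rewrite in_itv /= => /andP[h1 h2]; apply: h; rewrite /between (ltW h1) (ltW h2).
  - apply: continuous_in_subspaceT => x /set_mem /=; rewrite in_itv /= => xab.
    by apply: (@is_derive_continuous f x (df x)); apply: h; rewrite /between xab.
  - by exists c => //; move: cab; rewrite in_itv /between /= => ->.
have [||c cab e] := @MVT_segment R f df b a (ltW ba).
- by move=> x; rewrite in_itv /= => /andP[h1 h2]; apply: h; rewrite /between (ltW h1) (ltW h2) orbT.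
- apply: continuous_in_subspaceT => x /set_mem /=; rewrite in_itv /= => xab.
  by apply: (@is_derive_continuous f x (df x)); apply: h; rewrite /between xab orbT.
- exists c; first by move: cab; rewrite in_itv /between /= => ->; rewrite orbT.
  by rewrite -opprB e -mulrN opprB.
Qed.

Lemma mvt_bound f df a b K : (forall x, between a b x -> is_derive x 1 f (df x)) ->
  (forall x, between a b x -> `|df x| <= K) -> `|f b - f a| <= K * `|b - a|.
Proof.
move=> h hK; have [c cab ->] := mvt h.
by rewrite normrM ler_wpM2r // hK.
Qed.

(** Clearing the denominator removes the exclusion of [h = 0] and turns derivatives into
    inequalities that [lra] can combine. *)
Lemma is_deriveP f x d : is_derive x 1 f d <->
  forall e, 0 < e -> exists2 r, 0 < r & forall h, `|h| < r ->
    `|f (x + h) - f x - d * h| <= e * `|h|.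
Proof.
have key h e : h != 0 -> (`|d - h^-1 * (f (h + x) - f x)| <= e) =
    (`|f (x + h) - f x - d * h| <= e * `|h|).
  move=> h0; rewrite -(ler_pM2r (x := `|h|)) ?normr_gt0 // -normrM -normrN.
  by rewrite (addrC h); congr (`| _ | <= _); field.
split=> [/is_derive_cvg /cvgrPdist_le H e e0|H].
  have := H e e0; rewrite near_withinE => /nbhs_ballP[r /= r0 rb].
  exists r => // h hr; have [->|h0] := eqVneq h 0.
    by rewrite addr0 mulr0 subr0 subrr normr0 mulr0.
  rewrite -key //; by apply: rb; rewrite // /ball /= sub0r normrN.
apply: cvg_is_derive; apply/cvgrPdist_le => e e0.
have [r r0 hr] := H e e0.
rewrite near_withinE; apply/nbhs_ballP; exists r => //= h.
by rewrite /ball /= sub0r normrN => hlt h0; rewrite key //; apply: hr.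
Qed.

Lemma is_derive_uniq f x d d' : is_derive x 1 f d -> is_derive x 1 f d' -> d = d'.
Proof. by move=> [_ <-] [_ <-]. Qed.

Lemma derive_ge0_right f x d r : 0 < r -> is_derive x 1 f d ->
  (forall h, 0 < h < r -> f x <= f (x + h)) -> 0 <= d.
Proof.
move=> r0 /is_deriveP H hf; apply/ler_addgt0Pl => e e0.
have [r' r'0 hr'] := H e e0.
pose h := Num.min r r' / 2.
have m0 : 0 < Num.min r r' by rewrite lt_min r0.
have h0 : 0 < h by rewrite /h; lra.
have hlt : h < Num.min r r' by rewrite /h; lra.
move: hlt; rewrite lt_min => /andP[hr hhr'].
have := hr' h; rewrite gtr0_norm // => /(_ hhr').
have := hf h; rewrite h0 hr => /(_ isT) h1.
rewrite ler_norml => /andP[_ h2].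
rewrite -(ler_pM2r h0) mul0r; lra.
Qed.

(** The second derivative exists at [c] only, so Taylor's formula is not at hand. If [d2 < 0], then
    [g] is negative just to the right of [c], and the mean value theorem makes [f] drop below [f c]
    there. *)
Lemma min_test2 f g c d2 r : 0 < r ->
  (forall x, `|x - c| < r -> is_derive x 1 f (g x)) -> is_derive c 1 g d2 ->
  (forall x, `|x - c| < r -> f c <= f x) -> g c = 0 /\ 0 <= d2.
Proof.
move=> r0 df dg hmin.
have cc : `|c - c| < r by rewrite subrr normr0.
have g0 : g c = 0.
  have h1 : 0 <= g c.
    apply: (derive_ge0_right r0 (df c cc)) => h /andP[h0 hr].
    by apply: hmin; rewrite addrAC subrr add0r gtr0_norm.
  suff : 0 <= - g c by lra.
  have df' : is_derive (- c) 1 (fun x => f (- x)) (- g c).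
    apply/is_deriveP => e e0; have /is_deriveP/(_ e e0)[r' r'0 hr'] := df c cc.
    exists r' => // h hlt; have := hr' (- h); rewrite normrN => /(_ hlt).
    by rewrite opprD opprK mulrN mulNr.
  apply: (derive_ge0_right r0 df') => h /andP[h0 hr].
  rewrite opprK opprD opprK; apply: hmin.
  by rewrite addrAC subrr add0r normrN gtr0_norm.
split=> //; rewrite leNgt; apply/negP => d0.
have /is_deriveP/(_ (- d2 / 2)) [|r' r'0 hr'] := dg; first by lra.
pose h := Num.min r r' / 2.
have m0 : 0 < Num.min r r' by rewrite lt_min r0.
have h0 : 0 < h by rewrite /h; lra.
have hlt : h < Num.min r r' by rewrite /h; lra.
move: hlt; rewrite lt_min => /andP[hr hhr'].
have gneg k : 0 < k <= h -> g (c + k) < 0.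
  move=> /andP[k0 kh]; have := hr' k; rewrite gtr0_norm // => /(_ (le_lt_trans kh hhr')).
  rewrite g0 subr0 ler_norml => /andP[_]; rewrite lerBlDr => H.
  apply: le_lt_trans H _; have -> : - d2 / 2 * k + d2 * k = d2 * k / 2 by field.
  by rewrite pmulr_llt0 ?invr_gt0 ?ltr0n // nmulr_rlt0.
have step a b : c <= a -> a < b -> b <= c + h ->
    exists2 x, a <= x <= b & f b - f a = g x * (b - a).
  move=> ca ab bh; have [|x xb e] := @mvt f g a b.
    move=> x /orP[/andP[h1 h2]|/andP[h1 h2]]; apply: df; last by lra.
    by rewrite ger0_norm; lra.
  by exists x => //; move: xb => /orP[//|/andP[h1 h2]]; lra.
(* The interval is halved because on the first half the mean value point may be [c] itself, where
   [g] vanishes; on the second half the drop is strict. *)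
have [||| x /andP[x1 x2] ex] := step c (c + h / 2); [by lra..|].
have [||| y /andP[y1 y2] ey] := step (c + h / 2) (c + h); [by lra..|].
have gx : g x <= 0.
  have [->|xc] := eqVneq x c; first by rewrite g0.
  have := gneg (x - c); rewrite (addrC c) subrK => H; apply/ltW/H.
  by move: xc; rewrite neq_lt => /orP[|] ?; apply/andP; split; lra.
have gy : g y < 0.
  have := gneg (y - c); rewrite (addrC c) subrK => H; apply: H.
  by apply/andP; split; lra.
have fx : f (c + h / 2) - f c <= 0 by rewrite ex mulr_le0_ge0 //; lra.
have fy : f (c + h) - f (c + h / 2) < 0 by rewrite ey nmulr_rlt0 //; lra.
have := hmin (c + h); rewrite addrAC subrr add0r gtr0_norm // => /(_ hr).
lra.
Qed.

End RealCalculus.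

(** * Rules of differentiation and continuity, and tactics applying them *)

Section Rules.
Variable R : realType.
Implicit Types (f g : R -> R) (x c d e k : R).

Lemma derC x c : is_derive x 1 (fun=> c) 0.
Proof. exact: is_derive_cst. Qed.

Lemma derI x : is_derive x 1 (fun t : R => t) 1.
Proof. exact: is_derive_id. Qed.

Lemma derD f g x d e : is_derive x 1 f d -> is_derive x 1 g e ->
  is_derive x 1 (fun t => f t + g t) (d + e).
Proof. exact: is_deriveD. Qed.

Lemma derN f x d : is_derive x 1 f d -> is_derive x 1 (fun t => - f t) (- d).
Proof. exact: is_deriveN. Qed.

Lemma derM f g x d e : is_derive x 1 f d -> is_derive x 1 g e ->
  is_derive x 1 (fun t => f t * g t) (f x * e + g x * d).
Proof. exact: is_deriveM. Qed.

Lemma derX2 f x d : is_derive x 1 f d ->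
  is_derive x 1 (fun t => f t ^+ 2) (2 * f x * d).
Proof.
move=> fd; rewrite -mulrA mulr_natl mulr2n.
exact: (@derM f f x d d).
Qed.

Lemma der_shift f x c d : is_derive (x + c) 1 f d -> is_derive x 1 (fun t => f (t + c)) d.
Proof.
move=> /is_deriveP H; apply/is_deriveP => e /H[r r0 hr]; exists r => // h /hr.
by rewrite (addrAC x).
Qed.

Lemma der_shiftl f x c d : is_derive (c + x) 1 f d -> is_derive x 1 (fun t => f (c + t)) d.
Proof. by rewrite addrC; under eq_fun do rewrite addrC; exact: der_shift. Qed.

Lemma der_reflect f x c d : is_derive (c - x) 1 f d ->
  is_derive x 1 (fun t => f (c - t)) (- d).
Proof.
move=> /is_deriveP H; apply/is_deriveP => e /H[r r0 hr]; exists r => // h hh.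
by have := hr (- h); rewrite normrN opprD addrA mulrN mulNr => /(_ hh).
Qed.

Lemma derV f x d : f x != 0 -> is_derive x 1 f d ->
  is_derive x 1 (fun t => (f t)^-1) (- (f x ^- 2) * d).
Proof.
by move=> f0 [df <-]; apply: DeriveDef; [exact: derivableV|rewrite deriveV].
Qed.

Lemma der_near f g x d r : 0 < r -> (forall t, `|t - x| < r -> f t = g t) ->
  is_derive x 1 f d -> is_derive x 1 g d.
Proof.
move=> r0 h; apply: near_eq_is_derive; apply/nbhs_ballP; exists r => //= t.
by rewrite /ball /= distrC; exact: h.
Qed.

End Rules.

(** Derivatives of unknown functions are found by [eassumption], so they are put in the context
    beforehand in unfolded form. [der] leaves one goal: the computed derivative equals the stated
    one. *)
Ltac der1 F := lazymatch F with
  | (fun t => GRing.add (@?f t) (@?g t)) => notypeclasses refine (@derD _ f g _ _ _ _ _)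
  | (fun t => GRing.opp (@?f t)) => notypeclasses refine (@derN _ f _ _ _)
  | (fun t => GRing.exp (@?f t) 2) => notypeclasses refine (@derX2 _ f _ _ _)
  | (fun t => GRing.mul (@?f t) (@?g t)) => notypeclasses refine (@derM _ f g _ _ _ _ _)
  | (fun t => t) => notypeclasses refine (derI _)
  | _ => first [notypeclasses refine (derC _ _) | eassumption]
  end.
Ltac der := notypeclasses refine (is_derive_eq _ _);
  [repeat lazymatch goal with |- is_derive _ _ ?F _ => der1 F end | ].

Lemma cont_pair (S T U : topologicalType) (f : S -> T) (g : S -> U) x :
  {for x, continuous f} -> {for x, continuous g} ->
  {for x, continuous (fun t => (f t, g t))}.
Proof. by move=> cf cg; exact: (@cvg_pair _ _ _ _ (nbhs (f x)) (nbhs (g x))). Qed.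

Lemma cont_comp2 (S T U V : topologicalType) (u : T * U -> V) (f : S -> T) (g : S -> U) x :
  {for (f x, g x), continuous u} -> {for x, continuous f} -> {for x, continuous g} ->
  {for x, continuous (fun t => u (f t, g t))}.
Proof. by move=> cu cf cg; apply: (continuous_comp (cont_pair cf cg)). Qed.

Section ContinuityRules.
Variables (R : realType) (T : topologicalType).
Implicit Types (f g : T -> R) (x : T).

Lemma cntC x (c : R) : {for x, continuous (fun=> c)}.
Proof. exact: cvg_cst. Qed.

Lemma cntD f g x : {for x, continuous f} -> {for x, continuous g} ->
  {for x, continuous (fun t => f t + g t)}.
Proof. by move=> cf cg; exact: (cvgD cf cg). Qed.

Lemma cntN f x : {for x, continuous f} -> {for x, continuous (fun t => - f t)}.
Proof. by move=> cf; exact: (cvgN cf). Qed.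

Lemma cntM f g x : {for x, continuous f} -> {for x, continuous g} ->
  {for x, continuous (fun t => f t * g t)}.
Proof. by move=> cf cg; exact: (cvgM cf cg). Qed.

Lemma cntX2 f x : {for x, continuous f} -> {for x, continuous (fun t => f t ^+ 2)}.
Proof. by move=> cf; exact: (cntM cf cf). Qed.

End ContinuityRules.

(* The head symbol is inspected first: unifying a product with a square up to
   conversion is very slow. *)
Ltac cnt1 F := lazymatch F with
  | (fun t => GRing.add (@?f t) (@?g t)) => notypeclasses refine (@cntD _ _ f g _ _ _)
  | (fun t => GRing.opp (@?f t)) => notypeclasses refine (@cntN _ _ f _ _)
  | (fun t => GRing.exp (@?f t) 2) => notypeclasses refine (@cntX2 _ _ f _ _)
  | (fun t => GRing.mul (@?f t) (@?g t)) => notypeclasses refine (@cntM _ _ f g _ _ _)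
  | _ => first [notypeclasses refine (@cntC _ _ _ _) | eassumption]
  end.
Ltac cnt := repeat lazymatch goal with
  | |- prop_for _ (inPhantom (continuous ?F)) => cnt1 F end.

(** * Interior estimates for axially harmonic functions *)

Section AxialHarmonic.
Variable R : realType.
Implicit Types (u v : R * R -> R) (Q : set (R * R)) (z : R * R).

Definition xder u z d := is_derive z.1 1 (fun t => u (t, z.2)) d.
Definition yder u z d := is_derive z.2 1 (fun t => u (z.1, t)) d.

(** The derivatives are independent functions; that they are derivatives is stated in [axharm].
    Linear combinations and translates are then formed without differentiating. *)
Record jet := Jet
  { j0 : R * R -> R; ja : R * R -> R; jb : R * R -> R;
    jaa : R * R -> R; jbb : R * R -> R }.

(** [j0 U] is a solution of [u_aa + u_bb + (2 / b) u_b = 0]: the function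
    [x |-> u (Re x, |Im x|)] is harmonic on [R^4]. *)
Record axharm Q (U : jet) : Prop := AxHarm
  { ah_a : forall z, Q z -> xder (j0 U) z (ja U z);
    ah_b : forall z, Q z -> yder (j0 U) z (jb U z);
    ah_aa : forall z, Q z -> xder (ja U) z (jaa U z);
    ah_bb : forall z, Q z -> yder (jb U) z (jbb U z);
    ah_eq : forall z, Q z -> z.2 * (jaa U z + jbb U z) + 2 * jb U z = 0;
    ah_c0 : forall z, Q z -> {for z, continuous (j0 U)};
    ah_ca : forall z, Q z -> {for z, continuous (ja U)};
    ah_cb : forall z, Q z -> {for z, continuous (jb U)};
    ah_caa : forall z, Q z -> {for z, continuous (jaa U)};
    ah_cbb : forall z, Q z -> {for z, continuous (jbb U)} }.

Lemma axharmS Q Q' U : Q' `<=` Q -> axharm Q U -> axharm Q' U.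
Proof. by move=> s [? ? ? ? ? ? ? ? ? ?]; split=> z /s; auto. Qed.

Definition jlin k l U V := Jet
  (fun z => k * j0 U z + l * j0 V z) (fun z => k * ja U z + l * ja V z)
  (fun z => k * jb U z + l * jb V z) (fun z => k * jaa U z + l * jaa V z)
  (fun z => k * jbb U z + l * jbb V z).

Definition jshift h U := Jet (fun z => j0 U (z.1 + h, z.2))
  (fun z => ja U (z.1 + h, z.2)) (fun z => jb U (z.1 + h, z.2))
  (fun z => jaa U (z.1 + h, z.2)) (fun z => jbb U (z.1 + h, z.2)).

Lemma cont_lin k l u v z : {for z, continuous u} -> {for z, continuous v} ->
  {for z, continuous (fun z => k * u z + l * v z)}.
Proof.
move=> cu cv; exact: (cvgD (cvgM (cvg_cst _) cu) (cvgM (cvg_cst _) cv)).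
Qed.

Lemma cont_shift h u z : {for (z.1 + h, z.2), continuous u} ->
  {for z, continuous (fun z => u (z.1 + h, z.2))}.
Proof.
move=> cu; apply: (@continuous_comp _ _ _ (fun z : R * R => (z.1 + h, z.2)) u) => //.
by apply: cont_pair; [exact: (cvgD cvg_fst (cvg_cst _))|exact: cvg_snd].
Qed.

Lemma axharm_lin Q k l U V : axharm Q U -> axharm Q V -> axharm Q (jlin k l U V).
Proof.
case=> a1 a2 a3 a4 a5 a6 a7 a8 a9 a10 [b1 b2 b3 b4 b5 b6 b7 b8 b9 b10].
split=> z Qz /=; rewrite /xder /yder /=.
- have h1 := a1 z Qz; have h2 := b1 z Qz; rewrite /xder /yder in h1 h2.
  by der; rewrite /=; ring.
- have h1 := a2 z Qz; have h2 := b2 z Qz; rewrite /xder /yder in h1 h2.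
  by der; rewrite /=; ring.
- have h1 := a3 z Qz; have h2 := b3 z Qz; rewrite /xder /yder in h1 h2.
  by der; rewrite /=; ring.
- have h1 := a4 z Qz; have h2 := b4 z Qz; rewrite /xder /yder in h1 h2.
  by der; rewrite /=; ring.
- rewrite -[RHS](_ : k * (z.2 * (jaa U z + jbb U z) + 2 * jb U z) +
     l * (z.2 * (jaa V z + jbb V z) + 2 * jb V z) = 0); first by ring.
  by rewrite a5 // b5 // !mulr0 addr0.
- by apply: cont_lin; auto.
- by apply: cont_lin; auto.
- by apply: cont_lin; auto.
- by apply: cont_lin; auto.
- by apply: cont_lin; auto.
Qed.

Lemma axharm_shift Q h U : axharm (fun z => Q (z.1 - h, z.2)) U ->
  axharm Q (jshift h U).
Proof.
case=> a1 a2 a3 a4 a5 a6 a7 a8 a9 a10.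
have e (z : R * R) : Q z -> Q ((z.1 + h, z.2).1 - h, (z.1 + h, z.2).2).
  by rewrite /= addrK -surjective_pairing.
split=> z /e Qz /=; rewrite /xder /yder /=.
- exact: (der_shift (a1 _ Qz)).
- exact: (a2 _ Qz).
- exact: (der_shift (a3 _ Qz)).
- exact: (a4 _ Qz).
- exact: (a5 _ Qz).
- exact: (cont_shift (a6 _ Qz)).
- exact: (cont_shift (a7 _ Qz)).
- exact: (cont_shift (a8 _ Qz)).
- exact: (cont_shift (a9 _ Qz)).
- exact: (cont_shift (a10 _ Qz)).
Qed.

Definition box (c : R * R) r : set (R * R) :=
  [set z | `|z.1 - c.1| < r /\ `|z.2 - c.2| < r].

End AxialHarmonic.

(** * A gradient bound by the maximum principle *)

Section GradientEstimate.
Variable R : realType.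
Implicit Types (z c : R * R) (U : jet R) (M rho : R).

Lemma open_box c rho : open (box c rho).
Proof.
rewrite openE => z [hx hy]; rewrite /interior; apply/nbhs_ballP.
exists (Num.min (rho - `|z.1 - c.1|) (rho - `|z.2 - c.2|)) => /=.
  by rewrite lt_min !subr_gt0 hx hy.
move=> w [/= ]; rewrite /ball /= !lt_min => /andP[h1 _] /andP[_ h2].
split; [rewrite -(subrKA z.1)|rewrite -(subrKA z.2)];
  by apply: le_lt_trans (ler_normD _ _) _; rewrite -ltrBrDr distrC.
Qed.

(** Continuity of [g] replaces its differentiability at 0. This is the tool that extracts
    information at the axis from equations carrying a factor [b]. *)
Lemma der_mul0 (g : R -> R) : {for (0 : R), continuous g} ->
  is_derive (0 : R) 1 (fun t => t * g t) (g 0).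
Proof.
move=> /cvgrPdist_le cg; apply/is_deriveP => e e0.
have /nbhs_ballP[r /= r0 hr] := cg e e0; exists r => // h hh.
rewrite add0r mul0r subr0 mulrC -mulrBl normrM ler_wpM2r // distrC.
by apply: hr; rewrite /ball /= sub0r normrN.
Qed.

Lemma cont_line (u : R * R -> R) z : {for z, continuous u} ->
  {for z.2, continuous (fun t => u (z.1, t))}.
Proof.
move=> cu; apply: (@continuous_comp _ _ _ (fun t : R => (z.1, t)) u).
  by apply: cont_pair; [exact: cvg_cst|exact: cvg_id].
by rewrite -surjective_pairing.
Qed.

(** At $b=0$ the equation only says $u_b=0$. Nearby it reads $u_b=-\frac b2(u_{aa}+u_{bb})$, and
    differentiating this in $b$ at 0 gives the limit form of the equation. *)
Lemma axharm_axis (Q : set (R * R)) U x : open Q -> axharm Q U -> Q (x, 0) ->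
  jaa U (x, 0) + 3 * jbb U (x, 0) = 0.
Proof.
move=> oQ hU Q0.
have := ah_bb hU Q0; rewrite /yder /= => d1.
have cg : {for (0 : R), continuous (fun t => - 2^-1 * jaa U (x, t) + (- 2^-1) * jbb U (x, t))}.
  apply: (@cont_line (fun z => - 2^-1 * jaa U z + (- 2^-1) * jbb U z) (x, 0)).
  by apply: cont_lin; [exact: (ah_caa hU)|exact: (ah_cbb hU)].
have d2 := der_mul0 cg.
have /nbhs_ballP[r /= r0 hr] : nbhs (x, 0) Q by apply: open_nbhs_nbhs.
suff : - 2^-1 * jaa U (x, 0) + (- 2^-1) * jbb U (x, 0) = jbb U (x, 0) by lra.
apply: is_derive_uniq d1; apply: (der_near r0 _ d2) => t; rewrite subr0 => ht.
have := ah_eq hU (hr (x, t) _) => /= E.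
have {}E : t * (jaa U (x, t) + jbb U (x, t)) + 2 * jb U (x, t) = 0.
  apply: E; split; rewrite /ball /=; last by rewrite sub0r normrN.
  by rewrite subrr normr0.
by lra.
Qed.

Let box_pm c rho (x1 y1 x y s e : R) : box c (rho / 4) (x1, y1) -> `|x - x1| <= rho / 4 ->
  `|y - c.2| <= rho / 2 -> 0 <= s <= rho / 4 -> e = s \/ e = - s -> box c rho (x + e, y).
Proof.
move=> [/= ]; rewrite !ler_norml !ltr_norml => /andP[? ?] /andP[? ?].
move=> /andP[? ?] /andP[? ?] /andP[? ?] he; split; rewrite /= ltr_norml.
  by case: he => he; apply/andP; split; lra.
by apply/andP; split; lra.
Qed.

(** A barrier minus $\varphi(x,y,s)=u(x+s,y)-u(x-s,y)$. Its part in [y] is a polynomial in $y^2$, so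
    that $(2/y)\partial_y$ keeps it bounded at $y=0$; its part in [s] vanishes at $s=0$, as
    $\varphi$ does. *)
Definition brandt (p q k r2 x1 y1 : R) U (x y s : R) : R :=
  p * (x - x1) ^+ 2 + q * (y ^+ 2 - y1 ^+ 2) ^+ 2 + k * (s * (r2 - s))
  - (j0 U (x + s, y) - j0 U (x - s, y)).

(** At an interior minimum the operator
    $\frac12(\partial_x^2+\partial_s^2)+\partial_y^2+\frac2y\partial_y$ is nonnegative on [Psi]. It
    kills $\varphi$, and on the barrier it equals $p-k+q(20y^2-12y_1^2)$. *)
Lemma brandt_interior (Q : set (R * R)) U (p q k r2 x1 y1 x y s e : R) : open Q -> axharm Q U ->
  0 < e -> 0 <= q ->
  (forall t, `|t - x| < e -> Q (t + s, y) /\ Q (t - s, y)) ->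
  (forall t, `|t - y| < e -> Q (x + s, t) /\ Q (x - s, t)) ->
  (forall t, `|t - s| < e -> Q (x + t, y) /\ Q (x - t, y)) ->
  let Psi := brandt p q k r2 x1 y1 U in
  (forall t, `|t - x| < e -> Psi x y s <= Psi t y s) ->
  (forall t, `|t - y| < e -> Psi x y s <= Psi x t s) ->
  (forall t, `|t - s| < e -> Psi x y s <= Psi x y t) ->
  0 <= p - k + q * (20 * y ^+ 2).
Proof.
move=> oQ hU e0 q0 Qx Qy Qs Psi mx my ms.
have [Q1 Q2] : Q (x + s, y) /\ Q (x - s, y) by apply: Qx; rewrite subrr normr0.
have [_ Dx] : 2 * p * (x - x1) - (ja U (x + s, y) - ja U (x - s, y)) = 0 /\
    0 <= 2 * p - (jaa U (x + s, y) - jaa U (x - s, y)).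
  refine (@min_test2 R (fun t => Psi t y s)
    (fun t => 2 * p * (t - x1) - (ja U (t + s, y) - ja U (t - s, y))) x
    (2 * p - (jaa U (x + s, y) - jaa U (x - s, y))) e e0 _ _ mx).
  - move=> t /Qx[q1 q2]; rewrite /Psi /brandt.
    have h1 := ah_a hU q1; have h2 := ah_a hU q2; rewrite /xder /= in h1 h2.
    have h3 := der_shift h1; have h4 := der_shift h2.
    by der; rewrite /=; ring.
  - have h1 := ah_aa hU Q1; have h2 := ah_aa hU Q2; rewrite /xder /= in h1 h2.
    have h3 := der_shift h1; have h4 := der_shift h2.
    by der; rewrite /=; ring.
have [_ Ds] : k * (r2 - 2 * s) - (ja U (x + s, y) + ja U (x - s, y)) = 0 /\
    0 <= - (2 * k) - (jaa U (x + s, y) - jaa U (x - s, y)).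
  refine (@min_test2 R (fun t => Psi x y t)
    (fun t => k * (r2 - 2 * t) - (ja U (x + t, y) + ja U (x - t, y))) s
    (- (2 * k) - (jaa U (x + s, y) - jaa U (x - s, y))) e e0 _ _ ms).
  - move=> t /Qs[q1 q2]; rewrite /Psi /brandt.
    have h1 := ah_a hU q1; have h2 := ah_a hU q2.
    rewrite /xder /= in h1 h2; have h3 := der_shiftl h1.
    have h4 := der_reflect h2.
    by der; rewrite /=; ring.
  - have h1 := ah_aa hU Q1; have h2 := ah_aa hU Q2.
    rewrite /xder /= in h1 h2; have h3 := der_shiftl h1.
    have h4 := der_reflect h2.
    by der; rewrite /=; ring.
have [D1 Dy] : q * (4 * y * (y ^+ 2 - y1 ^+ 2)) - (jb U (x + s, y) - jb U (x - s, y)) = 0 /\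
    0 <= q * (12 * y ^+ 2 - 4 * y1 ^+ 2) - (jbb U (x + s, y) - jbb U (x - s, y)).
  refine (@min_test2 R (fun t => Psi x t s)
    (fun t => q * (4 * t * (t ^+ 2 - y1 ^+ 2)) - (jb U (x + s, t) - jb U (x - s, t))) y
    (q * (12 * y ^+ 2 - 4 * y1 ^+ 2) - (jbb U (x + s, y) - jbb U (x - s, y))) e e0 _ _ my).
  - move=> t /Qy[q1 q2]; rewrite /Psi /brandt.
    have h1 := ah_b hU q1; have h2 := ah_b hU q2; rewrite /yder /= in h1 h2.
    by der; rewrite /=; ring.
  - have h1 := ah_bb hU Q1; have h2 := ah_bb hU Q2; rewrite /yder /= in h1 h2.
    by der; rewrite /=; ring.
have y10 : 0 <= q * y1 ^+ 2 by rewrite mulr_ge0 // sqr_ge0.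
have y20 : 0 <= q * y ^+ 2 by rewrite mulr_ge0 // sqr_ge0.
(* On the axis the operator becomes $\frac12(\partial_x^2+\partial_s^2)+3\partial_y^2$, and
   [axharm_axis] takes the place of the equation. *)
have [yz|yn] := eqVneq y 0.
  rewrite yz in Q1 Q2 Dx Ds Dy y20 *.
  have A1 := axharm_axis oQ hU Q1; have A2 := axharm_axis oQ hU Q2.
  clear - Dx Ds Dy A1 A2 y10 y20; lra.
have E : (jaa U (x + s, y) - jaa U (x - s, y)) + (jbb U (x + s, y) - jbb U (x - s, y)) =
    - (q * (8 * (y ^+ 2 - y1 ^+ 2))).
  apply: (mulfI yn); have := ah_eq hU Q1; have := ah_eq hU Q2 => /= E1 E2.
  clear - D1 E1 E2; lra.
clear - E Dx Ds Dy y10 y20; lra.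
Qed.

(** Brandt's barrier argument: [u (x + s, y) - u (x - s, y)] satisfies an
    elliptic equation in the three variables [x, y, s]. *)
Lemma brandt_core U c rho M (x1 y1 p q k : R) : 0 < rho ->
  axharm (box c rho) U -> (forall z, box c rho z -> `|j0 U z| <= M) ->
  box c (rho / 4) (x1, y1) -> 0 <= p -> 0 <= q -> 0 <= k ->
  2 * M <= p * (rho / 4) ^+ 2 -> 2 * M <= k * (rho / 4) ^+ 2 ->
  (forall y, `|y - c.2| = rho / 2 -> 2 * M <= q * (y ^+ 2 - y1 ^+ 2) ^+ 2) ->
  (forall y, `|y - c.2| <= rho / 2 -> p - k + q * (20 * y ^+ 2) < 0) ->
  forall s, 0 <= s <= rho / 4 ->
  j0 U (x1 + s, y1) - j0 U (x1 - s, y1) <= k * (s * (rho / 2 - s)).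
Proof.
move=> rho0 hU hM b1 p0 q0 k0 hp hk hq hpde.
set r := rho / 4 in b1 hp hk *.
have r0 : 0 < r by rewrite /r; lra.
(* The range of [y] is centred at [c.2] and not at [y1]: the barrier $(y^2-y_1^2)^2$ also vanishes
   at $y=-y_1$, and the faces $|y-c_2|=\rho/2$ have to avoid that point. *)
pose K : set ((R * R) * R) := (`[x1 - r, x1 + r] `*` `[c.2 - rho / 2, c.2 + rho / 2])
  `*` `[0, r].
pose Psi (t : (R * R) * R) := brandt p q k (rho / 2) x1 y1 U t.1.1 t.1.2 t.2.
have KP x y s : K ((x, y), s) <-> [/\ `|x - x1| <= r, `|y - c.2| <= rho / 2 & 0 <= s <= r].
  rewrite /K /= !in_itv /= !ler_norml; split.
    by move=> [[/andP[? ?] /andP[? ?]] ->]; split=> //; apply/andP; split; lra.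
  by move=> [/andP[? ?] /andP[? ?] ->]; split=> //; split; apply/andP; split; lra.
have inb x y s e : K ((x, y), s) -> e = s \/ e = - s -> box c rho (x + e, y).
  by move=> /KP[? ? ?]; apply: box_pm b1 _ _ _.
(* At [(x1, y1, s)] the terms in [p] and [q] vanish, and nonnegativity of [Psi] is the claimed
   inequality. *)
suff Psi0 t : K t -> 0 <= Psi t.
  move=> s hs; have := Psi0 ((x1, y1), s); rewrite /Psi /brandt /= !subrr expr0n /= !mulr0 !add0r.
  rewrite subr_ge0; apply; apply/KP; split=> //.
    by rewrite subrr normr0 ltW.
  by move: b1 rho0 => [_ /=]; clear; rewrite /r => /ltW; lra.
move: t; have K0 : K !=set0.
  exists ((x1, c.2), 0); apply/KP; rewrite !subrr normr0.
  by split; [exact: ltW|rewrite divr_ge0 ?ltW|rewrite lexx ltW].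
have Kc : compact K.
  by do 2?[apply: compact_setX; last exact: segment_compact]; exact: segment_compact.
have Psic : {within K, continuous Psi}.
  apply: continuous_in_subspaceT => -[[x y] s] /set_mem Kt.
  have cx : {for ((x, y), s), continuous (fun t : (R * R) * R => t.1.1)}.
    by apply: (@continuous_comp _ _ _ (fun t : (R * R) * R => t.1) fst); [exact: cvg_fst|exact: cvg_fst].
  have cy : {for ((x, y), s), continuous (fun t : (R * R) * R => t.1.2)}.
    by apply: (@continuous_comp _ _ _ (fun t : (R * R) * R => t.1) snd); [exact: cvg_fst|exact: cvg_snd].
  have cs : {for ((x, y), s), continuous (fun t : (R * R) * R => t.2)} by exact: cvg_snd.
  have cc a : {for ((x, y), s), continuous (fun t : (R * R) * R => a : R)} by exact: cvg_cst.
  have c1 : {for ((x, y), s), continuous (fun t : (R * R) * R => j0 U (t.1.1 + t.2, t.1.2))}.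
    apply: (@cont_comp2 _ _ _ _ (j0 U)) => //; last by cnt.
    by apply: (ah_c0 hU); apply: (inb _ _ _ _ Kt); left.
  have c2 : {for ((x, y), s), continuous (fun t : (R * R) * R => j0 U (t.1.1 - t.2, t.1.2))}.
    apply: (@cont_comp2 _ _ _ _ (j0 U)) => //; last by cnt.
    by apply: (ah_c0 hU); apply: (inb _ _ _ _ Kt); right.
  have : {for ((x, y), s), continuous Psi} by rewrite /Psi /brandt; cnt.
  exact.
have [[[x y] s] /set_mem Kt tmin] := compact_EVT_min K0 Kc Psic.
move=> t Kt'; apply: le_trans (tmin t (mem_set Kt')); move: t Kt' => _ _.
have tmin' x' y' s' : K ((x', y'), s') -> Psi ((x, y), s) <= Psi ((x', y'), s').
  by move=> h; apply: tmin; exact: mem_set.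
have phiM : j0 U (x + s, y) - j0 U (x - s, y) <= 2 * M.
  have h1 := hM _ (inb _ _ _ _ Kt (or_introl erefl)).
  have h2 := hM _ (inb _ _ _ _ Kt (or_intror erefl)).
  by move: h1 h2; clear; rewrite !ler_norml => /andP[? ?] /andP[? ?]; lra.
move: (Kt) => /KP[hx hy hs]; move: (hs) => /andP[s0 sr].
have B1 : 0 <= p * (x - x1) ^+ 2 by rewrite mulr_ge0 // sqr_ge0.
have B2 : 0 <= q * (y ^+ 2 - y1 ^+ 2) ^+ 2 by rewrite mulr_ge0 // sqr_ge0.
have rr : rho / 2 = 2 * r by rewrite /r; clear; field.
have B3 : 0 <= k * (s * (rho / 2 - s)).
  by rewrite !mulr_ge0 // rr; move: s0 sr; clear; lra.
have PsiE : Psi ((x, y), s) = p * (x - x1) ^+ 2 + q * (y ^+ 2 - y1 ^+ 2) ^+ 2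
  + k * (s * (rho / 2 - s)) - (j0 U (x + s, y) - j0 U (x - s, y)) by [].
(* Face by face: at $s=0$ the difference of [u] vanishes; on every other face a single term of the
   barrier exceeds $2M$, which bounds that difference. At $s=r$ the factor $s(\rho/2-s)$ equals
   $r^2$, since $\rho/2=2r$. *)
have [s00|sn0] := eqVneq s 0.
  have e : j0 U (x + s, y) - j0 U (x - s, y) = 0 by rewrite s00 addr0 subr0 subrr.
  by rewrite PsiE e subr0 !addr_ge0.
have Psi2M : 2 * M <= p * (x - x1) ^+ 2 + q * (y ^+ 2 - y1 ^+ 2) ^+ 2
    + k * (s * (rho / 2 - s)) -> 0 <= Psi ((x, y), s).
  by move=> h; rewrite PsiE subr_ge0; exact: le_trans phiM h.
have [sr'|snr] := eqVneq s r.
  apply: Psi2M; rewrite (le_trans hk) // -[leLHS]add0r lerD ?addr_ge0 //.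
  by rewrite rr sr' mulr_natl mulr2n addrK expr2.
have [xr|xnr] := eqVneq `|x - x1| r.
  apply: Psi2M; rewrite (le_trans hp) // -xr real_normK ?num_real //.
  by rewrite -addrA lerDl addr_ge0.
have [yr|ynr] := eqVneq `|y - c.2| (rho / 2).
  apply: Psi2M; rewrite (le_trans (hq _ yr)) //.
  by rewrite addrAC lerDr addr_ge0.
(* The minimum is now interior, and [hpde] contradicts the second order condition. The radius [e]
   keeps all three coordinate segments inside [K]. *)
exfalso.
have {}sn0 : 0 < s by rewrite lt_neqAle eq_sym sn0.
have {}snr : s < r by rewrite lt_neqAle snr.
have {}xnr : `|x - x1| < r by rewrite lt_neqAle xnr.
have {}ynr : `|y - c.2| < rho / 2 by rewrite lt_neqAle ynr.
pose e := Num.min (Num.min s (r - s)) (Num.min (r - `|x - x1|) (rho / 2 - `|y - c.2|)).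
have e0 : 0 < e by rewrite !lt_min !subr_gt0 sn0 snr xnr ynr.
have eP t : `|t| < e -> [/\ `|t| < s, `|t| < r - s, `|t| < r - `|x - x1|
    & `|t| < rho / 2 - `|y - c.2|].
  by rewrite !lt_min => /andP[/andP[-> ->] /andP[-> ->]].
have Kx t : `|t - x| < e -> K ((t, y), s).
  move=> /eP[_ _ ht _]; apply/KP; split=> //; rewrite -(subrKA x).
  by apply: le_trans (ler_normD _ _) _; rewrite -lerBrDr ltW.
have Ky t : `|t - y| < e -> K ((x, t), s).
  move=> /eP[_ _ _ ht]; apply/KP; split=> //; rewrite -(subrKA y).
  by apply: le_trans (ler_normD _ _) _; rewrite -lerBrDr ltW.
have Ks t : `|t - s| < e -> K ((x, y), t).
  move=> /eP[h1 h2 _ _]; apply/KP; split=> //; move: h1 h2; rewrite !ltr_norml.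
  by clear; move=> /andP[? ?] /andP[? ?]; apply/andP; split; lra.
have bK x' y' s' : K ((x', y'), s') -> box c rho (x' + s', y') /\ box c rho (x' - s', y').
  by move=> h; split; apply: (inb _ _ _ _ h); [left|right].
have := hpde y hy; rewrite ltNge => /negP; apply.
apply: (@brandt_interior (box c rho) U p q k (rho / 2) x1 y1 x y s e (@open_box c rho)
  hU e0 q0).
- by move=> t /Kx /bK.
- by move=> t /Ky /bK.
- by move=> t /Ks /bK.
- by move=> t /Kx; exact: tmin'.
- by move=> t /Ky; exact: tmin'.
- by move=> t /Ks; exact: tmin'.
Qed.

End GradientEstimate.

Section GradientEstimate2.
Variable R : realType.
Implicit Types (z c : R * R) (U : jet R) (M rho : R).

Lemma der_bound (f : R -> R) (x d r K : R) : 0 < r -> is_derive x 1 f d ->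
  (forall h, `|h| < r -> `|f (x + h) - f x| <= K * `|h|) -> `|d| <= K.
Proof.
move=> r0 /is_deriveP H hf; apply/ler_addgt0Pl => e e0.
have [r' r'0 hr'] := H e e0.
have m0 : 0 < Num.min r r' by rewrite lt_min r0.
pose h := Num.min r r' / 2.
have h0 : 0 < h by rewrite /h; lra.
have hlt : h < Num.min r r' by rewrite /h; lra.
move: hlt; rewrite lt_min => /andP[hr hhr'].
have := hr' h; have := hf h; rewrite gtr0_norm // => /(_ hr) h1 /(_ hhr') h2.
rewrite -(ler_pM2r h0) -[X in `|d| * X]gtr0_norm // -normrM mulrDl.
move: h1 h2; rewrite !ler_norml => /andP[? ?] /andP[? ?]; apply/andP; split; lra.
Qed.

Lemma box_le c (r s : R) : r <= s -> box c r `<=` box c s.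
Proof. by move=> rs z [h1 h2]; split; [apply: lt_le_trans h1 _|apply: lt_le_trans h2 _]. Qed.

Lemma box_move c (r h : R) z : box c r z -> box c (r + `|h|) (z.1 + h, z.2).
Proof.
move=> [h1 h2]; split=> /=; last by apply: lt_le_trans h2 _; rewrite lerDl.
by rewrite addrAC; apply: le_lt_trans (ler_normD _ _) _; rewrite ltrD2r.
Qed.

(** On the axis $y^2-y_1^2\ge\rho^2/4-\rho^2/16=3\rho^2/16$. Away from it $|y-y_1|\ge\rho/4$ and
    $|y+y_1|\ge5\rho/4$ give the larger bound $5\rho^2/16$. *)
Lemma kappa_le (c2 rho y y1 : R) : 0 < rho -> c2 = 0 \/ rho <= `|c2| ->
  `|y - c2| = rho / 2 -> `|y1 - c2| < rho / 4 ->
  (3 * rho ^+ 2 / 16) ^+ 2 <= (y ^+ 2 - y1 ^+ 2) ^+ 2.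
Proof.
move=> rho0 hc hy hy1.
have a0 : 0 <= 3 * rho ^+ 2 / 16 by have := sqr_ge0 rho; lra.
rewrite -[leRHS]real_normK ?num_real // ler_sqr ?nnegrE // subr_sqr normrM.
have h1 : rho / 4 <= `|y - y1|.
  have -> : y - y1 = (y - c2) - (y1 - c2) by ring.
  by apply: le_trans (lerB_dist _ _); rewrite hy; lra.
case: hc => hc.
  move: hy hy1; rewrite hc !subr0 => hy hy1.
  have h2 : y1 ^+ 2 <= rho ^+ 2 / 16.
    have -> : rho ^+ 2 / 16 = (rho / 4) ^+ 2 by field.
    by rewrite -[leLHS]real_normK ?num_real // ler_sqr ?nnegrE // ?ltW //; lra.
  have h3 : y ^+ 2 = rho ^+ 2 / 4.
    by rewrite -[LHS]real_normK ?num_real // hy; field.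
  rewrite -normrM -subr_sqr ger0_norm; lra.
have h2 : 5 * rho / 4 <= `|y + y1|.
  have -> : y + y1 = 2 * c2 + ((y - c2) + (y1 - c2)) by ring.
  apply: le_trans (lerB_normD _ _); rewrite normrM ger0_norm ?ler0n //.
  by have := ler_normD (y - c2) (y1 - c2); lra.
apply: le_trans (ler_pM _ _ h1 h2); [|lra|lra].
have -> : rho / 4 * (5 * rho / 4) = 5 * rho ^+ 2 / 16 by field.
by have := sqr_ge0 rho; lra.
Qed.

(** Both sides of the barrier bound vanish at $s=0$; comparing their derivatives there gives
    $2u_a\le Mk\rho/2$. *)
Lemma grad_a1 c rho : 0 < rho -> c.2 = 0 \/ rho <= `|c.2| ->
  exists2 C, 0 < C & forall U M, 0 < M -> axharm (box c rho) U ->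
  (forall z, box c rho z -> `|j0 U z| <= M) ->
  forall z, box c (rho / 4) z -> ja U z <= C * M.
Proof.
move=> rho0 hc; pose r := rho / 4; pose Y := `|c.2| + rho.
have r0 : 0 < r by rewrite /r; lra.
pose kappa := (3 * rho ^+ 2 / 16) ^+ 2.
have ka0 : 0 < kappa by rewrite /kappa !exprn_gt0 // divr_gt0 ?mulr_gt0 ?exprn_gt0 ?ltr0n.
(* Scaled by [M], the coefficients [p] and [q] reach $2M$ on the faces in [x] and [y]. As [Y] bounds
   $|y|$, the choice of [k] leaves a margin [M * p] in the differential inequality. *)
pose p := 2 / r ^+ 2; pose q := 2 / kappa; pose k := 2 * p + 20 * q * Y ^+ 2.
have p0 : 0 < p by rewrite divr_gt0 ?exprn_gt0.
have q0 : 0 < q by rewrite divr_gt0.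
have qY : 0 <= q * Y ^+ 2 by rewrite mulr_ge0 ?sqr_ge0 ?ltW.
have k0 : 0 < k by rewrite /k -mulrA; lra.
exists (r * k); first by rewrite mulr_gt0.
move=> U M M0 hU hM [x1 y1] b1.
have core : forall s, 0 <= s <= rho / 4 ->
  j0 U (x1 + s, y1) - j0 U (x1 - s, y1) <= (M * k) * (s * (rho / 2 - s)).
  apply: (@brandt_core _ U c rho M x1 y1 (M * p) (M * q) (M * k)) => //;
    rewrite -/r; try by rewrite mulr_ge0 ?ltW.
  - by rewrite /p -mulrA divfK ?expf_neq0 ?gt_eqF // mulrC.
  - have -> : M * k * r ^+ 2 = 2 * (M * (p * r ^+ 2)) + M * (20 * (q * Y ^+ 2)) * r ^+ 2.
      by rewrite /k; ring.
    rewrite /p divfK ?expf_neq0 ?gt_eqF //.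
    have hk0 : 0 <= M * (20 * (q * Y ^+ 2)) * r ^+ 2.
      by rewrite mulr_ge0 ?sqr_ge0 // (mulr_ge0 (ltW M0)) // mulr_ge0.
    by move: hk0 M0; clear; lra.
  - move=> y hy; have := kappa_le rho0 hc hy (proj2 b1); rewrite -/kappa /= => hk.
    rewrite -mulrA (mulrC 2) ler_pM2l //.
    by rewrite /q mulrAC ler_pdivlMr // ler_pM2l.
  - move=> y hy; have -> : M * p - M * k + M * q * (20 * y ^+ 2) =
      M * (- p + 20 * (q * y ^+ 2 - q * Y ^+ 2)) by rewrite /k; ring.
    rewrite pmulr_rlt0 //.
    have : q * y ^+ 2 <= q * Y ^+ 2.
      rewrite ler_pM2l // -[leLHS]real_normK ?num_real // ler_sqr ?nnegrE //;
        last by rewrite /Y addr_ge0 // ltW.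
      rewrite /Y -(subrKC c.2 y); apply: le_trans (ler_normD _ _) _.
      by rewrite lerD2l; lra.
    by lra.
have d1 : is_derive x1 1 (fun t => j0 U (t, y1)) (ja U (x1, y1)).
  by apply: (ah_a hU (z := (x1, y1))); apply: box_le b1; lra.
have e1 : is_derive (0 : R) 1 (fun t => j0 U (t + x1, y1)) (ja U (x1, y1)).
  by apply: (@der_shift _ (fun t => j0 U (t, y1))); rewrite add0r.
have e2 : is_derive (0 : R) 1 (fun t => j0 U (x1 - t, y1)) (- ja U (x1, y1)).
  by apply: (@der_reflect _ (fun t => j0 U (t, y1))); rewrite subr0.
have e3 : is_derive (0 : R) 1 (fun s => (M * k) * (s * (rho / 2 - s))
    - (j0 U (s + x1, y1) - j0 U (x1 - s, y1))) (M * k * (rho / 2) - 2 * ja U (x1, y1)).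
  by der; rewrite /=; ring.
have := derive_ge0_right r0 e3; rewrite /= mul0r mulr0 !add0r !subr0 subrr oppr0 => H.
have {H} : 0 <= M * k * (rho / 2) - 2 * ja U (x1, y1).
  apply: H => h /andP[h0 hr]; rewrite add0r subr_ge0 (addrC h).
  by apply: core; rewrite !ltW.
by rewrite /r; lra.
Qed.

Lemma grad_a c rho : 0 < rho -> c.2 = 0 \/ rho <= `|c.2| ->
  exists2 C, 0 < C & forall U M, 0 < M -> axharm (box c rho) U ->
  (forall z, box c rho z -> `|j0 U z| <= M) ->
  forall z, box c (rho / 4) z -> `|ja U z| <= C * M.
Proof.
move=> rho0 hc; have [C C0 hC] := grad_a1 rho0 hc; exists C => // U M M0 hU hM z bz.
rewrite ler_norml (hC U M) // andbT.
(* This combination is [- U], for which the upper bound becomes the missing lower bound. *)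
have := hC (jlin (-1) 0 U U) M M0 (axharm_lin (-1) 0 hU hU) _ z bz; rewrite /=.
rewrite mul0r addr0 mulN1r => H; suff : - ja U z <= C * M by lra.
by apply: H => w /hM; rewrite mul0r addr0 mulN1r normrN.
Qed.

(** At this stage $u_a$ is not known to solve the equation. The first order estimate is therefore
    applied to difference quotients of [u] in [a], which solve it and are bounded by the mean value
    theorem. A shift of size below $\rho/8$ keeps the box of radius $\rho/8$ inside the one of
    radius $\rho/4$; the second use of [grad_a] leaves $\rho/32$. *)
Lemma grad_aa c rho : 0 < rho -> c.2 = 0 \/ rho <= `|c.2| ->
  exists2 C, 0 < C & forall U M, 0 < M -> axharm (box c rho) U ->
  (forall z, box c rho z -> `|j0 U z| <= M) ->
  forall z, box c (rho / 32) z -> `|jaa U z| <= C * M.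
Proof.
move=> rho0 hc; have [C1 C10 h1] := grad_a rho0 hc.
have rho8 : 0 < rho / 8 by lra.
have hc8 : c.2 = 0 \/ rho / 8 <= `|c.2| by case: hc => h; [left|right; lra].
have [C2 C20 h2] := grad_a rho8 hc8.
exists (C2 * C1); first exact: mulr_gt0.
move=> U M M0 hU hM z bz.
have bz4 : box c rho z by apply: box_le bz; lra.
apply: (@der_bound (fun t => ja U (t, z.2)) z.1 _ (rho / 8)) => //.
  exact: (ah_aa hU bz4).
move=> h hh; have [->|h0] := eqVneq h 0; first by rewrite addr0 subrr normr0 mulr0.
pose V := jlin h^-1 (- h^-1) (jshift h U) U.
have hV : axharm (box c (rho / 8)) V.
  apply: axharm_lin; last by apply: axharmS hU; apply: box_le; lra.
  apply: axharm_shift; apply: axharmS hU => w /= /(@box_move c _ h) /=.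
  by rewrite subrK -surjective_pairing; apply: box_le; lra.
have hVM w : box c (rho / 8) w -> `|j0 V w| <= C1 * M.
  move=> bw /=; rewrite mulNr -mulrBr normrM normfV mulrC ler_pdivrMr ?normr_gt0 //.
  have -> : `|h| = `|(w.1 + h) - w.1| by rewrite addrAC subrr add0r.
  rewrite [in j0 U w](surjective_pairing w).
  have bt x : between w.1 (w.1 + h) x -> box c (rho / 4) (x, w.2).
    move=> bx; have [w1 w2] := bw; split=> /=; last by lra.
    apply: (between_ball _ _ bx); first by lra.
    by have [/= h3 _] := box_move h bw; lra.
  apply: (@mvt_bound _ (fun t => j0 U (t, w.2)) (fun t => ja U (t, w.2))) => x /bt bx.
    by apply: (ah_a hU (z := (x, w.2))); apply: box_le bx; lra.
  exact: h1.
have := h2 V (C1 * M) (mulr_gt0 C10 M0) hV hVM z _; rewrite /= mulNr -mulrBr normrM normfV.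
have -> : rho / 8 / 4 = rho / 32 by field.
move=> /(_ bz); rewrite mulrC ler_pdivrMr ?normr_gt0 // mulrA.
by rewrite -surjective_pairing.
Qed.

(** The equation is $(b^2u_b)_b=-b^2u_{aa}$, so a bound of $u_{aa}$ integrates to one of $u_b$, and
    the equation returns $u_{bb}$. On the axis the integration starts from the value 0 at $b=0$. *)
Lemma grad_b c rho : 0 < rho -> c.2 = 0 \/ 2 * rho <= `|c.2| ->
  exists2 C, 0 < C & forall U M, 0 < M -> axharm (box c rho) U ->
  (forall z, box c rho z -> `|j0 U z| <= M) ->
  (forall z, box c rho z -> `|jaa U z| <= M) ->
  forall z, box c rho z -> `|jb U z| <= C * M /\ `|jbb U z| <= C * M.
Proof.
move=> rho0 hc.
have dTheta U x : axharm (box c rho) U -> forall t, box c rho (x, t) ->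
    is_derive t 1 (fun s => s ^+ 2 * jb U (x, s)) (- (t ^+ 2 * jaa U (x, t))).
  move=> hU t bt; have := ah_bb hU bt; rewrite /yder /= => d1.
  by der; have := ah_eq hU bt; rewrite /= => E; rewrite -[LHS]addr0 -(mulr0 (- t)) -E; ring.
have bbox x y y' t : box c rho (x, y) -> box c rho (x, y') -> between y y' t ->
    box c rho (x, t).
  by move=> [/= h1 h2] [/= _ h3] bt; split=> //=; apply: between_ball bt.
case: hc => hc.
  exists (rho + 3); first by lra.
  move=> U M M0 hU hM haa [x y] bz.
  have [y0|y0] := eqVneq y 0.
    rewrite y0 in bz *; have /= := ah_eq hU bz; rewrite mul0r add0r => /eqP.
    rewrite mulf_eq0 pnatr_eq0 /= => /eqP ->; rewrite normr0; split.
      by rewrite mulr_ge0 //; lra.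
    have := axharm_axis (@open_box _ c rho) hU bz; have := haa _ bz.
    have : 0 <= rho * M by rewrite mulr_ge0 ?ltW.
    by rewrite !ler_norml => ? /andP[? ?] ?; apply/andP; split; lra.
  have by0 : box c rho (x, 0) by have [/= h1 h2] := bz; split; rewrite //= hc subrr normr0.
  have hT : `|y ^+ 2 * jb U (x, y)| <= `|y| ^+ 2 * M * `|y|.
    have := @mvt_bound _ (fun s => s ^+ 2 * jb U (x, s)) (fun t => - (t ^+ 2 * jaa U (x, t)))
      0 y (`|y| ^+ 2 * M); rewrite /= expr0n /= mul0r !subr0; apply.
      by move=> t bt; apply: dTheta => //; apply: bbox by0 bz bt.
    move=> t bt; rewrite normrN normrM normrX; apply: ler_pM => //.
    - rewrite ler_sqr ?nnegrE //; have := between_le_norm bt; by rewrite !subr0.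
    - by apply: haa; apply: bbox by0 bz bt.
  have hb : `|jb U (x, y)| <= `|y| * M.
    move: hT; rewrite normrM normrX -mulrA ler_pM2l ?exprn_gt0 ?normr_gt0 //.
    by rewrite mulrC.
  have yr : `|y| < rho by have [_ /=] := bz; rewrite hc subr0.
  split.
    apply: le_trans hb _; rewrite ler_pM2r //; lra.
  have hq : `|jb U (x, y) / y| <= M.
    by rewrite normrM normfV ler_pdivrMr ?normr_gt0 // mulrC.
  have -> : jbb U (x, y) = - jaa U (x, y) - 2 * (jb U (x, y) / y).
    have := ah_eq hU bz => /= E; apply: (mulfI y0); rewrite mulrBr mulrCA.
    by rewrite (mulrCA y) divff // mulr1; lra.
  have := haa _ bz; move: hq; set w := jb _ _ / _.
  have : 0 <= rho * M by rewrite mulr_ge0 ?ltW.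
  by rewrite !ler_norml => ? /andP[? ?] /andP[? ?]; apply/andP; split; lra.
pose Y := `|c.2| + rho.
have Y0 : 0 < Y by rewrite /Y; have := normr_ge0 c.2; lra.
pose C1 := (Y ^+ 2 * (4 / rho) + Y ^+ 2 * (2 * rho)) / rho ^+ 2.
have C10 : 0 < C1.
  have Y2 : 0 < Y ^+ 2 by exact: exprn_gt0.
  have r4 : 0 < 4 / rho by rewrite divr_gt0.
  have r2 : 0 < 2 * rho by lra.
  have rr : 0 < rho ^+ 2 by exact: exprn_gt0.
  by apply: divr_gt0 => //; apply: addr_gt0; exact: mulr_gt0.
have C1r : 0 < 2 * C1 / rho by apply: divr_gt0 => //; apply: mulr_gt0.
exists (C1 + 1 + 2 * C1 / rho); first by lra.
move=> U M M0 hU hM haa [x y] bz.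
have bnd t : box c rho (x, t) -> `|t| <= Y /\ rho <= `|t|.
  move=> [_ /= ht]; split.
    by rewrite /Y -(subrKC c.2 t); apply: le_trans (ler_normD _ _) _; lra.
  rewrite -(subrKC c.2 t); apply: le_trans (lerB_normD _ _); lra.
have bc : box c rho (x, c.2) by have [/= h1 _] := bz; split; rewrite //= subrr normr0.
have bc' : box c rho (x, c.2 + rho / 2).
  by have [/= h1 _] := bz; split; rewrite //= addrAC subrr add0r ger0_norm; lra.
(* Away from the axis a starting value for $b^2u_b$ is missing. A mean value point of [u] on a
   segment of length [rho / 2] supplies one, with $|u_b|\le4M/\rho$. *)
have [t0 bt0 e0] := @mvt _ (fun t => j0 U (x, t)) (fun t => jb U (x, t)) c.2 (c.2 + rho / 2)
  (fun t bt => ah_b hU (bbox _ _ _ _ bc bc' bt)).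
have {bt0}bt0 := bbox _ _ _ _ bc bc' bt0.
have hb0 : `|jb U (x, t0)| <= 4 / rho * M.
  have -> : jb U (x, t0) = (j0 U (x, c.2 + rho / 2) - j0 U (x, c.2)) * (2 / rho).
    by rewrite e0; field; rewrite gt_eqF.
  have h1 := hM _ bc; have h2 := hM _ bc'; have := ler_normB (j0 U (x, c.2 + rho / 2)) (j0 U (x, c.2)).
  have r2 : 0 < 2 / rho by rewrite divr_gt0.
  move=> h3; rewrite normrM (gtr0_norm r2).
  have -> : 4 / rho * M = (2 * M) * (2 / rho) by field; rewrite gt_eqF.
  by rewrite ler_pM2r //; move: h1 h2 h3; clear; lra.
have sqY t : box c rho (x, t) -> `|t ^+ 2| <= Y ^+ 2.
  by move=> /bnd[? _]; rewrite normrX ler_sqr ?nnegrE // ltW.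
have hT : `|y ^+ 2 * jb U (x, y)| <= C1 * M * rho ^+ 2.
  have h1 : `|y ^+ 2 * jb U (x, y) - t0 ^+ 2 * jb U (x, t0)| <= Y ^+ 2 * M * `|y - t0|.
    apply: (@mvt_bound _ (fun s => s ^+ 2 * jb U (x, s)) (fun t => - (t ^+ 2 * jaa U (x, t)))).
      by move=> t bt; apply: dTheta => //; apply: bbox bt0 bz bt.
    move=> t bt; have btt := bbox _ _ _ _ bt0 bz bt.
    by rewrite normrN normrM; apply: ler_pM => //; [exact: sqY|exact: haa].
  have h2 : `|y - t0| <= 2 * rho.
    have -> : y - t0 = (y - c.2) - (t0 - c.2) by ring.
    apply: le_trans (ler_normB _ _) _; have [_ /=] := bz; have [_ /=] := bt0; lra.
  have h3 : `|t0 ^+ 2 * jb U (x, t0)| <= Y ^+ 2 * (4 / rho * M).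
    by rewrite normrM; apply: ler_pM => //; exact: sqY.
  rewrite -(subrK (t0 ^+ 2 * jb U (x, t0)) (y ^+ 2 * jb U (x, y))).
  apply: le_trans (ler_normD _ _) _.
  have -> : C1 * M * rho ^+ 2 = Y ^+ 2 * M * (2 * rho) + Y ^+ 2 * (4 / rho * M).
    by rewrite /C1; field; rewrite gt_eqF.
  apply: lerD => //; apply: le_trans h1 _; rewrite ler_pM2l // mulr_gt0 ?exprn_gt0 //.
have [yY ry] := bnd _ bz.
have y0 : y != 0 by rewrite -normr_gt0; lra.
have hb : `|jb U (x, y)| <= C1 * M.
  rewrite -(ler_pM2r (x := rho ^+ 2)) ?exprn_gt0 //; apply: le_trans hT.
  by rewrite normrM mulrC ler_wpM2r // normrX ler_sqr ?nnegrE // ltW.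
have C1M : 0 < C1 * M by rewrite mulr_gt0.
have C1rM : 0 < 2 * C1 / rho * M by rewrite mulr_gt0.
split; first by apply: le_trans hb _; lra.
have hq : `|jb U (x, y) / y| <= C1 / rho * M.
  have -> : C1 / rho * M = C1 * M / rho by field; rewrite gt_eqF.
  rewrite normrM normfV; apply: ler_pM => //.
  by rewrite lef_pV2 ?posrE // normr_gt0.
have -> : jbb U (x, y) = - jaa U (x, y) - 2 * (jb U (x, y) / y).
  have := ah_eq hU bz => /= E; apply: (mulfI y0); rewrite mulrBr mulrCA.
  by rewrite (mulrCA y) divff // mulr1; lra.
have := haa _ bz; move: hq C1rM; set w := jb _ _ / _.
have -> : 2 * C1 / rho * M = 2 * (C1 / rho * M) by ring.
set v := C1 / rho * M.
have -> : (C1 + 1 + 2 * C1 / rho) * M = C1 * M + M + 2 * v by rewrite /v; ring.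
by rewrite !ler_norml => /andP[? ?] ? /andP[? ?]; apply/andP; split; lra.
Qed.

End GradientEstimate2.

(** * Uniform limits of axially harmonic functions *)

Section Weierstrass.
Variable R : realType.
Implicit Types (z c : R * R) (U V : jet R) (M rho : R) (e : nat -> R).

(** Weaker than convergence to 0. The estimates below hold for each [n] separately, so one good
    index is enough. *)
Definition vanishing e := forall d, 0 < d -> exists n, e n < d.

Lemma vanishingZ e k : 0 < k -> vanishing e -> vanishing (fun n => k * e n).
Proof.
move=> k0 ve d d0; have [n hn] := ve (d / k) (divr_gt0 d0 k0); exists n.
by rewrite mulrC -ltr_pdivlMr.
Qed.

Lemma le_vanishing e (a b : R) : vanishing e -> (forall n, a <= b + e n) -> a <= b.
Proof.
move=> ve h; apply/ler_addgt0Pr => d d0; have [n hn] := ve d d0.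
by apply: le_trans (h n) _; rewrite lerD2l ltW.
Qed.

(** The limit is the supremum of the lower bounds [a n - e n], each of which lies below every
    [a m + e m]. *)
Lemma sup_limit e (a : nat -> R) : (forall n m, `|a n - a m| <= e n + e m) ->
  exists l, forall n, `|a n - l| <= e n.
Proof.
move=> h; pose A : set R := range (fun n => a n - e n).
have hle n m : a n - e n <= a m + e m.
  by have := h n m; rewrite ler_norml => /andP[_]; lra.
have A0 : A !=set0 by exists (a 0%N - e 0%N); exists 0%N.
have uA n : ubound A (a n + e n) by move=> _ [m _ <-].
exists (sup A) => n; rewrite ler_norml; apply/andP; split.
  have : sup A <= a n + e n by apply: ge_sup.
  by lra.
have : a n - e n <= sup A by apply: ub_le_sup; [exists (a 0%N + e 0%N)|exists n].
by lra.
Qed.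

(** The mean value theorem for [f n - f m], with [m] chosen to make [e m] small, bounds the
    increments of [f n - f'] by [e n * |h|]; so the difference quotients of [f'] are close to those
    of a single [f n]. *)
Lemma limit_derive (f g : nat -> R -> R) (f' g' : R -> R) (x r : R) e :
  0 < r -> vanishing e ->
  (forall n t, `|t - x| < r -> is_derive t 1 (f n) (g n t)) ->
  (forall n t, `|t - x| < r -> `|f n t - f' t| <= e n) ->
  (forall n t, `|t - x| < r -> `|g n t - g' t| <= e n) ->
  is_derive x 1 f' (g' x).
Proof.
move=> r0 ve fg hf hg.
have xx : `|x - x| < r by rewrite subrr normr0.
have incr n h : `|h| < r ->
    `|(f n (x + h) - f' (x + h)) - (f n x - f' x)| <= e n * `|h|.
  move=> hr; have xh : `|x + h - x| < r by rewrite addrAC subrr add0r.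
  apply: (@le_vanishing (fun m => (`|h| + 2) * e m)).
    by apply: vanishingZ => //; have := normr_ge0 h; lra.
  move=> m; have H : `|(f n (x + h) - f m (x + h)) - (f n x - f m x)| <= (e n + e m) * `|h|.
    have -> : `|h| = `|x + h - x| by rewrite addrAC subrr add0r.
    apply: (@mvt_bound _ (fun t => f n t - f m t) (fun t => g n t - g m t)) => t bt.
      by have h1 := fg n t (between_ball xx xh bt);
         have h2 := fg m t (between_ball xx xh bt); der.
    have := hg n t (between_ball xx xh bt); have := hg m t (between_ball xx xh bt).
    by clear; rewrite !ler_norml => /andP[? ?] /andP[? ?]; apply/andP; split; lra.
  have := hf m _ xx; have := hf m _ xh; move: H; clear.
  have -> : (e n + e m) * `|h| = e n * `|h| + e m * `|h| by ring.
  have -> : (`|h| + 2) * e m = e m * `|h| + 2 * e m by ring.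
  set a := e n * _; set b := e m * _.
  by rewrite !ler_norml => /andP[? ?] /andP[? ?] /andP[? ?]; apply/andP; split; lra.
apply/is_deriveP => d d0; have [n hn] := ve (d / 4) (ltac:(lra)).
have /is_deriveP/(_ (d / 2))[|s s0 hs] := fg n x xx; first by lra.
exists (Num.min r s); first by rewrite lt_min r0.
move=> h; rewrite lt_min => /andP[hr /hs h1].
have h2 := incr n h hr; have h3 := hg n x xx.
have {}h3 : `|(g n x - g' x) * h| <= d / 4 * `|h|.
  by rewrite normrM ler_wpM2r //; lra.
have {}h2 : `|f n (x + h) - f' (x + h) - (f n x - f' x)| <= d / 4 * `|h|.
  by apply: le_trans h2 _; rewrite ler_wpM2r // ltW.
move: h1 h2 h3; clear; rewrite mulrBl.
have -> : d / 2 * `|h| = 2 * (d / 4 * `|h|) by field.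
have -> : d * `|h| = 4 * (d / 4 * `|h|) by field.
set a := d / 4 * _; set b := g n x * h; set b' := g' x * h.
by rewrite !ler_norml => /andP[? ?] /andP[? ?] /andP[? ?]; apply/andP; split; lra.
Qed.

Lemma limit_continuous (T : topologicalType) (f : nat -> T -> R) (f' : T -> R) x (Q : set T) e :
  nbhs x Q -> vanishing e -> (forall n, {for x, continuous (f n)}) ->
  (forall n t, Q t -> `|f n t - f' t| <= e n) -> {for x, continuous f'}.
Proof.
move=> Qx ve cf hf; apply/cvgrPdist_le => d d0.
have [n hn] := ve (d / 4) (ltac:(lra)).
have /cvgrPdist_le/(_ (d / 2)) H := cf n.
have {}H := H (ltac:(lra)); near=> t.
have h1 : `|f n x - f n t| <= d / 2 by near: t.
have h2 : `|f n t - f' t| <= e n by apply: hf; near: t.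
have h3 : `|f n x - f' x| <= e n by apply: hf; exact: nbhs_singleton.
move: h1 h2 h3 hn; clear.
by rewrite !ler_norml => /andP[? ?] /andP[? ?] /andP[? ?] ?; apply/andP; split; lra.
Unshelve. all: by end_near. Qed.

Definition jbound U K z := [/\ `|j0 U z| <= K, `|ja U z| <= K, `|jb U z| <= K,
  `|jaa U z| <= K & `|jbb U z| <= K].

Lemma interior_estimate c rho : 0 < rho -> c.2 = 0 \/ rho <= `|c.2| ->
  exists2 C, 0 < C & forall U M, 0 < M -> axharm (box c rho) U ->
  (forall z, box c rho z -> `|j0 U z| <= M) ->
  forall z, box c (rho / 32) z -> jbound U (C * M) z.
Proof.
move=> rho0 hc; have [C1 C10 h1] := grad_a rho0 hc; have [C2 C20 h2] := grad_aa rho0 hc.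
have [||C3 C30 h3] := @grad_b R c (rho / 32); first by lra.
  by case: hc => h; [left|right; lra].
exists (C1 + C2 + 1 + C3 * (C2 + 1)).
  by have : 0 < C3 * (C2 + 1); [rewrite mulr_gt0 //; lra|lra].
move=> U M M0 hU hM z bz.
have b4 : box c (rho / 4) z by apply: box_le bz; lra.
have b0 : box c rho z by apply: box_le bz; lra.
have M20 : 0 < (C2 + 1) * M by rewrite mulr_gt0 //; lra.
have [|||H1 H2] := h3 U _ M20 _ _ _ z bz.
- by apply: axharmS hU; apply: box_le; lra.
- move=> w bw; apply: le_trans (hM w _) _; first by apply: box_le bw; lra.
  by rewrite mulrDl mul1r lerDr mulr_ge0 ?ltW.
- move=> w bw; apply: le_trans (h2 U M M0 hU hM w bw) _.
  by rewrite ler_pM2r //; lra.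
have H3 := h1 U M M0 hU hM z b4; have H4 := h2 U M M0 hU hM z bz.
have H5 := hM z b0.
have p1 : 0 < C1 * M by rewrite mulr_gt0.
have p2 : 0 < C2 * M by rewrite mulr_gt0.
have p3 : 0 < C3 * ((C2 + 1) * M) by rewrite mulr_gt0.
have -> : (C1 + C2 + 1 + C3 * (C2 + 1)) * M =
  C1 * M + C2 * M + M + C3 * ((C2 + 1) * M) by ring.
by split; [apply: le_trans H5 _|apply: le_trans H3 _|apply: le_trans H1 _|
  apply: le_trans H4 _|apply: le_trans H2 _]; lra.
Qed.

Lemma box_center c r : 0 < r -> box c r c.
Proof. by move=> r0; split; rewrite subrr normr0. Qed.

Lemma box_ball_x c r z : box c r z -> exists2 s, 0 < s &
  forall t, `|t - z.1| < s -> box c r (t, z.2).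
Proof.
move=> [h1 h2]; exists (r - `|z.1 - c.1|); first by rewrite subr_gt0.
move=> t ht; split=> //=; rewrite -(subrKA z.1).
by apply: le_lt_trans (ler_normD _ _) _; rewrite -ltrBrDr.
Qed.

Lemma box_ball_y c r z : box c r z -> exists2 s, 0 < s &
  forall t, `|t - z.2| < s -> box c r (z.1, t).
Proof.
move=> [h1 h2]; exists (r - `|z.2 - c.2|); first by rewrite subr_gt0.
move=> t ht; split=> //=; rewrite -(subrKA z.2).
by apply: le_lt_trans (ler_normD _ _) _; rewrite -ltrBrDr.
Qed.

(** Weierstrass's theorem for the singular equation. By linearity the interior estimate applies to
    [U n - U m], so all the derivatives in the jets are uniformly Cauchy on the smaller box. *)
Lemma axharm_limit c rho : 0 < rho -> c.2 = 0 \/ rho <= `|c.2| ->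
  exists2 C, 0 < C & forall (U : nat -> jet R) u e, (forall n, 0 < e n) -> vanishing e ->
  (forall n, axharm (box c rho) (U n)) ->
  (forall n z, box c rho z -> `|j0 (U n) z - u z| <= e n) ->
  exists V, [/\ j0 V = u, axharm (box c (rho / 32)) V &
    forall n z, box c (rho / 32) z -> jbound (jlin 1 (-1) (U n) V) (C * e n) z].
Proof.
move=> rho0 hc; have [C C0 hC] := interior_estimate rho0 hc.
exists (C + 1); first by lra.
move=> U u e e0 ve hU hu.
have diff n m z : box c (rho / 32) z ->
    jbound (jlin 1 (-1) (U n) (U m)) (C * e n + C * e m) z.
  move=> bz; rewrite -mulrDr; apply: hC bz; first by rewrite addr_gt0.
    exact: axharm_lin.
  move=> w bw; rewrite /= mul1r mulN1r.
  have := hu n w bw; have := hu m w bw; clear.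
  by rewrite !ler_norml => /andP[? ?] /andP[? ?]; apply/andP; split; lra.
have lim (p : jet R -> R * R -> R) : (forall n m z, box c (rho / 32) z ->
    `|p (U n) z - p (U m) z| <= C * e n + C * e m) ->
    exists v, forall n z, box c (rho / 32) z -> `|p (U n) z - v z| <= C * e n.
  move=> h; have H z : exists l, box c (rho / 32) z -> forall n, `|p (U n) z - l| <= C * e n.
    have [bz|nz] := pselect (box c (rho / 32) z); last by exists 0.
    have [l hl] := @sup_limit (fun n => C * e n) (fun n => p (U n) z)
      (fun n m => h n m z bz).
    by exists l.
  exists (fun z => projT1 (cid (H z))) => n z bz.
  by case: cid => l /= /(_ bz).
have [ua hua] : exists v, forall n z, box c (rho / 32) z -> `|ja (U n) z - v z| <= C * e n.
  by apply: lim => n m z /(diff n m)[_ + _ _ _]; rewrite /= mul1r mulN1r.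
have [ub hub] : exists v, forall n z, box c (rho / 32) z -> `|jb (U n) z - v z| <= C * e n.
  by apply: lim => n m z /(diff n m)[_ _ + _ _]; rewrite /= mul1r mulN1r.
have [uaa huaa] : exists v, forall n z, box c (rho / 32) z -> `|jaa (U n) z - v z| <= C * e n.
  by apply: lim => n m z /(diff n m)[_ _ _ + _]; rewrite /= mul1r mulN1r.
have [ubb hubb] : exists v, forall n z, box c (rho / 32) z -> `|jbb (U n) z - v z| <= C * e n.
  by apply: lim => n m z /(diff n m)[_ _ _ _ +]; rewrite /= mul1r mulN1r.
(* One error sequence dominating both [e n], for the functions, and [C * e n], for their
   derivatives. *)
pose k n := (C + 1) * e n.
have vk : vanishing k by apply: vanishingZ => //; lra.
have w n (a b : R) : `|a - b| <= C * e n -> `|a - b| <= k n.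
  by move=> h; apply: le_trans h _; rewrite /k mulrDl mul1r lerDl ltW.
have h0 n z : box c (rho / 32) z -> `|j0 (U n) z - u z| <= k n.
  move=> bz; apply: le_trans (hu n z _) _; first by apply: box_le bz; lra.
  by rewrite /k mulrDl mul1r lerDr mulr_ge0 ?ltW.
have ha n z bz := w n _ _ (hua n z bz); have hb n z bz := w n _ _ (hub n z bz).
have haa n z bz := w n _ _ (huaa n z bz); have hbb n z bz := w n _ _ (hubb n z bz).
have bb z : box c (rho / 32) z -> box c rho z by apply: box_le; lra.
exists (Jet u ua ub uaa ubb); split=> //; last first.
  by move=> n z bz; split; rewrite /= mul1r mulN1r; auto.
split=> -[x y] bz; rewrite ?/xder ?/yder /=.
- have [s s0 hs] := box_ball_x bz; apply: (@limit_derive (fun n t => j0 (U n) (t, y))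
    (fun n t => ja (U n) (t, y)) _ (fun t => ua (t, y)) _ s k s0 vk) => n t /hs ht.
  + exact: (ah_a (hU n) (bb _ ht)).
  + exact: h0.
  + exact: ha.
- have [s s0 hs] := box_ball_y bz; apply: (@limit_derive (fun n t => j0 (U n) (x, t))
    (fun n t => jb (U n) (x, t)) _ (fun t => ub (x, t)) _ s k s0 vk) => n t /hs ht.
  + exact: (ah_b (hU n) (bb _ ht)).
  + exact: h0.
  + exact: hb.
- have [s s0 hs] := box_ball_x bz; apply: (@limit_derive (fun n t => ja (U n) (t, y))
    (fun n t => jaa (U n) (t, y)) _ (fun t => uaa (t, y)) _ s k s0 vk) => n t /hs ht.
  + exact: (ah_aa (hU n) (bb _ ht)).
  + exact: ha.
  + exact: haa.
- have [s s0 hs] := box_ball_y bz; apply: (@limit_derive (fun n t => jb (U n) (x, t))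
    (fun n t => jbb (U n) (x, t)) _ (fun t => ubb (x, t)) _ s k s0 vk) => n t /hs ht.
  + exact: (ah_bb (hU n) (bb _ ht)).
  + exact: hb.
  + exact: hbb.
- apply/eqP; rewrite -normr_le0.
  apply: (@le_vanishing (fun n => (2 * `|y| + 2) * k n)).
    by apply: vanishingZ => //; have := normr_ge0 y; lra.
  move=> n; rewrite add0r.
  have -> : y * (uaa (x, y) + ubb (x, y)) + 2 * ub (x, y) =
    - (y * (jaa (U n) (x, y) - uaa (x, y))) - (y * (jbb (U n) (x, y) - ubb (x, y))) - 2 * (jb (U n) (x, y) - ub (x, y)).
    by have /= E := ah_eq (hU n) (bb _ bz); rewrite -[LHS]subr0 -E; ring.
  apply: le_trans (ler_normB _ _) _; rewrite normrM (ger0_norm (x := 2)) //.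
  have h1 := ler_normB (- (y * (jaa (U n) (x, y) - uaa (x, y)))) (y * (jbb (U n) (x, y) - ubb (x, y))).
  have h2 : `|y * (jaa (U n) (x, y) - uaa (x, y))| <= `|y| * k n.
    by rewrite normrM ler_wpM2l // haa.
  have h3 : `|y * (jbb (U n) (x, y) - ubb (x, y))| <= `|y| * k n.
    by rewrite normrM ler_wpM2l // hbb.
  have := hb n _ bz; rewrite normrN in h1; move: h1 h2 h3.
  have -> : (2 * `|y| + 2) * k n = 2 * (`|y| * k n) + 2 * k n by ring.
  by clear; lra.
- by apply: (limit_continuous (open_nbhs_nbhs (conj (@open_box _ c _) bz)) vk _ h0) => n;
    apply: (ah_c0 (hU n)); auto.
- by apply: (limit_continuous (open_nbhs_nbhs (conj (@open_box _ c _) bz)) vk _ ha) => n;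
    apply: (ah_ca (hU n)); auto.
- by apply: (limit_continuous (open_nbhs_nbhs (conj (@open_box _ c _) bz)) vk _ hb) => n;
    apply: (ah_cb (hU n)); auto.
- by apply: (limit_continuous (open_nbhs_nbhs (conj (@open_box _ c _) bz)) vk _ haa) => n;
    apply: (ah_caa (hU n)); auto.
- by apply: (limit_continuous (open_nbhs_nbhs (conj (@open_box _ c _) bz)) vk _ hbb) => n;
    apply: (ah_cbb (hU n)); auto.
Qed.

Lemma vanishing_inv a : 0 < a -> vanishing (fun n => a / n.+1%:R).
Proof.
move=> a0 d d0; pose n := Num.truncn (a / d); exists n.
rewrite ltr_pdivrMr ?ltr0n // mulrC -ltr_pdivrMr //.
by rewrite truncnS_gt ?num_real.
Qed.

(** $u_a$ is the uniform limit of difference quotients in [a], which are solutions; the bound of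
    $u_{aa}$ gives the rate of convergence. *)
Lemma axharm_da_local c rho U M : 0 < rho -> c.2 = 0 \/ rho <= `|c.2| -> 0 < M ->
  axharm (box c rho) U -> (forall z, box c rho z -> `|j0 U z| <= M) ->
  exists2 V, j0 V = ja U & axharm (box c (rho / 2048)) V.
Proof.
move=> rho0 hc M0 hU hM; have [C C0 hC] := interior_estimate rho0 hc.
have r0 : 0 < rho / 64 by lra.
have hc64 : c.2 = 0 \/ rho / 64 <= `|c.2| by case: hc => h; [left|right; lra].
have [K K0 hK] := axharm_limit r0 hc64.
(* From the box of radius $\rho/64$ these steps stay inside the box of radius $\rho/32$ of the
   interior estimate. Passing to the limit costs another factor 32, whence 2048. *)
pose h n : R := (rho / 64) / n.+1%:R.
have h0 n : 0 < h n by rewrite divr_gt0.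
have hle n : h n <= rho / 64.
  by rewrite ler_pdivrMr ?ltr0n // ler_peMr ?ler1n // ltW.
pose W n := jlin (h n)^-1 (- (h n)^-1) (jshift (h n) U) U.
have CM : 0 < C * M by rewrite mulr_gt0.
have [||||V [V0 hV _]] := hK W (ja U) (fun n => C * M * h n).
- by move=> n; rewrite mulr_gt0.
- by apply: vanishingZ => //; exact: vanishing_inv.
- move=> n; apply: axharm_lin; last by apply: axharmS hU; apply: box_le; lra.
  apply: axharm_shift; apply: axharmS hU => w /= /(@box_move _ c _ (h n)) /=.
  rewrite subrK -surjective_pairing; apply: box_le; rewrite gtr0_norm //.
  by have := hle n; lra.
- move=> n z bz; rewrite /= mulNr -mulrBr [in j0 U z](surjective_pairing z).
  have b32 t : between z.1 (z.1 + h n) t -> box c (rho / 32) (t, z.2).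
    move=> bt; have [w1 w2] := bz; split=> /=; last by lra.
    apply: (between_ball _ _ bt); first by lra.
    by have [/= ] := box_move (h n) bz; rewrite (gtr0_norm (h0 n)); have := hle n; lra.
  have bU t : box c (rho / 32) t -> box c rho t by apply: box_le; lra.
  have [x bx ->] := @mvt _ (fun t => j0 U (t, z.2)) (fun t => ja U (t, z.2)) z.1 (z.1 + h n)
    (fun t bt => ah_a hU (bU _ (b32 t bt))).
  rewrite addrAC subrr add0r mulrC mulfK ?gt_eqF // [in ja U z](surjective_pairing z).
  apply: le_trans (_ : C * M * `|x - z.1| <= _); last first.
    by rewrite ler_pM2l //; have := between_le_norm bx; rewrite (addrAC z.1) subrr add0r (gtr0_norm (h0 n)).
  have bx' t : between z.1 x t -> between z.1 (z.1 + h n) t.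
    move: bx => /orP[]/andP[? ?] /orP[]/andP[? ?]; apply/orP.
    - by left; apply/andP; split; lra.
    - by left; apply/andP; split; lra.
    - by right; apply/andP; split; lra.
    - by right; apply/andP; split; lra.
  apply: (@mvt_bound _ (fun t => ja U (t, z.2)) (fun t => jaa U (t, z.2))) => t /bx' bt.
    exact: (ah_aa hU (bU _ (b32 t bt))).
  by have [] := hC U M M0 hU hM _ (b32 t bt).
exists V => //; suff -> : rho / 2048 = rho / 64 / 32 by [].
by clear; field.
Qed.

End Weierstrass.

(** * Local character of the equation, and mixed derivatives *)

Section Canonical.
Variable R : realType.
Implicit Types (u v : R * R -> R) (Q : set (R * R)) (z w c : R * R) (U V : jet R).

Definition dx u z : R := 'D_1 (fun t => u (t, z.2)) z.1.
Definition dy u z : R := 'D_1 (fun t => u (z.1, t)) z.2.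

Lemma xder_dx u z d : xder u z d -> dx u z = d. Proof. by case. Qed.
Lemma yder_dy u z d : yder u z d -> dy u z = d. Proof. by case. Qed.

(** The jet depends on [u] alone, through total derivative operators. Jets found on small boxes
    therefore agree with it, and being a solution becomes a local property, [axh_local]. *)
Definition canon u := Jet u (dx u) (dy u) (dx (dx u)) (dy (dy u)).

Definition axh Q u := axharm Q (canon u).

Lemma in_ball (x r t : R) : `|t - x| < r -> ball x r t.
Proof. by rewrite distrC. Qed.

Lemma open_lines Q z : open Q -> Q z -> exists2 r, 0 < r &
  (forall t, `|t - z.1| < r -> Q (t, z.2)) /\ (forall t, `|t - z.2| < r -> Q (z.1, t)).
Proof.
move=> oQ Qz; have /nbhs_ballP[r /= r0 hr] : nbhs z Q by apply: open_nbhs_nbhs.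
exists r => //; split=> t ht; apply: hr; split; apply: in_ball => //=;
  by rewrite subrr normr0.
Qed.

Lemma open_box_sub Q z : open Q -> Q z -> exists2 r, 0 < r & box z r `<=` Q.
Proof.
move=> oQ Qz; have /nbhs_ballP[r /= r0 hr] : nbhs z Q by apply: open_nbhs_nbhs.
exists r => // w [h1 h2]; apply: hr; split; exact: in_ball.
Qed.

Lemma xder_ext Q u v z d : open Q -> Q z -> (forall w, Q w -> u w = v w) ->
  xder u z d -> xder v z d.
Proof.
move=> oQ Qz uv; have [r r0 [hr _]] := open_lines oQ Qz.
by apply: (der_near r0) => t /hr /uv.
Qed.

Lemma yder_ext Q u v z d : open Q -> Q z -> (forall w, Q w -> u w = v w) ->
  yder u z d -> yder v z d.
Proof.
move=> oQ Qz uv; have [r r0 [_ hr]] := open_lines oQ Qz.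
by apply: (der_near r0) => t /hr /uv.
Qed.

Lemma cont_ext (T S : topologicalType) (Q : set T) (u v : T -> S) (z : T) : open Q -> Q z ->
  (forall t, Q t -> u t = v t) -> {for z, continuous u} -> {for z, continuous v}.
Proof.
move=> oQ Qz uv cu; rewrite /prop_for /continuous_at -(uv z Qz).
apply: cvg_trans cu; apply: near_eq_cvg.
by near=> w; apply/uv; near: w; apply: open_nbhs_nbhs.
Unshelve. all: by end_near. Qed.

Lemma axharm_canon Q U u : open Q -> axharm Q U -> (forall z, Q z -> j0 U z = u z) ->
  axh Q u /\ forall z, Q z -> dx u z = ja U z /\ dy u z = jb U z.
Proof.
move=> oQ [a1 a2 a3 a4 a5 a6 a7 a8 a9 a10] uE.
have h1 z : Q z -> xder u z (ja U z) by move=> Qz; exact: (xder_ext oQ Qz uE (a1 z Qz)).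
have h2 z : Q z -> yder u z (jb U z) by move=> Qz; exact: (yder_ext oQ Qz uE (a2 z Qz)).
have e1 z : Q z -> ja U z = dx u z by move=> /h1 /xder_dx.
have e2 z : Q z -> jb U z = dy u z by move=> /h2 /yder_dy.
have h3 z : Q z -> xder (dx u) z (jaa U z) by move=> Qz; exact: (xder_ext oQ Qz e1 (a3 z Qz)).
have h4 z : Q z -> yder (dy u) z (jbb U z) by move=> Qz; exact: (yder_ext oQ Qz e2 (a4 z Qz)).
have e3 z : Q z -> jaa U z = dx (dx u) z by move=> /h3 /xder_dx.
have e4 z : Q z -> jbb U z = dy (dy u) z by move=> /h4 /yder_dy.
split; last by move=> z Qz; rewrite e1 // e2.
split=> z Qz /=.
- by rewrite -e1 //; exact: h1.
- by rewrite -e2 //; exact: h2.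
- by rewrite -e3 //; exact: h3.
- by rewrite -e4 //; exact: h4.
- by rewrite -e2 // -e3 // -e4 // a5.
- exact: (cont_ext oQ Qz uE (a6 z Qz)).
- exact: (cont_ext oQ Qz e1 (a7 z Qz)).
- exact: (cont_ext oQ Qz e2 (a8 z Qz)).
- exact: (cont_ext oQ Qz e3 (a9 z Qz)).
- exact: (cont_ext oQ Qz e4 (a10 z Qz)).
Qed.

Lemma axh_local Q u : (forall z, Q z -> exists Q', Q' z /\ axh Q' u) -> axh Q u.
Proof.
move=> h; split=> z /h[Q' [Qz hQ]].
- exact: (ah_a hQ).
- exact: (ah_b hQ).
- exact: (ah_aa hQ).
- exact: (ah_bb hQ).
- exact: (ah_eq hQ).
- exact: (ah_c0 hQ).
- exact: (ah_ca hQ).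
- exact: (ah_cb hQ).
- exact: (ah_caa hQ).
- exact: (ah_cbb hQ).
Qed.

Lemma good_box Q z : open Q -> Q z -> exists2 r, 0 < r &
  box z r `<=` Q /\ (z.2 = 0 \/ r <= `|z.2|).
Proof.
move=> oQ Qz; have [r r0 hr] := open_box_sub oQ Qz.
have [z0|z0] := eqVneq z.2 0; first by exists r => //; split=> //; left.
exists (Num.min r `|z.2|); first by rewrite lt_min r0 normr_gt0.
split; last by right; rewrite ge_min lexx orbT.
by move=> w /box_le bw; apply: hr; apply: bw; rewrite ge_min lexx.
Qed.

Lemma bounded_box u z : {for z, continuous u} -> exists2 r, 0 < r &
  forall w, box z r w -> `|u w| <= `|u z| + 1.
Proof.
move=> /cvgrPdist_le/(_ 1 ltr01)/nbhs_ballP[r /= r0 hr]; exists r => // w [h1 h2].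
have h : `|u z - u w| <= 1 by apply: hr; split; exact: in_ball.
rewrite -(subKr (u z) (u w)).
by apply: le_trans (ler_normB _ _) _; rewrite lerD2l.
Qed.

(** Near each point there is a box on which [u] is bounded, by continuity, and whose centre lies on
    the axis or at least one radius away from it, as the estimates require. *)
Theorem axh_dx Q u : open Q -> axh Q u -> axh Q (dx u).
Proof.
move=> oQ hu; apply: axh_local => z Qz.
have [r1 r10 [s1 c1]] := good_box oQ Qz.
have [r2 r20 bd] := bounded_box (ah_c0 hu Qz).
pose r := Num.min r1 r2.
have r0 : 0 < r by rewrite lt_min r10.
have rc : z.2 = 0 \/ r <= `|z.2|.
  by case: c1 => hz; [left|right; rewrite ge_min hz].
have hM : axharm (box z r) (canon u).
  by apply: axharmS hu => w bw; apply: s1; apply: box_le bw; rewrite ge_min lexx.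
have M0 : 0 < `|u z| + 1 by rewrite ltr_wpDl.
have [|V V0 hV] := @axharm_da_local R z r (canon u) (`|u z| + 1) r0 rc M0 hM.
  by move=> w bw; apply: bd; apply: box_le bw; rewrite ge_min lexx orbT.
have r' : 0 < r / 2048 by lra.
exists (box z (r / 2048)); split; first exact: box_center.
by have [] := axharm_canon (@open_box _ _ _) hV (u := dx u) _; rewrite ?V0.
Qed.

(** The existence of the derivative of [ub] is part of the claim. The quantity
    [ub (x + h, y) - ub (x, y)] is itself a derivative in [y], and the mean value theorem in both
    variables bounds the increments of [u (x + h, .) - u (x, .)]. *)
Lemma schwarz Q u ua ub uab z : open Q -> Q z ->
  (forall w, Q w -> xder u w (ua w)) -> (forall w, Q w -> yder u w (ub w)) ->
  (forall w, Q w -> yder ua w (uab w)) -> {for z, continuous uab} ->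
  xder ub z (uab z).
Proof.
move=> oQ Qz ha hb hab cab; case: z Qz cab => x y Qz cab.
rewrite /xder /=; apply/is_deriveP => e e0.
have /cvgrPdist_le/(_ e e0)/nbhs_ballP[r1 /= r10 h1] := cab.
have [r2 r20 h2] := open_box_sub oQ Qz.
pose r := Num.min r1 r2; exists r; first by rewrite lt_min r10.
have r0 : 0 < r by rewrite lt_min r10.
have bQ w : box (x, y) r w -> Q w.
  by move=> bw; apply: h2; apply: box_le bw; rewrite ge_min lexx orbT.
have be w : box (x, y) r w -> `|uab w - uab (x, y)| <= e.
  move=> bw; rewrite distrC; apply: h1.
  have [/= w1 w2] : box (x, y) r1 w by apply: box_le bw; rewrite ge_min lexx.
  by split; exact: in_ball.
have bI s t : `|s - x| < r -> `|t - y| < r -> box (x, y) r (s, t) by [].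
move=> h hr; have xx : `|x - x| < r by rewrite subrr normr0.
have yy : `|y - y| < r by rewrite subrr normr0.
have xh : `|x + h - x| < r by rewrite addrAC subrr add0r.
pose g t := u (x + h, t) - u (x, t) - h * uab (x, y) * t.
have dg : is_derive y 1 g (ub (x + h, y) - ub (x, y) - uab (x, y) * h).
  have d1 := hb (x + h, y) (bQ _ (bI _ _ xh yy)); rewrite /yder /= in d1.
  have d2 := hb (x, y) (bQ _ (bI _ _ xx yy)); rewrite /yder /= in d2.
  by rewrite /g; der; rewrite /=; ring.
apply: (der_bound r0 dg) => k kr; rewrite /g.
have yk : `|y + k - y| < r by rewrite addrAC subrr add0r.
have [s bs] := @mvt _ (fun t => u (t, y + k) - u (t, y))
  (fun t => ua (t, y + k) - ua (t, y)) x (x + h) (fun t bt =>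
   derD (ha (t, y + k) (bQ _ (bI _ _ (between_ball xx xh bt) yk)))
        (derN (ha (t, y) (bQ _ (bI _ _ (between_ball xx xh bt) yy))))).
have sx := between_ball xx xh bs.
have [t bt E] := @mvt _ (fun t => ua (s, t)) (fun t => uab (s, t)) y (y + k)
  (fun t bt => hab (s, t) (bQ _ (bI _ _ sx (between_ball yy yk bt)))).
rewrite E (addrAC x) subrr add0r (addrAC y) subrr add0r => E2.
have -> : u (x + h, y + k) - u (x, y + k) - h * uab (x, y) * (y + k) -
  (u (x + h, y) - u (x, y) - h * uab (x, y) * y) =
  (uab (s, t) - uab (x, y)) * (h * k).
  rewrite -[LHS](_ : (u (x + h, y + k) - u (x + h, y) - (u (x, y + k) - u (x, y)))
    - h * k * uab (x, y) = _); last by ring.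
  by rewrite E2; ring.
rewrite normrM normrM -mulrA ler_wpM2r ?mulr_ge0 //.
by apply: be; split=> //=; exact: between_ball bt.
Qed.

Lemma axh_dxy Q u z : open Q -> axh Q u -> Q z -> xder (dy u) z (dy (dx u) z).
Proof.
move=> oQ hu Qz; have hdu := axh_dx oQ hu.
apply: (schwarz oQ Qz (ah_a hu) (ah_b hu) (ah_b hdu)).
exact: (ah_cb hdu Qz).
Qed.

Lemma axh_limit Q (U : nat -> jet R) u : open Q -> (forall n, axharm Q (U n)) ->
  (forall z, Q z -> exists r e, [/\ 0 < r, (forall n, 0 < e n), vanishing e &
    forall n w, box z r w -> `|j0 (U n) w - u w| <= e n]) -> axh Q u.
Proof.
move=> oQ hU hu; apply: axh_local => z Qz.
have [r1 r10 [s1 c1]] := good_box oQ Qz.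
have [r2 [e [r20 e0 ve he]]] := hu z Qz.
pose r := Num.min r1 r2.
have r0 : 0 < r by rewrite lt_min r10.
have rc : z.2 = 0 \/ r <= `|z.2|.
  by case: c1 => hz; [left|right; rewrite ge_min hz].
have [C C0 hC] := axharm_limit r0 rc.
have [|| V [V0 hV _]] := hC U u e e0 ve.
- by move=> n; apply: axharmS (hU n) => w bw; apply: s1; apply: box_le bw; rewrite ge_min lexx.
- by move=> n w bw; apply: he; apply: box_le bw; rewrite ge_min lexx orbT.
have r' : 0 < r / 32 by lra.
exists (box z (r / 32)); split; first exact: box_center.
by have [] := axharm_canon (@open_box _ _ _) hV (u := u) _; rewrite ?V0.
Qed.

End Canonical.

(** * Smoothness of axially monogenic stems *)

Section Regularity.
Variable R : realType.
Implicit Types (u v A B : R * R -> R) (Q : set (R * R)) (z w c : R * R).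

Lemma antiderivative (f : R -> R) a r : 0 < r ->
  (forall t, `|t - a| < r -> {for t, continuous f}) ->
  exists2 F : R -> R, F a = 0 & forall t, `|t - a| < r / 2 -> is_derive t 1 F (f t).
Proof.
move=> r0 cf; pose l := a - r / 2; pose m := a + r / 2.
pose F0 (x : R) : R := (\int[lebesgue_measure]_(t in [set` `[l, x]]) (f t))%R.
exists (fun x => F0 x - F0 a); first by rewrite subrr.
move=> t ht; have [lt tm] : l < t /\ t < m.
  by move: ht; rewrite ltr_norml /l /m => /andP[? ?]; split; lra.
have fi : (@lebesgue_measure R).-integrable `[l, m] (EFin \o f).
  apply: continuous_compact_integrable; first exact: segment_compact.
  apply: continuous_in_subspaceT => x /set_mem /=; rewrite in_itv /= => /andP[h1 h2].
  by apply: cf; rewrite ltr_norml; move: h1 h2; rewrite /l /m => *; apply/andP; split; lra.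
have [d1 d2] : derivable F0 t 1 /\ F0^`()%classic t = f t.
  apply: (continuous_FTC1_closed tm fi lt); apply: cf; lra.
rewrite derive1E in d2; have D := DeriveDef d1 d2.
by der; rewrite subr0.
Qed.

Lemma unif_on_segment (g : R * R -> R) a b y e : 0 < e -> a <= b ->
  (forall s, a <= s <= b -> {for (s, y), continuous g}) ->
  exists2 d, 0 < d & forall s k, a <= s <= b -> `|k| < d -> `|g (s, y + k) - g (s, y)| <= e.
Proof.
move=> e0 ab cg.
have := @segment_compact R a b => /compact_near_coveringP.
move=> /(_ R (nbhs (0 : R)) (fun k s => `|g (s, y + k) - g (s, y)| <= e) _) H.
have /nbhs_ballP[d /= d0 hd] : \forall k \near nbhs (0 : R), `[a, b]%classic `<=`
    (fun s => `|g (s, y + k) - g (s, y)| <= e).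
  apply: H => s; rewrite /= in_itv /= => sab.
  have /cvgrPdist_le/(_ (e / 2) (ltac:(lra)))/nbhs_ballP[r /= r0 hr] := cg s sab.
  exists (ball s r, ball (0 : R) r); first by split; apply: nbhsx_ballx.
  move=> [s' k] /= [bs bk].
  have h1 : `|g (s, y) - g (s', y + k)| <= e / 2.
    by apply: hr; split => //; apply: in_ball; move: bk; rewrite /ball /= sub0r normrN addrAC subrr add0r.
  have h2 : `|g (s, y) - g (s', y)| <= e / 2.
    by apply: hr; split => //; exact: ballxx.
  move: h1 h2; clear.
  by rewrite !ler_norml => /andP[? ?] /andP[? ?]; apply/andP; split; lra.
exists d => // s k sab kd; apply: (hd k); last by rewrite /= in_itv.
by rewrite /ball /= sub0r normrN.
Qed.

(** The system satisfied by the two components of the stem of an axially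
    monogenic function. *)
Record amsys Q A B : Prop := AmSys
  { am_Ax : forall z, Q z -> xder A z (dx A z); am_Ay : forall z, Q z -> yder A z (dy A z);
    am_Bx : forall z, Q z -> xder B z (dx B z); am_By : forall z, Q z -> yder B z (dy B z);
    am_cAx : forall z, Q z -> {for z, continuous (dx A)};
    am_cAy : forall z, Q z -> {for z, continuous (dy A)};
    am_cBx : forall z, Q z -> {for z, continuous (dx B)};
    am_cBy : forall z, Q z -> {for z, continuous (dy B)};
    am_eq1 : forall z, Q z -> dy A z = - dx B z;
    am_eq2 : forall z, Q z -> z.2 * (dx A z - dy B z) = 2 * B z }.

Lemma amsysS Q Q' A B : Q' `<=` Q -> amsys Q A B -> amsys Q' A B.
Proof.
move=> s [a1 a2 b1 b2 c1 c2 c3 c4 q1 q2]; split=> z /s Qz.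
- exact: (a1 z Qz).
- exact: (a2 z Qz).
- exact: (b1 z Qz).
- exact: (b2 z Qz).
- exact: (c1 z Qz).
- exact: (c2 z Qz).
- exact: (c3 z Qz).
- exact: (c4 z Qz).
- exact: (q1 z Qz).
- exact: (q2 z Qz).
Qed.

Lemma C1_continuous Q u ua ub z : open Q -> Q z ->
  (forall w, Q w -> xder u w (ua w)) -> (forall w, Q w -> yder u w (ub w)) ->
  {for z, continuous ua} -> {for z, continuous ub} -> {for z, continuous u}.
Proof.
case: z => x y oQ Qz ha hb ca cb; apply/cvgrPdist_le => e e0.
have [r1 r10 s1] := open_box_sub oQ Qz.
have [r2 r20 s2] := bounded_box ca; have [r3 r30 s3] := bounded_box cb.
pose K := `|ua (x, y)| + `|ub (x, y)| + 1.
have K0 : 0 < K by rewrite ltr_wpDl // addr_ge0.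
pose r := Num.min (Num.min r1 (Num.min r2 r3)) (e / (2 * K)).
have r0 : 0 < r by rewrite !lt_min r10 r20 r30 divr_gt0 // mulr_gt0.
have rr w : box (x, y) r w -> [/\ Q w, `|ua w| <= K & `|ub w| <= K].
  move=> bw; split.
  - by apply: s1; apply: box_le bw; rewrite !ge_min lexx.
  - have /s2 : box (x, y) r2 w by apply: box_le bw; rewrite !ge_min lexx orbT.
    by have := normr_ge0 (ub (x, y)); rewrite /K; lra.
  - have /s3 : box (x, y) r3 w by apply: box_le bw; rewrite !ge_min lexx !orbT.
    by have := normr_ge0 (ua (x, y)); rewrite /K; lra.
have rK : K * r <= e / 2.
  have : r <= e / (2 * K) by rewrite !ge_min lexx !orbT.
  rewrite ler_pdivlMr ?mulr_gt0 // => h.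
  by rewrite ler_pdivlMr // mulrC mulrA mulrC.
have Hn : nbhs (x, y) (box (x, y) r).
  by apply: open_nbhs_nbhs; split; [exact: open_box|exact: box_center].
apply: filterS Hn => -[x' y'] [/= b1 b2].
have xx : `|x - x| < r by rewrite subrr normr0.
have yy : `|y - y| < r by rewrite subrr normr0.
have bI s t : `|s - x| < r -> `|t - y| < r -> box (x, y) r (s, t) by [].
have h1 : `|u (x', y) - u (x, y)| <= K * `|x' - x|.
  apply: (@mvt_bound _ (fun t => u (t, y)) (fun t => ua (t, y))) => t bt;
    have [q1 q2 q3] := rr _ (bI _ _ (between_ball xx b1 bt) yy) => //.
  exact: (ha _ q1).
have h2 : `|u (x', y') - u (x', y)| <= K * `|y' - y|.
  apply: (@mvt_bound _ (fun t => u (x', t)) (fun t => ub (x', t))) => t bt;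
    have [q1 q2 q3] := rr _ (bI _ _ b1 (between_ball yy b2 bt)) => //.
  exact: (hb _ q1).
have -> : u (x, y) - u (x', y') = - (u (x', y') - u (x', y)) - (u (x', y) - u (x, y)) by ring.
apply: le_trans (ler_normB _ _) _; rewrite normrN.
have h3 : K * `|x' - x| <= K * r by rewrite ler_pM2l // ltW.
have h4 : K * `|y' - y| <= K * r by rewrite ler_pM2l // ltW.
by move: h1 h2 h3 h4 rK; clear; lra.
Qed.

Lemma am_cA Q A B z : open Q -> amsys Q A B -> Q z -> {for z, continuous A}.
Proof.
move=> oQ h Qz; exact: (C1_continuous oQ Qz (am_Ax h) (am_Ay h) (am_cAx h Qz) (am_cAy h Qz)).
Qed.

Lemma am_cB Q A B z : open Q -> amsys Q A B -> Q z -> {for z, continuous B}.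
Proof.
move=> oQ h Qz; exact: (C1_continuous oQ Qz (am_Bx h) (am_By h) (am_cBx h Qz) (am_cBy h Qz)).
Qed.

Lemma cont_linex (u : R * R -> R) z : {for z, continuous u} ->
  {for z.1, continuous (fun t => u (t, z.2))}.
Proof.
move=> cu; apply: (@cont_comp2 _ _ _ _ u id (fun=> z.2)); last exact: cvg_cst.
  by rewrite -surjective_pairing.
exact: cvg_id.
Qed.

(** The form $A\,da-B\,db$ is closed by the first equation of the system. [P] integrates [A] along
    rows from the central column, hence $P_b$ is the integral of $-B_a$ over the row. *)
Lemma primitive_box A B c r : 0 < r -> amsys (box c (4 * r)) A B ->
  exists P, (forall z, box c r z -> xder P z (A z)) /\
    (forall z, box c r z -> yder P z (B (c.1, z.2) - B z)).
Proof.
case: c => a b r0 h; have oQ := @open_box R (a, b) (4 * r).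
have bI q s t : `|s - a| < q -> `|t - b| < q -> box (a, b) q (s, t) by [].
have b4 s t : box (a, b) r (s, t) -> box (a, b) (4 * r) (s, t) by apply: box_le; lra.
have H y : exists F : R -> R, `|y - b| < r ->
    F a = 0 /\ forall t, `|t - a| < r -> is_derive t 1 F (A (t, y)).
  have [yb|nyb] := boolP (`|y - b| < r); last by exists (fun=> 0).
  have [||F F0 hF] := @antiderivative (fun t => A (t, y)) a (2 * r); first by lra.
    move=> t ht; apply: (@cont_linex A (t, y)); apply: (am_cA oQ h).
    by apply: bI; lra.
  by exists F => _; split=> // t ht; apply: hF; lra.
pose P z := projT1 (cid (H z.2)) z.1.
have P0 y : `|y - b| < r -> P (a, y) = 0 by rewrite /P /=; case: cid => F /= HF /HF[].
have PA z : box (a, b) r z -> xder P z (A z).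
  case: z => x y [/= hx hy]; rewrite /xder /P /=; case: cid => F /= /(_ hy)[_].
  exact.
exists P; split=> // -[x y] bz; have [/= hx hy] := bz; rewrite /yder /=.
have aa : `|a - a| < r by rewrite subrr normr0.
(* In place of differentiation under the integral, the mean value theorem is applied along the row,
   where the increment of [A] is controlled to within [e1 * |k|] uniformly; the row is shorter than
   [r]. *)
apply/is_deriveP => e e0; pose e1 := e / r.
have e10 : 0 < e1 by rewrite divr_gt0.
have [d d0 hd] : exists2 d, 0 < d & forall s k, between a x s -> `|k| < d ->
    `|dy A (s, y + k) - dy A (s, y)| <= e1.
  have ca s : between a x s -> {for (s, y), continuous (dy A)}.
    by move=> bs; apply: (am_cAy h); apply: b4; apply: bI => //; exact: (between_ball aa hx bs).
  have [ax|xa] := leP a x.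
    have [s sax|d d0 hd] := @unif_on_segment (dy A) a x y e1 e10 ax.
      by apply: ca; rewrite /between sax.
    exists d => // s k /orP[|/andP[h1 h2]]; first exact: hd.
    by apply: hd; apply/andP; split; lra.
  have [s sax|d d0 hd] := @unif_on_segment (dy A) x a y e1 e10 (ltW xa).
    by apply: ca; rewrite /between sax orbT.
  exists d => // s k /orP[/andP[h1 h2]|]; last exact: hd.
  by apply: hd; apply/andP; split; lra.
exists (Num.min d (r - `|y - b|)); first by rewrite lt_min d0 subr_gt0.
move=> k; rewrite lt_min => /andP[kd kr].
have yk : `|y + k - b| < r.
  by rewrite addrAC; apply: le_lt_trans (ler_normD _ _) _; move: kr; clear; lra.
have Abd s : between a x s -> `|A (s, y + k) - A (s, y) + k * dx B (s, y)| <= e1 * `|k|.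
  move=> bs; have sa := between_ball aa hx bs.
  have [t bt ->] := @mvt _ (fun t => A (s, t)) (fun t => dy A (s, t)) y (y + k)
    (fun t bt => am_Ay h (b4 _ _ (bI _ _ _ sa (between_ball hy yk bt)))).
  have := am_eq1 h (b4 _ _ (bI _ _ _ sa hy)) => E.
  have -> : dx B (s, y) = - dy A (s, y) by rewrite E opprK.
  rewrite (addrAC y) subrr add0r mulrN mulrC -mulrBr normrM mulrC ler_wpM2r //.
  have := hd s (t - y) bs; rewrite (addrC y) subrK; apply.
  by apply: le_lt_trans kd; have := between_le_norm bt; rewrite (addrAC y) subrr add0r.
have : `|(P (x, y + k) - P (x, y) + k * B (x, y)) - (P (a, y + k) - P (a, y) + k * B (a, y))|
    <= e1 * `|k| * `|x - a|.
  apply: (@mvt_bound _ (fun s => P (s, y + k) - P (s, y) + k * B (s, y))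
    (fun s => A (s, y + k) - A (s, y) + k * dx B (s, y))) => // s bs.
  have sa := between_ball aa hx bs.
  have d1 := PA _ (bI _ _ _ sa yk); have d2 := PA _ (bI _ _ _ sa hy).
  have d3 := am_Bx h (b4 _ _ (bI _ _ _ sa hy)); rewrite /xder /= in d1 d2 d3.
  by der; rewrite /=; ring.
rewrite !P0 // => H1.
have -> : P (x, y + k) - P (x, y) - (B (a, y) - B (x, y)) * k =
  (P (x, y + k) - P (x, y) + k * B (x, y)) - (0 - 0 + k * B (a, y)) by ring.
apply: le_trans H1 _; have -> : e = e1 * r by rewrite /e1 divfK // gt_eqF.
by rewrite mulrAC -mulrA mulrA ler_wpM2r // ler_pM2l // ltW.
Qed.

(** With $A=-2u_a$ and $B=2u_b$ the second equation of the system is the axial equation for [u]. The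
    factors are those of Fueter's map, [fueter_stem]. *)
Lemma amsys_primitive Q A B z : open Q -> amsys Q A B -> Q z ->
  exists r u, [/\ 0 < r, box z r `<=` Q, axh (box z r) u &
   forall w, box z r w -> A w = - 2 * dx u w /\ B w = 2 * dy u w].
Proof.
move=> oQ h Qz; have [r4 r40 s4] := open_box_sub oQ Qz.
pose r := r4 / 4; have r0 : 0 < r by rewrite /r; lra.
have h4 : amsys (box z (4 * r)) A B.
  have -> : 4 * r = r4 by rewrite /r; field.
  exact: (amsysS s4 h).
have [P [Px Py]] := primitive_box r0 h4.
have s w : box z r w -> Q w by move=> bw; apply: s4; apply: box_le bw; rewrite /r; lra.
have [|S _ hS] := @antiderivative (fun t => B (z.1, t)) z.2 (2 * r) (ltac:(lra)).
  move=> t ht; apply: (@cont_line _ B (z.1, t)); apply: (am_cB oQ h); apply: s4.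
  by split; rewrite /= ?subrr ?normr0 //; move: ht; rewrite /r; lra.
(* [S] is a primitive of [B] on the central column and cancels the term [B (c.1, z.2)] left by
   [primitive_box]. *)
pose u w := - 2^-1 * P w + 2^-1 * S w.2.
have hu : axharm (box z r) (Jet u (fun w => - 2^-1 * A w) (fun w => 2^-1 * B w)
    (fun w => - 2^-1 * dx A w) (fun w => 2^-1 * dy B w)).
  split=> w bw; rewrite /xder /yder /=; have Qw := s w bw.
  - by have := Px w bw; rewrite /xder /= => d1; rewrite /u /=; der; rewrite /=; ring.
  - have := Py w bw; rewrite /yder /= => d1; have d2 : is_derive w.2 1 S (B (z.1, w.2)).
      by apply: hS; case: bw => _; lra.
    by rewrite /u /=; der; rewrite /=; ring.
  - by have := am_Ax h Qw; rewrite /xder /= => d1; der; rewrite /=; ring.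
  - by have := am_By h Qw; rewrite /yder /= => d1; der; rewrite /=; ring.
  - by have := am_eq2 h Qw; clear; rewrite /=; lra.
  - have d1 w' : box z r w' -> xder u w' (- 2^-1 * A w').
      by move=> bv; have := Px w' bv; rewrite /xder /= => d1; rewrite /u /=; der; rewrite /=; ring.
    have d2 w' : box z r w' -> yder u w' (2^-1 * B w').
      move=> bv; have := Py w' bv; rewrite /yder /= => d1'; have d2 : is_derive w'.2 1 S (B (z.1, w'.2)).
        by apply: hS; case: bv => _; lra.
      by rewrite /u /=; der; rewrite /=; ring.
    apply: (C1_continuous (@open_box _ z r) bw d1 d2).
      by have c1 := am_cA oQ h Qw; cnt.
    by have c1 := am_cB oQ h Qw; cnt.
  - by have c1 := am_cA oQ h Qw; cnt.
  - by have c1 := am_cB oQ h Qw; cnt.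
  - by have c1 := am_cAx h Qw; cnt.
  - by have c1 := am_cBy h Qw; cnt.
have [h1 h2] := axharm_canon (@open_box _ z r) hu (u := u) (fun _ _ => erefl).
exists r, u; split=> // w bw; have [/= -> ->] := h2 w bw.
by split; field.
Qed.

Lemma amsys_of Q A B Ax Ay Bx By : open Q ->
  (forall z, Q z -> xder A z (Ax z)) -> (forall z, Q z -> yder A z (Ay z)) ->
  (forall z, Q z -> xder B z (Bx z)) -> (forall z, Q z -> yder B z (By z)) ->
  (forall z, Q z -> {for z, continuous Ax}) -> (forall z, Q z -> {for z, continuous Ay}) ->
  (forall z, Q z -> {for z, continuous Bx}) -> (forall z, Q z -> {for z, continuous By}) ->
  (forall z, Q z -> Ay z = - Bx z) -> (forall z, Q z -> z.2 * (Ax z - By z) = 2 * B z) ->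
  amsys Q A B.
Proof.
move=> oQ a1 a2 b1 b2 c1 c2 c3 c4 q1 q2.
have e1 z (Qz : Q z) := esym (xder_dx (a1 z Qz)).
have e2 z (Qz : Q z) := esym (yder_dy (a2 z Qz)).
have e3 z (Qz : Q z) := esym (xder_dx (b1 z Qz)).
have e4 z (Qz : Q z) := esym (yder_dy (b2 z Qz)).
split=> z Qz.
- by rewrite -e1 //; exact: a1.
- by rewrite -e2 //; exact: a2.
- by rewrite -e3 //; exact: b1.
- by rewrite -e4 //; exact: b2.
- exact: (cont_ext oQ Qz e1 (c1 z Qz)).
- exact: (cont_ext oQ Qz e2 (c2 z Qz)).
- exact: (cont_ext oQ Qz e3 (c3 z Qz)).
- exact: (cont_ext oQ Qz e4 (c4 z Qz)).
- by rewrite -e2 // -e3 // q1.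
- by rewrite -e1 // -e4 // q2.
Qed.

Lemma xderZ k u z d : xder u z d -> xder (fun z => k * u z) z (k * d).
Proof. by rewrite /xder => d1; der; rewrite /=; ring. Qed.

Lemma yderZ k u z d : yder u z d -> yder (fun z => k * u z) z (k * d).
Proof. by rewrite /yder => d1; der; rewrite /=; ring. Qed.

Lemma contZ (k : R) u z : {for z, continuous u} -> {for z, continuous (fun z => k * u z)}.
Proof. by move=> c1; cnt. Qed.

Lemma axh_amsys Q u : open Q -> axh Q u ->
  amsys Q (fun z => - 2 * dx u z) (fun z => 2 * dy u z).
Proof.
move=> oQ hu; have hdu := axh_dx oQ hu.
apply: (@amsys_of Q _ _ (fun z => - 2 * dx (dx u) z) (fun z => - 2 * dy (dx u) z)
  (fun z => 2 * dy (dx u) z) (fun z => 2 * dy (dy u) z)) => // z Qz.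
- exact: (xderZ _ (ah_aa hu Qz)).
- exact: (yderZ _ (ah_b hdu Qz)).
- exact: (xderZ _ (axh_dxy oQ hu Qz)).
- exact: (yderZ _ (ah_bb hu Qz)).
- exact: (@contZ _ _ _ (ah_caa hu Qz)).
- exact: (@contZ _ _ _ (ah_cb hdu Qz)).
- exact: (@contZ _ _ _ (ah_cb hdu Qz)).
- exact: (@contZ _ _ _ (ah_cbb hu Qz)).
- by rewrite mulNr.
- have := ah_eq hu Qz; rewrite /=; move: (dx _ _) (dy _ _) (dy _ _) z.2 => a b d y.
  by clear; lra.
Qed.

Lemma amsys_ext Q A B A' B' : open Q -> amsys Q A B ->
  (forall z, Q z -> A z = A' z) -> (forall z, Q z -> B z = B' z) -> amsys Q A' B'.
Proof.
move=> oQ [a1 a2 b1 b2 c1 c2 c3 c4 q1 q2] eA eB.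
have a1' z (Qz : Q z) := xder_ext oQ Qz eA (a1 z Qz).
have a2' z (Qz : Q z) := yder_ext oQ Qz eA (a2 z Qz).
have b1' z (Qz : Q z) := xder_ext oQ Qz eB (b1 z Qz).
have b2' z (Qz : Q z) := yder_ext oQ Qz eB (b2 z Qz).
apply: (amsys_of oQ a1' a2' b1' b2' c1 c2 c3 c4 q1) => z Qz.
by rewrite -eB // q2.
Qed.

(** The gain of regularity: [A] and [B] are only $C^1$, but locally they come from a solution [u],
    and $u_a$ is again a solution, whose stem is $(A_a,B_a)$. *)
Theorem amsys_dx Q A B : open Q -> amsys Q A B -> amsys Q (dx A) (dx B).
Proof.
move=> oQ h.
suff loc z : Q z -> exists Q', Q' z /\ amsys Q' (dx A) (dx B).
  split=> z /loc[Q' [Qz hQ]].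
  - exact: (am_Ax hQ).
  - exact: (am_Ay hQ).
  - exact: (am_Bx hQ).
  - exact: (am_By hQ).
  - exact: (am_cAx hQ).
  - exact: (am_cAy hQ).
  - exact: (am_cBx hQ).
  - exact: (am_cBy hQ).
  - exact: (am_eq1 hQ).
  - exact: (am_eq2 hQ).
move=> Qz; have [r [u [r0 sQ hu uE]]] := amsys_primitive oQ h Qz.
have oB := @open_box R z r.
exists (box z r); split; first exact: box_center.
have eA w (bw : box z r w) := esym (proj1 (uE w bw)).
have eB w (bw : box z r w) := esym (proj2 (uE w bw)).
apply: (amsys_ext oB (axh_amsys oB (axh_dx oB hu))) => w bw; apply/esym; apply: xder_dx.
  exact: (xder_ext oB bw eA (xderZ _ (ah_aa hu bw))).
exact: (xder_ext oB bw eB (xderZ _ (axh_dxy oB hu bw))).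
Qed.

End Regularity.

(** * Slice functions in real coordinates *)

Section VectorDerivatives.
Variable R : realType.

Lemma is_derive_line (V W : normedModType R) (f : V -> W) (x v : V) (d : W) :
  is_derive x v f d <-> is_derive (0 : R) 1 (fun h : R => f (h *: v + x)) d.
Proof.
have e : (fun h : R => h^-1 *: ((f \o shift x) (h *: v) - f x)) =
   (fun h : R => h^-1 *: (((fun h : R => f (h *: v + x)) \o shift (0 : R)) (h *: (1 : R)) -
     (fun h : R => f (h *: v + x)) 0)).
  by apply/funext => h /=; rewrite addr0 [h%:A]mulr1 scale0r add0r.
split=> -[H1 H2]; (apply: DeriveDef; [move: H1|move: H2]); by rewrite /derivable /derive e.
Qed.

Lemma is_derive_pair (V W1 W2 : normedModType R) (f : V -> W1 * W2) x v d :
  is_derive x v f d <->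
  is_derive x v (fun y => (f y).1) d.1 /\ is_derive x v (fun y => (f y).2) d.2.
Proof.
have cl (W : normedModType R) (g : V -> W) e : is_derive x v g e <->
    h^-1 *: ((g \o shift x) (h *: v) - g x) @[h --> 0^'] --> e.
  split=> [[g1 <-] //|ge].
  by apply: DeriveDef; [apply/cvg_ex; exists e|exact: cvg_lim ge].
rewrite !cl; split=> [H|[H1 H2]].
  by split; [exact: (cvg_comp _ _ H cvg_fst)|exact: (cvg_comp _ _ H cvg_snd)].
rewrite [d]surjective_pairing.
exact: (@cvg_pair _ _ _ _ (nbhs d.1) (nbhs d.2) _ _ _ _ _ H1 H2).
Qed.

Lemma is_derive_mx (V : normedModType R) m n (M : V -> 'M[R]_(m, n)) x v d :
  is_derive x v M d <-> forall i j, is_derive x v (fun y => M y i j) (d i j).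
Proof.
split=> [[H <-] i j|H].
  by rewrite derive_mx // mxE; apply: derivableP; move/derivable_mxP : H.
have D : derivable M x v by apply/derivable_mxP => i j; have [] := H i j.
apply: DeriveDef => //; rewrite derive_mx //; apply/matrixP => i j.
by rewrite mxE; have [] := H i j.
Qed.

Lemma is_derive_uniqV (V W : normedModType R) (f : V -> W) x v d d' :
  is_derive x v f d -> is_derive x v f d' -> d = d'.
Proof. by move=> [_ <-] [_ <-]. Qed.

End VectorDerivatives.

Section QuaternionDerivatives.
Variable R : realType.
Local Notation H := (quat R).
Implicit Types (f g : R -> H) (t : R) (d e : H) (b : R -> R).

Lemma qcoN l (x : H) : qco l (- x) = - qco l x. Proof. by rewrite /qco mxE. Qed.
Lemma qco0 l : qco l (0 : H) = 0. Proof. by rewrite /qco mxE. Qed.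

Lemma qcoM (x y : H) :
  [/\ qco 0 (x * y) = qco 0 x * qco 0 y - qco 1 x * qco 1 y - qco 2 x * qco 2 y - qco 3 x * qco 3 y,
      qco 1 (x * y) = qco 0 x * qco 1 y + qco 1 x * qco 0 y + qco 2 x * qco 3 y - qco 3 x * qco 2 y,
      qco 2 (x * y) = qco 0 x * qco 2 y - qco 1 x * qco 3 y + qco 2 x * qco 0 y + qco 3 x * qco 1 y
    & qco 3 (x * y) = qco 0 x * qco 3 y + qco 1 x * qco 2 y - qco 2 x * qco 1 y + qco 3 x * qco 0 y].
Proof. by rewrite quat_mulE /qmul !qco_mkquat. Qed.

Lemma qco1 : [/\ qco 0 (1 : H) = 1, qco 1 (1 : H) = 0, qco 2 (1 : H) = 0 & qco 3 (1 : H) = 0].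
Proof. by rewrite quat1E !qco_mkquat. Qed.

Lemma is_derive_qco (V : normedModType R) (f : V -> H) x v d :
  is_derive x v f d <->
  forall l, (l < 4)%N -> is_derive x v (fun s => qco l (f s)) (qco l d).
Proof.
split=> [/is_derive_mx h l ll|h]; first exact: h.
apply/(@is_derive_mx R V 1 4 f) => i j; rewrite (ord1 i) -(inord_val j).
exact: h.
Qed.

Lemma qd_split f t d :
  is_derive t 1 (fun s => qco 0 (f s)) (qco 0 d) -> is_derive t 1 (fun s => qco 1 (f s)) (qco 1 d) ->
  is_derive t 1 (fun s => qco 2 (f s)) (qco 2 d) -> is_derive t 1 (fun s => qco 3 (f s)) (qco 3 d) ->
  is_derive t 1 f d.
Proof. by move=> *; apply/is_derive_qco => -[|[|[|[|]]]]. Qed.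

Lemma qdC t d : is_derive t 1 (fun=> d) (0 : H).
Proof. exact: is_derive_cst. Qed.

Lemma qdD f g t d e : is_derive t 1 f d -> is_derive t 1 g e ->
  is_derive t 1 (fun s => f s + g s) (d + e).
Proof. exact: is_deriveD. Qed.

Lemma qdN f t d : is_derive t 1 f d -> is_derive t 1 (fun s => - f s) (- d).
Proof. exact: is_deriveN. Qed.

Lemma qdM f g t d e : is_derive t 1 f d -> is_derive t 1 g e ->
  is_derive t 1 (fun s => f s * g s) (f t * e + d * g t).
Proof.
move=> /is_derive_qco df /is_derive_qco dg.
have f0 := df 0%N isT; have f1 := df 1%N isT; have f2 := df 2%N isT; have f3 := df 3%N isT.
have g0 := dg 0%N isT; have g1 := dg 1%N isT; have g2 := dg 2%N isT; have g3 := dg 3%N isT.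
have [m0 m1 m2 m3] := qcoM (f t) e; have [n0 n1 n2 n3] := qcoM d (g t).
apply: qd_split; rewrite qcoD ?m0 ?m1 ?m2 ?m3 ?n0 ?n1 ?n2 ?n3.
- rewrite (_ : (fun s => qco 0 (f s * g s)) = fun s => qco 0 (f s) * qco 0 (g s) -
    qco 1 (f s) * qco 1 (g s) - qco 2 (f s) * qco 2 (g s) - qco 3 (f s) * qco 3 (g s)).
    by der; rewrite /=; ring.
  by apply/funext => s; have [] := qcoM (f s) (g s).
- rewrite (_ : (fun s => qco 1 (f s * g s)) = fun s => qco 0 (f s) * qco 1 (g s) +
    qco 1 (f s) * qco 0 (g s) + qco 2 (f s) * qco 3 (g s) - qco 3 (f s) * qco 2 (g s)).
    by der; rewrite /=; ring.
  by apply/funext => s; have [] := qcoM (f s) (g s).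
- rewrite (_ : (fun s => qco 2 (f s * g s)) = fun s => qco 0 (f s) * qco 2 (g s) -
    qco 1 (f s) * qco 3 (g s) + qco 2 (f s) * qco 0 (g s) + qco 3 (f s) * qco 1 (g s)).
    by der; rewrite /=; ring.
  by apply/funext => s; have [] := qcoM (f s) (g s).
- rewrite (_ : (fun s => qco 3 (f s * g s)) = fun s => qco 0 (f s) * qco 3 (g s) +
    qco 1 (f s) * qco 2 (g s) - qco 2 (f s) * qco 1 (g s) + qco 3 (f s) * qco 0 (g s)).
    by der; rewrite /=; ring.
  by apply/funext => s; have [] := qcoM (f s) (g s).
Qed.

Lemma qdZ b f t (b' : R) d : is_derive t 1 b b' -> is_derive t 1 f d ->
  is_derive t 1 (fun s => b s *: f s) (b t *: d + b' *: f t).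
Proof.
move=> db /is_derive_qco df; apply/is_derive_qco => l /df dl.
rewrite (_ : (fun s => qco l (b s *: f s)) = fun s => b s * qco l (f s)).
  by der; rewrite qcoD !qcoZ; ring.
by apply/funext => s; rewrite qcoZ.
Qed.

Lemma qd_comp b f t (b' : R) d : is_derive (b t) 1 f d -> is_derive t 1 b b' ->
  is_derive t 1 (fun s => f (b s)) (b' *: d).
Proof.
move=> /is_derive_qco df db; apply/is_derive_qco => l /df dl.
by rewrite qcoZ mulrC; exact: (is_derive1_comp dl db).
Qed.

Lemma qd_near f g t d (r : R) : 0 < r -> (forall s, `|s - t| < r -> f s = g s) ->
  is_derive t 1 f d -> is_derive t 1 g d.
Proof.
move=> r0 h; apply: near_eq_is_derive; apply/nbhs_ballP; exists r => //= s.
by rewrite /ball /= distrC; exact: h.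
Qed.

Lemma continuous_qco (T : topologicalType) (f : T -> H) x :
  {for x, continuous f} <-> forall l, (l < 4)%N -> {for x, continuous (fun s => qco l (f s))}.
Proof.
split=> [cf l ll|h].
  apply: (@continuous_comp _ _ _ f (fun y : H => qco l y)) => //.
  exact: (@coord_continuous R 1 4).
apply/cvgrPdist_le => e e0; near=> s.
rewrite /Num.Def.normr/= mx_normrE (bigmax_le _ (ltW e0)) //= => -[i j] _.
rewrite (ord1 i) -(inord_val j) !mxE /=.
have : forall l : 'I_4, `|qco l (f x) - qco l (f s)| <= e.
  near: s; apply: filter_forall => l; have := h l (ltn_ord l).
  by move=> /cvgrPdist_le/(_ e e0).
by move=> /(_ j); rewrite /qco inord_val.
Unshelve. all: by end_near. Qed.

Lemma continuous_pairP (T U V : topologicalType) (f : T -> U * V) x :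
  {for x, continuous f} <->
  {for x, continuous (fun s => (f s).1)} /\ {for x, continuous (fun s => (f s).2)}.
Proof.
split=> [cf|[h1 h2]].
  by split; [exact: (continuous_comp cf cvg_fst)|exact: (continuous_comp cf cvg_snd)].
have := cont_pair h1 h2; rewrite (_ : (fun s => _) = f) //.
by apply/funext => s; rewrite -surjective_pairing.
Qed.

End QuaternionDerivatives.

(** * Slice functions along lines in H *)

Section LinesInH.
Variable R : realType.
Local Notation H := (quat R).
Local Notation HC := (quatC R).
Local Notation C := (cplx R).
Implicit Types (D : set C) (F : C -> HC) (f : H -> H) (x y e J : H) (s t : R).

Lemma qco_qunit k (l : 'I_4) : (k < 4)%N -> qco k (qunit R l) = (k == l)%:R.
Proof.
move=> k4; rewrite /qco /qunit mxE eqxx /=; congr (_%:R); congr (nat_of_bool _).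
by rewrite -val_eqE /= inordK.
Qed.

Lemma qunit0 : qunit R ord0 = 1.
Proof. by have [h0 h1 h2 h3] := qco1 R; apply: quat_eqP; rewrite qco_qunit ?h0 ?h1 ?h2 ?h3. Qed.

Lemma qunit_sq (l : 'I_4) : l != ord0 -> qunit R l * qunit R l = -1.
Proof.
have [h0 h1 h2 h3] := qco1 R; have [m0 m1 m2 m3] := qcoM (qunit R l) (qunit R l).
move=> l0; apply: quat_eqP; rewrite qcoN ?h0 ?h1 ?h2 ?h3 ?m0 ?m1 ?m2 ?m3 !qco_qunit //;
  by case: l l0 {m0 m1 m2 m3} => -[|[|[|[|]]]] //= ? _; ring.
Qed.

Lemma qunit_anticomm y (l : 'I_4) : l != ord0 -> qco 0 y = 0 ->
  y * qunit R l + qunit R l * y = (- (2 * qco l y)) *: 1.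
Proof.
have [h0 h1 h2 h3] := qco1 R; have [m0 m1 m2 m3] := qcoM (qunit R l) y.
have [n0 n1 n2 n3] := qcoM y (qunit R l).
move=> l0 y0; apply: quat_eqP; rewrite qcoZ qcoD ?h0 ?h1 ?h2 ?h3 ?m0 ?m1 ?m2 ?m3 ?n0 ?n1 ?n2 ?n3
  !qco_qunit // y0;
  by case: l l0 {m0 m1 m2 m3 n0 n1 n2 n3} => -[|[|[|[|]]]] //= ? _; ring.
Qed.

Lemma imag_sum y : qco 0 y = 0 -> \sum_(l < 4 | l != ord0) qco l y *: qunit R l = y.
Proof.
move=> y0; rewrite big_mkcond !big_ord_recl big_ord0 /= !add0r addr0 /bump /=.
by apply: quat_eqP; rewrite !qcoD !qcoZ !qco_qunit //= /bump /= ?y0; ring.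
Qed.

Lemma imag_norm y b : qco 0 y = 0 -> y * y = (- b) *: 1 ->
  \sum_(l < 4 | l != ord0) qco l y ^+ 2 = b.
Proof.
move=> y0 /(congr1 (qco 0)); have [-> _ _ _] := qcoM y y; have [h0 _ _ _] := qco1 R.
rewrite qcoZ h0 y0 => E; rewrite big_mkcond !big_ord_recl big_ord0 /= /bump /=.
by move: E; clear; lra.
Qed.

Lemma sum_imag_cst (V : zmodType) (v : V) : \sum_(l < 4 | l != ord0) v = v *+ 3.
Proof. by rewrite big_mkcond !big_ord_recl big_ord0 /= add0r addr0 addrA !mulrS mulr0n addr0 addrA. Qed.

(** If $y^2=-b^2$, $e^2=-1$ and $ye+ey=-2c$, this is the modulus of $y+se$, the distance to the real
    axis along a line of direction [e]. *)
Definition radius (b c s : R) := Num.sqrt (b ^+ 2 + 2 * c * s + s ^+ 2).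

Lemma radius0 b c : 0 < b -> radius b c 0 = b.
Proof. by move=> b0; rewrite /radius mulr0 expr0n /= !addr0 sqrtr_sqr gtr0_norm. Qed.

Lemma radius_derive b c s : 0 < radius b c s ->
  is_derive s 1 (radius b c) ((c + s) / radius b c s).
Proof.
move=> r0; have n0 : 0 < b ^+ 2 + 2 * c * s + s ^+ 2 by rewrite -sqrtr_gt0.
have d1 : is_derive s 1 (fun s => b ^+ 2 + 2 * c * s + s ^+ 2) (2 * (c + s)).
  by der; rewrite /=; ring.
have d2 := @is_derive1_comp R Num.sqrt (fun s => b ^+ 2 + 2 * c * s + s ^+ 2) s _ _
  (is_derive1_sqrt n0) d1.
apply: (is_derive_eq d2); rewrite -/(radius b c s).
by field; rewrite gt_eqF.
Qed.

Lemma line_imag y e c b s : y * y = (- b ^+ 2) *: 1 -> e * e = -1 ->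
  y * e + e * y = (- (2 * c)) *: 1 -> 0 < radius b c s ->
  imag_unit ((radius b c s)^-1 *: (y + s *: e)).
Proof.
move=> yy ee ye r0; have n0 : 0 < b ^+ 2 + 2 * c * s + s ^+ 2 by rewrite -sqrtr_gt0.
have sq : (y + s *: e) * (y + s *: e) = (- (b ^+ 2 + 2 * c * s + s ^+ 2)) *: 1.
  rewrite mulrDl !mulrDr yy -!scalerAl -!scalerAr ee -addrA (addrA (s *: (y * e))).
  rewrite -scalerDr ye -(scaleN1r (1 : H)) !scalerA -!scalerDl.
  by congr (_ *: _); rewrite /GRing.scale /=; ring.
rewrite /imag_unit /= -scalerAl -scalerAr sq !scalerA -(scaleN1r (1 : H)); congr (_ *: _).
have -> : (radius b c s)^-1 * (radius b c s)^-1 = (b ^+ 2 + 2 * c * s + s ^+ 2)^-1.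
  by rewrite -invfM -expr2 sqr_sqrtr // ltW.
by field; rewrite gt_eqF.
Qed.

(** The imaginary unit turns along the line, but it is $(y+se)/\rho(s)$: its variation is an affine
    factor, and everything else depends on $\rho(s)$ only. *)
Lemma slice_line D F f a b c y e : open D -> induces D F f -> D (a, b) -> 0 < b ->
  y * y = (- b ^+ 2) *: 1 -> e * e = -1 -> y * e + e * y = (- (2 * c)) *: 1 ->
  exists2 r, 0 < r & forall s, `|s| < r -> [/\ 0 < radius b c s, D (a, radius b c s) &
    f (s *: e + (a%:A + y)) = (F (a, radius b c s)).1
      + (y + s *: e) * ((radius b c s)^-1 *: (F (a, radius b c s)).2)].
Proof.
move=> oD hf Dz b0 yy ee ye.
have rd : {for (0 : R), continuous (radius b c)}.
  by apply: is_derive_continuous; apply: radius_derive; rewrite radius0.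
have [r1 r10 [_ h1]] := open_lines oD Dz.
have m0 : 0 < Num.min b r1 by rewrite lt_min b0.
move: rd => /cvgrPdist_lt/(_ _ m0)/nbhs_ballP[r /= r0 hr].
exists r => // s hs; have := hr s; rewrite radius0 // /ball /= sub0r normrN => /(_ hs).
rewrite lt_min => /andP[h2 h3].
have p0 : 0 < radius b c s.
  by move: h2; rewrite ltr_norml => /andP[_]; lra.
have Ds : D (a, radius b c s) by apply: h1; rewrite /= distrC.
split=> //; have := hf _ _ Ds (line_imag yy ee ye p0) => /=.
rewrite scalerA divff ?gt_eqF // scale1r => E.
by rewrite addrCA (addrC (s *: e)) E -scalerAl -scalerAr.
Qed.

End LinesInH.

Ltac qlin := apply: quat_eqP; rewrite ?(qcoD, qcoN, qcoZ) ?qco0; ring.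

Section FirstOrder.
Variable R : realType.
Local Notation H := (quat R).
Local Notation HC := (quatC R).
Local Notation C := (cplx R).
Implicit Types (D : set C) (F : C -> HC) (f : H -> H) (x y e J d : H) (s t a b c r : R).

Lemma derive_along f x e r (g : R -> H) : 0 < r ->
  (forall s, `|s| < r -> is_derive s 1 (fun s => f (s *: e + x)) (g s)) ->
  is_derive x e f (g 0) /\ forall d, is_derive (0 : R) 1 g d -> is_derive x e ('D_e f) d.
Proof.
move=> r0 h; split=> [|d dg].
  by apply/is_derive_line; apply: h; rewrite normr0.
apply/is_derive_line; apply: (qd_near r0 _ dg) => s; rewrite subr0 => /h hs.
have D0 : is_derive (s *: e + x) e f (g s).
  apply: (proj2 (is_derive_line f (s *: e + x) e (g s))).
  have := proj1 (is_derive_line (fun s : R => f (s *: e + x)) s 1 (g s)) hs.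
  rewrite (_ : (fun h : R => f _) = fun h => f (h *: e + (s *: e + x))) //.
  by apply/funext => k; rewrite [k%:A]mulr1 scalerDl addrA.
by case: D0 => _ <-.
Qed.

Lemma qd_scaleV (f : R -> H) b d : b != 0 -> is_derive b 1 f d ->
  is_derive b 1 (fun t => t^-1 *: f t) (b^-1 *: d - b ^- 2 *: f b).
Proof.
move=> b0 df; have d1 : is_derive b 1 (fun t => t^-1) (- (b ^- 2) * 1).
  exact: (derV b0 (derI _)).
by have := qdZ d1 df; rewrite mulr1 scaleNr.
Qed.

Lemma qd_line (P Q : R -> H) b c s y e p q : 0 < radius b c s ->
  is_derive (radius b c s) 1 P p -> is_derive (radius b c s) 1 Q q ->
  is_derive s 1 (fun s => P (radius b c s) + (y + s *: e) * Q (radius b c s))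
    (((c + s) / radius b c s) *: p
     + ((y + s *: e) * (((c + s) / radius b c s) *: q) + e * Q (radius b c s))).
Proof.
move=> r0 dP dQ; have dr := radius_derive r0.
have d1 : is_derive s 1 (fun s => y + s *: e) (0 + (s *: 0 + 1 *: e)).
  exact: (qdD (qdC s y) (qdZ (derI s) (qdC s e))).
have := qdD (qd_comp dP dr) (qdM d1 (qd_comp dQ dr)).
by rewrite scaler0 !add0r scale1r.
Qed.

Lemma pderiv0_slice D F f a b J Aa Ba : open D -> induces D F f -> D (a, b) -> imag_unit J ->
  is_derive a 1 (fun t => (F (t, b)).1) Aa -> is_derive a 1 (fun t => (F (t, b)).2) Ba ->
  is_derive (a%:A + b *: J) 1 f (Aa + J * Ba).
Proof.
move=> oD hf Dz hJ dA dB; apply/is_derive_line.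
have [r r0 [h1 _]] := open_lines oD Dz.
have dA0 : is_derive (0 : R) 1 (fun h => (F (h + a, b)).1 + J * (F (h + a, b)).2)
    (Aa + (J * Ba + 0 * (F (0 + a, b)).2)).
  have d1 : is_derive (0 : R) 1 (fun h => (F (h + a, b)).1) Aa.
    have := proj1 (@is_derive_line R R H (fun t => (F (t, b)).1) a 1 Aa) dA.
    by under eq_fun do rewrite [_%:A]mulr1.
  have d2 : is_derive (0 : R) 1 (fun h => (F (h + a, b)).2) Ba.
    have := proj1 (@is_derive_line R R H (fun t => (F (t, b)).2) a 1 Ba) dB.
    by under eq_fun do rewrite [_%:A]mulr1.
  exact: (qdD d1 (qdM (qdC 0 J) d2)).
have := dA0; rewrite mul0r addr0; apply: (qd_near r0) => s; rewrite subr0 => hs.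
have Ds : D (s + a, b) by apply: h1; rewrite /= addrK.
by have := hf _ _ Ds hJ => /= <-; rewrite scalerDl addrA.
Qed.

Lemma slice_point J b : imag_unit J -> 0 < b -> let y := b *: J in
  [/\ y * y = (- b ^+ 2) *: 1, qco 0 y = 0,
      \sum_(l < 4 | l != ord0) qco l y *: qunit R l = y &
      \sum_(l < 4 | l != ord0) qco l y ^+ 2 = b ^+ 2].
Proof.
move=> hJ b0 y; have yy : y * y = (- b ^+ 2) *: 1.
  by rewrite /y -scalerAl -scalerAr hJ scalerA -expr2 scalerN scaleNr.
have y0 : qco 0 y = 0 by rewrite /y qcoZ (imag_unit_re hJ) mulr0.
by split=> //; [exact: imag_sum|exact: imag_norm].
Qed.

(** The three imaginary directions are summed with $\sum_ly_le_l=y$ and $e_l^2=-1$. The terms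
    $e_le_lB/b$ contribute $-3B/b$, of which the radial derivative of $B/b$ gives back one. *)
Lemma dbar_offaxis D F f a b J Aa Ba Ab Bb : open D -> induces D F f -> D (a, b) -> 0 < b ->
  imag_unit J ->
  is_derive a 1 (fun t => (F (t, b)).1) Aa -> is_derive a 1 (fun t => (F (t, b)).2) Ba ->
  is_derive b 1 (fun t => (F (a, t)).1) Ab -> is_derive b 1 (fun t => (F (a, t)).2) Bb ->
  dbar f (a%:A + b *: J) =
    2^-1 *: ((Aa - Bb - (2 / b) *: (F (a, b)).2) + J * (Ba + Ab)).
Proof.
move=> oD hf Dz b0 hJ dAa dBa dAb dBb.
have [yy y0 ysum ynorm] := slice_point hJ b0.
set y := b *: J in yy y0 ysum ynorm *.
have bn0 : b != 0 by rewrite gt_eqF.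
have hr : radius b 0 0 = b by rewrite radius0.
pose q := b^-1 *: Bb - b ^- 2 *: (F (a, b)).2.
have pd (l : 'I_4) : l != ord0 -> pderiv l f (a%:A + y) =
    (qco l y / b) *: Ab + (y * ((qco l y / b) *: q) + qunit R l * (b^-1 *: (F (a, b)).2)).
  move=> l0; have ye := qunit_anticomm l0 y0; have ee := qunit_sq R l0.
  have [r r0 hl] := slice_line oD hf Dz b0 yy ee ye.
  have rad : radius b (qco l y) 0 = b by rewrite radius0.
  have dP : is_derive (radius b (qco l y) 0) 1 (fun t => (F (a, t)).1) Ab by rewrite rad.
  have dQ : is_derive (radius b (qco l y) 0) 1 (fun t => t^-1 *: (F (a, t)).2) q.
    by rewrite rad; exact: qd_scaleV.
  have rp : 0 < radius b (qco l y) 0 by rewrite rad.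
  have := qd_line y (qunit R l) rp dP dQ.
  rewrite rad addr0 scale0r addr0 => d0.
  apply: derive_val; apply: (proj2 (is_derive_line f (a%:A + y) (qunit R l) _)).
  by apply: (qd_near r0 _ d0) => s; rewrite subr0 => /hl[_ _ ->].
rewrite /dbar; congr (_ *: _); rewrite (bigD1 ord0) //= qunit0 mul1r.
have -> : pderiv ord0 f (a%:A + y) = Aa + J * Ba.
  by rewrite /pderiv qunit0; have [] := pderiv0_slice oD hf Dz hJ dAa dBa.
rewrite (eq_bigr (fun l : 'I_4 => (b^-1 *: (qco l y *: qunit R l)) * (Ab + y * q)
    - b^-1 *: (F (a, b)).2)); last first.
  move=> l l0; rewrite (pd l l0); set e := qunit R l; set k := qco l y; set B := (F _).2.
  rewrite !(mulrDr e) -(scalerAr (k / b) e Ab) -(scalerAr (k / b) y q) -(scalerAr (k / b) e (y * q)).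
  rewrite (mulrA e e) (qunit_sq R l0) mulN1r scalerA (mulrC b^-1 k).
  rewrite (mulrDr ((k / b) *: e) Ab (y * q)).
  by rewrite -(scalerAl (k / b) e Ab) -(scalerAl (k / b) e (y * q)) addrA.
rewrite big_split /= -mulr_suml -scaler_sumr ysum sum_imag_cst.
have -> : b^-1 *: y = J by rewrite /y scalerA mulVf // scale1r.
have Jy : J * y = (- b) *: 1 by rewrite /y -(scalerAr b J J) hJ scalerN scaleNr.
set B := (F (a, b)).2.
have -> : J * (Ab + y * q) = J * Ab - Bb + b^-1 *: B.
  rewrite mulrDr (mulrA J) Jy -(scalerAl (- b) 1 q) mul1r /q -/B scalerBr !scalerA mulNr mulfV //.
  rewrite scaleN1r addrA; congr (_ + _); rewrite -scaleNr; congr (_ *: _).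
  by field.
by rewrite mulrDr; qlin.
Qed.

(** At a real point each of the units $i,j,k$ is itself the imaginary unit of the line in its
    direction, so each of the three directions contributes $-B_b$. *)
Lemma dbar_axis D F f a J Aa Ba Ab Bb : open D -> induces D F f -> D (a, 0) ->
  imag_unit J ->
  is_derive a 1 (fun t => (F (t, 0)).1) Aa -> is_derive a 1 (fun t => (F (t, 0)).2) Ba ->
  is_derive (0 : R) 1 (fun t => (F (a, t)).1) Ab ->
  is_derive (0 : R) 1 (fun t => (F (a, t)).2) Bb -> Ab = 0 -> Ba = 0 ->
  dbar f (a%:A) = 2^-1 *: (Aa - 3 *: Bb).
Proof.
move=> oD hf Dz hJ dAa dBa dAb dBb Ab0 Ba0.
rewrite /dbar; congr (_ *: _); rewrite (bigD1 ord0) //= qunit0 mul1r.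
have -> : pderiv ord0 f (a%:A) = Aa + J * Ba.
  rewrite /pderiv qunit0; have := pderiv0_slice oD hf Dz hJ dAa dBa.
  by rewrite scale0r addr0 => -[].
rewrite Ba0 mulr0 addr0 (eq_bigr (fun=> - Bb)) ?sum_imag_cst; last first.
  move=> l l0; have [r r0 [_ hr]] := open_lines oD Dz.
  rewrite -(_ : qunit R l * (qunit R l * Bb) = - Bb); last by rewrite mulrA qunit_sq // mulN1r.
  congr (_ * _); apply: derive_val; apply: (proj2 (is_derive_line f (a%:A) (qunit R l) _)).
  have := qdD dAb (qdM (qdC 0 (qunit R l)) dBb); rewrite Ab0 mul0r addr0 add0r.
  apply: (qd_near r0) => s; rewrite subr0 => hs.
  have Ds : D (a, s) by apply: hr; rewrite /= subr0.
  by have := hf _ _ Ds (qunit_sq R l0) => /= <-; rewrite addrC.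
by rewrite mulrSr mulr2n; qlin.
Qed.

End FirstOrder.

(** * The first order system of an axially monogenic stem *)

Section Stems.
Variable R : realType.
Local Notation H := (quat R).
Local Notation HC := (quatC R).
Local Notation C := (cplx R).
Implicit Types (D : set C) (F : C -> HC) (f : H -> H) (phi : C -> H) (x J : H) (z w : C).

Lemma is_derive_ea (W : normedModType R) (u : C -> W) z d :
  is_derive z ((1, 0) : C) u d <-> is_derive z.1 1 (fun t => u (t, z.2)) d.
Proof.
have e : (fun h : R => u (h *: ((1, 0) : C) + z)) = (fun h : R => u (h *: 1 + z.1, z.2)).
  apply/funext => h; congr (u _).
  by rewrite [LHS]surjective_pairing /= [h *: (0 : R)]mulr0 add0r.
split=> [/is_derive_line|H].
  by rewrite e => H; apply/(is_derive_line (fun t : R => u (t, z.2)) z.1 1 d).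
by apply/is_derive_line; rewrite e; apply/(is_derive_line (fun t : R => u (t, z.2)) z.1 1 d).
Qed.

Lemma is_derive_eb (W : normedModType R) (u : C -> W) z d :
  is_derive z ((0, 1) : C) u d <-> is_derive z.2 1 (fun t => u (z.1, t)) d.
Proof.
have e : (fun h : R => u (h *: ((0, 1) : C) + z)) = (fun h : R => u (z.1, h *: 1 + z.2)).
  apply/funext => h; congr (u _).
  by rewrite [LHS]surjective_pairing /= [h *: (0 : R)]mulr0 add0r.
split=> [/is_derive_line|H].
  by rewrite e => H; apply/(is_derive_line (fun t : R => u (z.1, t)) z.2 1 d).
by apply/is_derive_line; rewrite e; apply/(is_derive_line (fun t : R => u (z.1, t)) z.2 1 d).
Qed.

Definition qdx phi z : H := \row_(l < 4) dx (fun w => qco l (phi w)) z.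
Definition qdy phi z : H := \row_(l < 4) dy (fun w => qco l (phi w)) z.

Lemma qco_qdx l phi z : (l < 4)%N -> qco l (qdx phi z) = dx (fun w => qco l (phi w)) z.
Proof. by move=> l4; rewrite {1}/qco mxE inordK. Qed.

Lemma qco_qdy l phi z : (l < 4)%N -> qco l (qdy phi z) = dy (fun w => qco l (phi w)) z.
Proof. by move=> l4; rewrite {1}/qco mxE inordK. Qed.

Lemma qdx_is phi z : (forall l, (l < 4)%N ->
    xder (fun w => qco l (phi w)) z (dx (fun w => qco l (phi w)) z)) ->
  is_derive z.1 1 (fun t => phi (t, z.2)) (qdx phi z).
Proof. by move=> h; apply/is_derive_qco => l l4; rewrite qco_qdx //; exact: h. Qed.

Lemma qdy_is phi z : (forall l, (l < 4)%N ->
    yder (fun w => qco l (phi w)) z (dy (fun w => qco l (phi w)) z)) ->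
  is_derive z.2 1 (fun t => phi (z.1, t)) (qdy phi z).
Proof. by move=> h; apply/is_derive_qco => l l4; rewrite qco_qdy //; exact: h. Qed.

Lemma xder_qco phi z d l : is_derive z.1 1 (fun t => phi (t, z.2)) d -> (l < 4)%N ->
  xder (fun w => qco l (phi w)) z (qco l d).
Proof. by move=> /is_derive_qco h l4; exact: h. Qed.

Lemma yder_qco phi z d l : is_derive z.2 1 (fun t => phi (z.1, t)) d -> (l < 4)%N ->
  yder (fun w => qco l (phi w)) z (qco l d).
Proof. by move=> /is_derive_qco h l4; exact: h. Qed.

Lemma qdx_eq phi z d : is_derive z.1 1 (fun t => phi (t, z.2)) d -> qdx phi z = d.
Proof.
move=> h; apply/rowP => l; rewrite -(inord_val l) -[LHS]/(qco l _) -[RHS]/(qco l _).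
by rewrite qco_qdx //; apply: xder_dx; apply: xder_qco.
Qed.

Lemma qdy_eq phi z d : is_derive z.2 1 (fun t => phi (z.1, t)) d -> qdy phi z = d.
Proof.
move=> h; apply/rowP => l; rewrite -(inord_val l) -[LHS]/(qco l _) -[RHS]/(qco l _).
by rewrite qco_qdy //; apply: yder_dy; apply: yder_qco.
Qed.

(** Used with [k = 1] and [k = -1], the parities in [b] of the two components of a stem. *)
Lemma parity_x D phi z k d : open D -> conj_invariant D -> D z ->
  (forall w, D w -> phi (cconj w) = k *: phi w) ->
  is_derive z.1 1 (fun t => phi (t, z.2)) d ->
  is_derive z.1 1 (fun t => phi (t, - z.2)) (k *: d).
Proof.
move=> oD cD Dz pk dz; have [r r0 [h1 _]] := open_lines oD Dz.
have := qdZ (derC z.1 k) dz; rewrite scale0r addr0.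
by apply: (qd_near r0) => s hs; rewrite -pk //; exact: h1.
Qed.

Lemma parity_y D phi z k d : open D -> conj_invariant D -> D z ->
  (forall w, D w -> phi (cconj w) = k *: phi w) ->
  is_derive z.2 1 (fun t => phi (z.1, t)) d ->
  is_derive (- z.2) 1 (fun t => phi (z.1, t)) (- k *: d).
Proof.
move=> oD cD Dz pk dz; have [r r0 [_ h2]] := open_lines oD Dz.
have d1 : is_derive (- z.2) 1 (fun t : R => - t) (- 1) by exact: (derN (derI _)).
have d2 : is_derive (- - z.2) 1 (fun t => phi (z.1, t)) d by rewrite opprK.
have := qdZ (derC (- z.2) k) (qd_comp d2 d1); rewrite scale0r addr0 scalerA mulrN1.
apply: (qd_near r0) => s hs; rewrite -pk /cconj /= ?opprK //.
by apply: h2; rewrite -normrN opprD !opprK; move: hs; rewrite opprK.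
Qed.

Lemma stem1 D F w : stem D F -> D w -> (F (cconj w)).1 = 1 *: (F w).1.
Proof. by move=> h /h ->; rewrite scale1r. Qed.

Lemma stem2 D F w : stem D F -> D w -> (F (cconj w)).2 = (-1) *: (F w).2.
Proof. by move=> h /h ->; rewrite scaleN1r. Qed.

Definition pda F z : HC := (qdx (fun w => (F w).1) z, qdx (fun w => (F w).2) z).
Definition pdb F z : HC := (qdy (fun w => (F w).1) z, qdy (fun w => (F w).2) z).

Definition c1 l F z := qco l (F z).1.
Definition c2 l F z := qco l (F z).2.

Definition amH D F := forall l, (l < 4)%N -> amsys D (c1 l F) (c2 l F).

Lemma add_imag_eq0 (X Y J : H) : imag_unit J -> X + J * Y = 0 -> X + (- J) * Y = 0 ->
  X = 0 /\ Y = 0.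
Proof.
move=> hJ e1 e2; have X0 : X = 0.
  apply: (@scalerI _ _ (2 : R)); first by rewrite pnatr_eq0.
  rewrite scaler0 scaler_nat mulr2n; have := congr2 +%R e1 e2.
  by rewrite mulNr addrACA subrr !addr0.
split=> //; move: e1; rewrite X0 add0r => /(congr1 (fun q => - (J * q))).
by rewrite mulrA hJ mulN1r opprK mulr0 oppr0.
Qed.

Lemma stem_real D F a : stem D F -> D (a, 0) -> (F (a, 0)).2 = 0.
Proof.
move=> sF Da; have := stem2 sF Da; rewrite /cconj /= oppr0 scaleN1r => /eqP.
rewrite -subr_eq0 opprK -mulr2n -scaler_nat scaler_eq0 pnatr_eq0 /=.
by move/eqP.
Qed.

Lemma qdouble0 (d : H) : d = - d -> d = 0.
Proof.
move=> /eqP; rewrite -subr_eq0 opprK -mulr2n -scaler_nat scaler_eq0 pnatr_eq0 /=.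
by move/eqP.
Qed.

Lemma axis_derivatives D F a Ba Ab : open D -> conj_invariant D -> stem D F -> D (a, 0) ->
  is_derive a 1 (fun t => (F (t, 0)).2) Ba ->
  is_derive (0 : R) 1 (fun t => (F (a, t)).1) Ab -> Ab = 0 /\ Ba = 0.
Proof.
move=> oD cD sF Da dB dA; split.
  apply: qdouble0; have := @parity_y D (fun w => (F w).1) (a, 0) 1 Ab oD cD Da.
  move=> /(_ (fun w Dw => stem1 sF Dw) dA) /=; rewrite oppr0 scaleN1r => dA'.
  exact: (is_derive_uniqV dA dA').
have [r r0 [h1 _]] := open_lines oD Da.
apply: (is_derive_uniqV dB); apply: (qd_near r0 _ (qdC a 0)) => s /h1 Ds.
by rewrite (stem_real sF Ds).
Qed.

Definition has_partials D F Fa Fb := forall z, D z ->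
  [/\ is_derive z.1 1 (fun t => (F (t, z.2)).1) (Fa z).1,
      is_derive z.1 1 (fun t => (F (t, z.2)).2) (Fa z).2,
      is_derive z.2 1 (fun t => (F (z.1, t)).1) (Fb z).1 &
      is_derive z.2 1 (fun t => (F (z.1, t)).2) (Fb z).2].

(** For $b>0$, evaluation at [J] and at [- J] separates the two equations. For $b<0$ they follow by
    parity, and at $b=0$ parity alone makes every term vanish. *)
Lemma dbar_system D F (Fa Fb : C -> HC) f z : open D -> conj_invariant D -> stem D F ->
  has_partials D F Fa Fb -> induces D F f -> (forall x, Omega D x -> dbar f x = 0) ->
  D z -> (Fb z).1 = - (Fa z).2 /\ z.2 *: ((Fa z).1 - (Fb z).2) = 2 *: (F z).2.
Proof.
move=> oD cD sF hF hf hd.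
suff pos w : D w -> 0 < w.2 -> (Fb w).1 = - (Fa w).2 /\
    w.2 *: ((Fa w).1 - (Fb w).2) = 2 *: (F w).2.
  move=> Dz; have [a1 a2 b1 b2] := hF z Dz.
  have [z0|z0|z0] := ltrgtP z.2 0; last 2 first.
  - exact: pos.
  - have [a ez] : exists a, z = (a, 0).
      by exists z.1; rewrite [LHS]surjective_pairing z0.
    subst z; have [-> ->] := axis_derivatives oD cD sF Dz a2 b1.
    by rewrite oppr0 scale0r (stem_real sF Dz) scaler0.
  - have Dw := cD z Dz; have w0 : 0 < (cconj z).2 by rewrite /= oppr_gt0.
    have [a1' a2' b1' b2'] := hF _ Dw.
    have e1 := is_derive_uniqV a1' (parity_x oD cD Dz (fun w Dw => stem1 sF Dw) a1).
    have e2 := is_derive_uniqV a2' (parity_x oD cD Dz (fun w Dw => stem2 sF Dw) a2).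
    have e3 := is_derive_uniqV b1' (parity_y oD cD Dz (fun w Dw => stem1 sF Dw) b1).
    have e4 := is_derive_uniqV b2' (parity_y oD cD Dz (fun w Dw => stem2 sF Dw) b2).
    have [] := pos _ Dw w0; rewrite e1 e2 e3 e4 (stem2 sF Dz) /= !scaleN1r !opprK !scale1r.
    move=> h1 h2; split; first by rewrite -[LHS]opprK h1.
    by apply: oppr_inj; rewrite -scaleNr h2 scalerN.
case: w => a b Dw /= b0; have [J hJ] := imag_unit_ex R; have hNJ := imag_unitN hJ.
have [a1 a2 b1 b2] := hF _ Dw; rewrite /= in a1 a2 b1 b2 *.
have h1 := dbar_offaxis oD hf Dw b0 hJ a1 a2 b1 b2.
have h2 := dbar_offaxis oD hf Dw b0 hNJ a1 a2 b1 b2.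
rewrite hd in h1; last by exists (a, b), J.
rewrite hd in h2; last by exists (a, b), (- J).
have half (d : H) : 0 = 2^-1 *: d -> d = 0.
  by move=> /esym/eqP; rewrite scaler_eq0 invr_eq0 pnatr_eq0 /= => /eqP.
have [e1 e2] := add_imag_eq0 hJ (half _ h1) (half _ h2).
split; first by apply/eqP; rewrite -addr_eq0 addrC; apply/eqP.
move/eqP: e1; rewrite subr_eq0 => /eqP ->; rewrite scalerA.
by congr (_ *: _); field; rewrite gt_eqF.
Qed.

Lemma amH_of_partials D F (Fa Fb : C -> HC) : open D -> has_partials D F Fa Fb ->
  (forall z, D z -> {for z, continuous Fa}) -> (forall z, D z -> {for z, continuous Fb}) ->
  (forall z, D z -> (Fb z).1 = - (Fa z).2 /\ z.2 *: ((Fa z).1 - (Fb z).2) = 2 *: (F z).2) ->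
  amH D F.
Proof.
move=> oD hF ca cb eqs.
move=> l l4.
have qc (G : C -> HC) z : {for z, continuous G} ->
    {for z, continuous (c1 l G)} /\ {for z, continuous (c2 l G)}.
  by move=> /continuous_pairP[/continuous_qco h1 /continuous_qco h2]; split; [exact: h1|exact: h2].
apply: (@amsys_of _ D _ _ (c1 l (Fa)) (c1 l (Fb)) (c2 l (Fa)) (c2 l (Fb)))
  => // z Dz.
- by have [h1 h2 _ _] := hF z Dz; exact: (xder_qco (phi := fun w => (F w).1) (h1) l4).
- by have [_ _ h3 h4] := hF z Dz; exact: (yder_qco (phi := fun w => (F w).1) (h3) l4).
- by have [h1 h2 _ _] := hF z Dz; exact: (xder_qco (phi := fun w => (F w).2) (h2) l4).
- by have [_ _ h3 h4] := hF z Dz; exact: (yder_qco (phi := fun w => (F w).2) (h4) l4).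
- by have [] := qc _ _ (ca z Dz).
- by have [] := qc _ _ (cb z Dz).
- by have [] := qc _ _ (ca z Dz).
- by have [] := qc _ _ (cb z Dz).
- by have [h _] := eqs z Dz; rewrite /c1 /c2 h qcoN.
- by have [_ /(congr1 (qco l))] := eqs z Dz; rewrite !qcoZ qcoD qcoN.
Qed.

Lemma axmono_amH D F f : open D -> conj_invariant D -> stem D F -> C1_on D F ->
  induces D F f -> (forall x, Omega D x -> dbar f x = 0) -> amH D F.
Proof.
move=> oD cD sF cF hf hd.
have hp : has_partials D F (dalpha F) (dbeta F).
  move=> z /cF[h1 h2 _ _].
  have e12 := proj1 (is_derive_pair _ _ _ _) (proj1 (is_derive_ea _ _ _) (derivableP h1)).
  have e34 := proj1 (is_derive_pair _ _ _ _) (proj1 (is_derive_eb _ _ _) (derivableP h2)).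
  case: e12 e34 => e1 e2 [e3 e4].
  by split; [exact: e1|exact: e2|exact: e3|exact: e4].
apply: (amH_of_partials oD hp).
- by move=> z /cF[].
- by move=> z /cF[].
- by move=> z; exact: (dbar_system oD cD sF hp hf hd).
Qed.

Lemma amH_da D F z : amH D F -> D z -> is_derive z.1 1 (fun t => (F (t, z.2)).1) (pda F z).1 /\
  is_derive z.1 1 (fun t => (F (t, z.2)).2) (pda F z).2.
Proof.
move=> hF Dz; split.
  by apply: (qdx_is (phi := fun w => (F w).1)) => l l4; exact: (am_Ax (hF l l4) Dz).
by apply: (qdx_is (phi := fun w => (F w).2)) => l l4; exact: (am_Bx (hF l l4) Dz).
Qed.

Lemma amH_db D F z : amH D F -> D z -> is_derive z.2 1 (fun t => (F (z.1, t)).1) (pdb F z).1 /\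
  is_derive z.2 1 (fun t => (F (z.1, t)).2) (pdb F z).2.
Proof.
move=> hF Dz; split.
  by apply: (qdy_is (phi := fun w => (F w).1)) => l l4; exact: (am_Ay (hF l l4) Dz).
by apply: (qdy_is (phi := fun w => (F w).2)) => l l4; exact: (am_By (hF l l4) Dz).
Qed.

Lemma amH_eqs D F z : amH D F -> D z -> (pdb F z).1 = - (pda F z).2 /\
  z.2 *: ((pda F z).1 - (pdb F z).2) = 2 *: (F z).2.
Proof.
move=> hF Dz; split; apply/rowP => l; rewrite -(inord_val l) -[LHS]/(qco l _) -[RHS]/(qco l _).
  by rewrite qcoN qco_qdx // qco_qdy //; exact: (am_eq1 (hF l (ltn_ord l)) Dz).
rewrite !qcoZ qcoD qcoN qco_qdx // qco_qdy //; exact: (am_eq2 (hF l (ltn_ord l)) Dz).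
Qed.

Lemma amH_derive D F z : amH D F -> D z ->
  is_derive z ((1, 0) : C) F (pda F z) /\ is_derive z ((0, 1) : C) F (pdb F z).
Proof.
by move=> hF Dz; split; [apply/is_derive_ea|apply/is_derive_eb]; apply/is_derive_pair;
  [exact: (amH_da hF Dz)|exact: (amH_db hF Dz)].
Qed.

Lemma amH_C1 D F : open D -> amH D F -> C1_on D F.
Proof.
move=> oD hF z Dz; have [[h1 _] [h2 _]] := amH_derive hF Dz.
split; [exact: h1|exact: h2| |].
  have e w : D w -> pda F w = dalpha F w by move=> Dw; have [[_ <-] _] := amH_derive hF Dw.
  apply: (cont_ext oD Dz e); apply/continuous_pairP; split; apply/continuous_qco => l l4.
    rewrite (_ : (fun s => qco l _) = dx (c1 l F)); first exact: (am_cAx (hF l l4) Dz).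
    by apply/funext => w; rewrite qco_qdx.
  rewrite (_ : (fun s => qco l _) = dx (c2 l F)); first exact: (am_cBx (hF l l4) Dz).
  by apply/funext => w; rewrite qco_qdx.
have e w : D w -> pdb F w = dbeta F w by move=> Dw; have [_ [_ <-]] := amH_derive hF Dw.
apply: (cont_ext oD Dz e); apply/continuous_pairP; split; apply/continuous_qco => l l4.
  rewrite (_ : (fun s => qco l _) = dy (c1 l F)); first exact: (am_cAy (hF l l4) Dz).
  by apply/funext => w; rewrite qco_qdy.
rewrite (_ : (fun s => qco l _) = dy (c2 l F)); first exact: (am_cBy (hF l l4) Dz).
by apply/funext => w; rewrite qco_qdy.
Qed.

(** At $b=0$ the second equation is void. Nearby it reads $B=\frac b2(A_a-B_b)$, and its derivative
    in $b$ at 0 is the relation that [dbar_axis] calls for. *)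
Lemma amsys_axis (Q : set C) (A B : C -> R) a : open Q -> amsys Q A B -> Q (a, 0) ->
  dx A (a, 0) = 3 * dy B (a, 0).
Proof.
move=> oQ h Q0; have cg : {for (0 : R), continuous
    (fun t => 2^-1 * dx A (a, t) + (- 2^-1) * dy B (a, t))}.
  apply: (@cont_line _ (fun z => 2^-1 * dx A z + (- 2^-1) * dy B z) (a, 0)).
  by apply: cont_lin; [exact: (am_cAx h)|exact: (am_cBy h)].
have d2 := der_mul0 cg; have [r r0 [_ hr]] := open_lines oQ Q0.
have := am_By h Q0; rewrite /yder /= => d1.
suff : 2^-1 * dx A (a, 0) + (- 2^-1) * dy B (a, 0) = dy B (a, 0) by lra.
apply: is_derive_uniq d1; apply: (der_near r0 _ d2) => t /hr /= Qt.
by have /= E := am_eq2 h Qt; move: E; clear; lra.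
Qed.

Lemma amH_axmono D F f : open D -> conj_invariant D -> stem D F -> amH D F ->
  induces D F f -> axially_monogenic D f.
Proof.
move=> oD cD sF hF hf; split; first by exists F; split; [exact: sF|exact: (amH_C1 oD hF)|exact: hf].
have pos a b J : D (a, b) -> 0 < b -> imag_unit J -> dbar f (a%:A + b *: J) = 0.
  move=> Dz b0 hJ; have [a1 a2] := amH_da hF Dz; have [b1 b2] := amH_db hF Dz.
  have [e1 e2] := amH_eqs hF Dz; rewrite /= in a1 a2 b1 b2 e1 e2.
  rewrite (dbar_offaxis oD hf Dz b0 hJ a1 a2 b1 b2) e1 subrr mulr0 addr0.
  rewrite mulrC -scalerA -e2 scalerA mulVf ?gt_eqF // scale1r subrr scaler0 //.
move=> x [[a b] [J [Dz hJ ->]]] /=; have [b0|b0|b0] := ltrgtP b 0; last 2 first.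
- exact: pos.
- subst b; rewrite scale0r addr0.
  have [a1 a2] := amH_da hF Dz; have [b1 b2] := amH_db hF Dz; rewrite /= in a1 a2 b1 b2.
  have [e1 e2] := axis_derivatives oD cD sF Dz a2 b1.
  rewrite (dbar_axis oD hf Dz hJ a1 a2 b1 b2 e1 e2).
  apply/rowP => l; rewrite -(inord_val l) -[LHS]/(qco l _) -[RHS]/(qco l _).
  rewrite qcoZ qcoD qcoN qcoZ qco_qdx // qco_qdy // qco0.
  by rewrite (amsys_axis oD (hF l (ltn_ord l)) Dz) subrr mulr0.
- have -> : b *: J = (- b) *: (- J) by rewrite scaleNr scalerN opprK.
  by apply: pos; [exact: (cD _ Dz)|rewrite oppr_gt0|exact: imag_unitN].
Qed.

End Stems.

(** * Fueter's theorem *)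

Section Laplacian.
Variable R : realType.
Local Notation H := (quat R).
Local Notation HC := (quatC R).
Local Notation C := (cplx R).
Implicit Types (D : set C) (F : C -> HC) (f : H -> H) (x y e J d : H) (z w : C) (s t a b c r : R).

(** [fd_1a] and [fd_1b] are the Cauchy-Riemann equations written with $F_2=bG$, and [fd_eq] is the
    harmonicity of $bG$. With [G] given up to the axis, no division by [b] occurs there. *)
Record fueter_data D F (G Ga Gb Gaa Gab Gbb : C -> H) : Prop := FueterData
  { fd_stem : stem D F;
    fd_2 : forall z, D z -> (F z).2 = z.2 *: G z;
    fd_1a : forall z, D z -> is_derive z.1 1 (fun t => (F (t, z.2)).1) (G z + z.2 *: Gb z);
    fd_1b : forall z, D z -> is_derive z.2 1 (fun t => (F (z.1, t)).1) ((- z.2) *: Ga z);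
    fd_a : forall z, D z -> is_derive z.1 1 (fun t => G (t, z.2)) (Ga z);
    fd_b : forall z, D z -> is_derive z.2 1 (fun t => G (z.1, t)) (Gb z);
    fd_aa : forall z, D z -> is_derive z.1 1 (fun t => Ga (t, z.2)) (Gaa z);
    fd_ab : forall z, D z -> is_derive z.2 1 (fun t => Ga (z.1, t)) (Gab z);
    fd_ba : forall z, D z -> is_derive z.1 1 (fun t => Gb (t, z.2)) (Gab z);
    fd_bb : forall z, D z -> is_derive z.2 1 (fun t => Gb (z.1, t)) (Gbb z);
    fd_eq : forall z, D z -> z.2 *: (Gaa z + Gbb z) + 2 *: Gb z = 0 }.

Section Data.
Variables (D : set C) (F : C -> HC) (G Ga Gb Gaa Gab Gbb : C -> H) (f : H -> H).
Hypotheses (oD : open D) (cD : conj_invariant D) (hF : fueter_data D F G Ga Gb Gaa Gab Gbb)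
  (hf : induces D F f).

Let slide (phi : C -> H) a b d s : is_derive (s + a) 1 (fun t => phi (t, b)) d ->
  is_derive s 1 (fun h => phi (h + a, b)) d.
Proof.
move=> h; have ds : is_derive s 1 (fun h : R => h + a) 1 by der; rewrite /= addr0.
by have := @qd_comp R (fun h => h + a) (fun t => phi (t, b)) s 1 d h ds; rewrite scale1r.
Qed.

Lemma pderiv00 a b J : D (a, b) -> imag_unit J ->
  pderiv ord0 (pderiv ord0 f) (a%:A + b *: J) =
  Ga (a, b) + b *: Gab (a, b) + J * (b *: Gaa (a, b)).
Proof.
move=> Dz hJ; have [r r0 [h1 _]] := open_lines oD Dz.
have Ds s : `|s| < r -> D (s + a, b) by move=> hs; apply: h1; rewrite /= addrK.
pose g s := G (s + a, b) + b *: Gb (s + a, b) + J * (b *: Ga (s + a, b)).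
have dcst b' (phi : C -> H) s d : is_derive s 1 (fun h => phi (h + a, b)) d ->
    is_derive s 1 (fun h => b' *: phi (h + a, b)) (b' *: d).
  by move=> h; have := qdZ (derC s b') h; rewrite scale0r addr0.
have dmul s (phi : R -> H) d : is_derive s 1 phi d -> is_derive s 1 (fun h => J * phi h) (J * d).
  by move=> h; have := qdM (qdC s J) h; rewrite mul0r addr0.
have dg s : `|s| < r -> is_derive s 1 (fun s => f (s *: qunit R ord0 + (a%:A + b *: J))) (g s).
  move=> hs; have Dsa := Ds s hs.
  have d1 := slide (phi := fun w => (F w).1) (fd_1a hF Dsa).
  have d2 := dmul _ _ _ (dcst b _ _ _ (slide (fd_a hF Dsa))).
  have [r2 r20 hr2] : exists2 r2, 0 < r2 & forall k, `|k - s| < r2 -> `|k| < r.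
    exists (r - `|s|); first by rewrite subr_gt0.
    by move=> k hk; rewrite -(subrK s k); apply: le_lt_trans (ler_normD _ _) _; lra.
  apply: (qd_near r20 _ (qdD d1 d2)) => k /hr2 /Ds Dk.
  rewrite qunit0; have := hf Dk hJ => /=; rewrite (fd_2 hF Dk) /= scalerDl addrA => ->.
  by [].
have [_ h2] := derive_along r0 dg.
have D0 := Dz; have d0 : is_derive (0 : R) 1 g
    (Ga (a, b) + b *: Gab (a, b) + J * (b *: Gaa (a, b))).
  have e0 : (a, b) = (0 + a, b) by rewrite add0r.
  rewrite e0 in Dz *; apply: qdD; first apply: qdD.
  - exact: (slide (fd_a hF Dz)).
  - exact: (dcst b _ _ _ (slide (fd_ba hF Dz))).
  - exact: (dmul _ _ _ (dcst b _ _ _ (slide (fd_aa hF Dz)))).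
by have [_ <-] := h2 _ d0.
Qed.

Lemma pderivll_axis a (l : 'I_4) : l != ord0 -> D (a, 0) ->
  pderiv l (pderiv l f) (a%:A) = - Ga (a, 0).
Proof.
move=> l0 Dz; have [r r0 [_ h1]] := open_lines oD Dz; set e := qunit R l.
have Ds s : `|s| < r -> D (a, s) by move=> hs; apply: h1; rewrite /= subr0.
pose g s := (- s) *: Ga (a, s) + e * (s *: Gb (a, s) + 1 *: G (a, s)).
have dmul s (phi : R -> H) d : is_derive s 1 phi d -> is_derive s 1 (fun h => e * phi h) (e * d).
  by move=> h; have := qdM (qdC s e) h; rewrite mul0r addr0.
have dg s : `|s| < r -> is_derive s 1 (fun s => f (s *: e + a%:A)) (g s).
  move=> hs; have Dsa := Ds s hs.
  have d1 := fd_1b hF Dsa; have d2 := dmul _ _ _ (qdZ (derI s) (fd_b hF Dsa)).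
  have [r2 r20 hr2] : exists2 r2, 0 < r2 & forall k, `|k - s| < r2 -> `|k| < r.
    exists (r - `|s|); first by rewrite subr_gt0.
    by move=> k hk; rewrite -(subrK s k); apply: le_lt_trans (ler_normD _ _) _; lra.
  apply: (qd_near r20 _ (qdD d1 d2)) => k /hr2 /Ds Dk.
  by have := hf Dk (qunit_sq R l0) => /=; rewrite (fd_2 hF Dk) /= addrC => ->.
have [_ h2] := derive_along r0 dg.
have Gb0 : Gb (a, 0) = 0.
  have := fd_eq hF Dz; rewrite /= scale0r add0r => /eqP.
  by rewrite scaler_eq0 pnatr_eq0 /= => /eqP.
have dN : is_derive (0 : R) 1 (fun s : R => - s) (- 1) by exact: (derN (derI _)).
have d0 := qdD (qdZ dN (fd_ab hF Dz))
  (dmul _ _ _ (qdD (qdZ (derI 0) (fd_bb hF Dz)) (qdZ (derC 0 1) (fd_b hF Dz)))).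
have [_ E] := h2 _ d0; rewrite /pderiv E /= Gb0 oppr0 !scale0r !scaler0 !addr0 mulr0 addr0 add0r.
by rewrite scaleN1r.
Qed.

Lemma pderivll_offaxis a b J (l : 'I_4) : l != ord0 -> D (a, b) -> 0 < b -> imag_unit J ->
  let y := b *: J in let c := qco l y in
  let S := b^-1 *: Gb (a, b) in let S' := b^-1 *: Gbb (a, b) - b ^- 2 *: Gb (a, b) in
  pderiv l (pderiv l f) (a%:A + y) =
    c ^+ 2 *: (- (b^-1 *: Gab (a, b)) + y * (b^-1 *: S')) + (- Ga (a, b) + y * S)
    + (c *: qunit R l) * (2 *: S).
Proof.
move=> l0 Dz b0 hJ y c S S'.
have [yy y0 _ _] := slice_point hJ b0; rewrite -/y in yy y0.
have ye := qunit_anticomm l0 y0; have ee := qunit_sq R l0; rewrite -/c in ye.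
set e := qunit R l in ye ee *.
have sF := fd_stem hF.
have [r r0 hl] := slice_line oD hf Dz b0 yy ee ye.
pose rho := radius b c.
have rho0 : rho 0 = b by rewrite /rho radius0.
have rhop s : `|s| < r -> 0 < rho s by move=> /hl[].
have Ds s : `|s| < r -> D (a, rho s) by move=> /hl[].
(* Here $F_2=\rho G$ cancels the factor $\rho^{-1}$ of [slice_line], and $\rho'=(c+s)/\rho$ turns
   $F_{1,b}=-\rho G_a$ into $-(c+s)G_a$. *)
pose g s := (- (c + s)) *: Ga (a, rho s) +
  ((y + s *: e) * ((c + s) *: ((rho s)^-1 *: Gb (a, rho s))) + e * G (a, rho s)).
have dg s : `|s| < r -> is_derive s 1 (fun s => f (s *: e + (a%:A + y))) (g s).
  move=> hs; have d1 := qd_line y e (rhop s hs) (fd_1b hF (Ds s hs)) (fd_b hF (Ds s hs)).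
  have rn0 : rho s != 0 by rewrite gt_eqF // rhop.
  have [r2 r20 hr2] : exists2 r2, 0 < r2 & forall k, `|k - s| < r2 -> `|k| < r.
    exists (r - `|s|); first by rewrite subr_gt0.
    by move=> k hk; rewrite -(subrK s k); apply: le_lt_trans (ler_normD _ _) _; lra.
  have -> : g s = ((c + s) / rho s) *: ((- (a, rho s).2) *: Ga (a, rho s))
     + ((y + s *: e) * (((c + s) / rho s) *: Gb (a, rho s)) + e * G (a, rho s)).
    rewrite /g /= !scalerA mulrN divfK //.
  apply: (qd_near r20 _ d1) => k /hr2 hk; have [kp Dk ->] := hl k hk.
  by rewrite (fd_2 hF Dk) /= scalerA mulVf ?scale1r // gt_eqF.
have [_ h2] := derive_along r0 dg.
have r0p : 0 < rho 0 by rewrite rho0.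
have dr : is_derive (0 : R) 1 rho ((c + 0) / rho 0) by exact: radius_derive.
rewrite addr0 rho0 in dr.
have dab : is_derive (rho 0) 1 (fun t => Ga (a, t)) (Gab (a, b)).
  by rewrite rho0; exact: (fd_ab hF Dz).
have db : is_derive (rho 0) 1 (fun t => G (a, t)) (Gb (a, b)).
  by rewrite rho0; exact: (fd_b hF Dz).
have dS : is_derive (rho 0) 1 (fun t => t^-1 *: Gb (a, t)) S'.
  by rewrite rho0; apply: qd_scaleV; [rewrite gt_eqF|exact: (fd_bb hF Dz)].
have dc : is_derive (0 : R) 1 (fun s : R => c + s) 1 by der; rewrite /= add0r.
have dNc : is_derive (0 : R) 1 (fun s : R => - (c + s)) (- 1) by exact: (derN dc).
have dy1 : is_derive (0 : R) 1 (fun s => y + s *: e) e.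
  by have := qdD (qdC (0 : R) y) (qdZ (derI (0 : R)) (qdC 0 e)); rewrite scale0r !add0r scale1r.
have d0 := qdD (qdZ dNc (qd_comp dab dr))
  (qdD (qdM dy1 (qdZ dc (qd_comp dS dr))) (qdM (qdC (0 : R) e) (qd_comp db dr))).
have [_ E] := h2 _ d0; clear dS db dab dr; rewrite /pderiv E /= rho0 !addr0 scale0r addr0 mul0r addr0.
rewrite -/S scale1r scaleN1r.
have -> : e * ((c / b) *: Gb (a, b)) = (c *: e) * S.
  by rewrite /S -(scalerAr (c / b)) -(scalerAr b^-1) -(scalerAl c) scalerA (mulrC b^-1).
clear E h2 d0; clearbody S S'.
rewrite -(scalerAr c e S) -(scalerAl c e S) -(scalerAl c e (2 *: S)) -(scalerAr 2 e S).
rewrite (mulrDr y) !scalerA !scalerDr.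
rewrite -(scalerAr (c * (c / b)) y S') -(scalerAr b^-1 y S') scalerA.
move: (y * S') (y * S) (e * S) => u v w.
by qlin.
Qed.

(** Over the imaginary directions $\sum_ly_l^2=b^2$ and $\sum_ly_le_l=y$; then [fd_eq] eliminates
    $G_{bb}$. The radius being a square root, only $b\ge0$ is treated here. *)
Lemma fueter_laplacian a b J : D (a, b) -> 0 <= b -> imag_unit J ->
  laplacian f (a%:A + b *: J) = (-2) *: Ga (a, b) + J * (2 *: Gb (a, b)).
Proof.
move=> Dz; rewrite le_eqVlt => /orP[/eqP b0|b0] hJ; rewrite /laplacian (bigD1 ord0) //=.
  subst b; rewrite (pderiv00 Dz hJ) scale0r addr0 !scale0r mulr0 !addr0.
  rewrite (eq_bigr (fun=> - Ga (a, 0))) ?sum_imag_cst; last by move=> l l0; exact: pderivll_axis.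
  have -> : Gb (a, 0) = 0.
    have := fd_eq hF Dz; rewrite /= scale0r add0r => /eqP.
    by rewrite scaler_eq0 pnatr_eq0 /= => /eqP.
  by rewrite scaler0 mulr0 addr0 mulrSr mulr2n; qlin.
rewrite (pderiv00 Dz hJ); have [_ _ ysum ynorm] := slice_point hJ b0.
pose S := b^-1 *: Gb (a, b); pose S' := b^-1 *: Gbb (a, b) - b ^- 2 *: Gb (a, b).
pose y := b *: J; rewrite -/y in ysum ynorm *.
rewrite (eq_bigr (fun l : 'I_4 => qco l y ^+ 2 *: (- (b^-1 *: Gab (a, b)) + y * (b^-1 *: S'))
  + (- Ga (a, b) + y * S) + (qco l y *: qunit R l) * (2 *: S))); last first.
  by move=> l l0; exact: pderivll_offaxis.
rewrite big_split big_split /= -scaler_suml ynorm -mulr_suml ysum sum_imag_cst mulrSr mulr2n.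
rewrite /S' /S /y.
have -> : Gbb (a, b) = - Gaa (a, b) - (2 / b) *: Gb (a, b).
  have /= E := fd_eq hF Dz; apply: (@scalerI _ _ b); first by rewrite gt_eqF.
  have bn : b != 0 by rewrite gt_eqF.
  apply/eqP; rewrite -subr_eq0 -E; apply/eqP.
  by apply: quat_eqP; rewrite ?(qcoD, qcoN, qcoZ); field.
have bn : b != 0 by rewrite gt_eqF.
have Jz k u : J * (k *: u) = k *: (J * u) by rewrite -scalerAr.
have bJz u : (b *: J) * u = b *: (J * u) by rewrite -scalerAl.
rewrite !bJz !(Jz, mulrDr J, mulrN J).
by apply: quat_eqP; rewrite ?(qcoD, qcoN, qcoZ); field.
Qed.

End Data.

End Laplacian.

(** * Axially monogenic stems with their derivatives along the real axis *)

Section Jets.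
Variable R : realType.
Local Notation H := (quat R).
Local Notation HC := (quatC R).
Local Notation C := (cplx R).
Implicit Types (D : set C) (F : C -> HC) (f : H -> H) (x J lambda : H) (z w : C)
  (Xs Ys Fs : nat -> C -> HC) (Lambda : seq H) (k : nat).

Lemma continuous_qM (T : topologicalType) (f g : T -> H) t :
  {for t, continuous f} -> {for t, continuous g} -> {for t, continuous (fun s => f s * g s)}.
Proof.
move=> /continuous_qco cf /continuous_qco cg; apply/continuous_qco.
have f0 := cf 0%N isT; have f1 := cf 1%N isT; have f2 := cf 2%N isT; have f3 := cf 3%N isT.
have g0 := cg 0%N isT; have g1 := cg 1%N isT; have g2 := cg 2%N isT; have g3 := cg 3%N isT.
move=> [|[|[|[|//]]]] _.
- rewrite (_ : (fun s => _) = fun s => qco 0 (f s) * qco 0 (g s) -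
    qco 1 (f s) * qco 1 (g s) - qco 2 (f s) * qco 2 (g s) - qco 3 (f s) * qco 3 (g s)).
    by cnt.
  by apply/funext => s; have [] := qcoM (f s) (g s).
- rewrite (_ : (fun s => _) = fun s => qco 0 (f s) * qco 1 (g s) +
    qco 1 (f s) * qco 0 (g s) + qco 2 (f s) * qco 3 (g s) - qco 3 (f s) * qco 2 (g s)).
    by cnt.
  by apply/funext => s; have [] := qcoM (f s) (g s).
- rewrite (_ : (fun s => _) = fun s => qco 0 (f s) * qco 2 (g s) -
    qco 1 (f s) * qco 3 (g s) + qco 2 (f s) * qco 0 (g s) + qco 3 (f s) * qco 1 (g s)).
    by cnt.
  by apply/funext => s; have [] := qcoM (f s) (g s).
- rewrite (_ : (fun s => _) = fun s => qco 0 (f s) * qco 3 (g s) +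
    qco 1 (f s) * qco 2 (g s) - qco 2 (f s) * qco 1 (g s) + qco 3 (f s) * qco 0 (g s)).
    by cnt.
  by apply/funext => s; have [] := qcoM (f s) (g s).
Qed.

Definition rmulC (u : HC) lambda : HC := (u.1 * lambda, u.2 * lambda).

(** A jet is the sequence of the iterated derivatives of its term of index 0 in
    the direction of the real axis. *)
Definition dlam lambda Xs k z : HC := Xs k.+1 z - rmulC (Xs k z) lambda.

Record amdata D F (Fa Fb : C -> HC) : Prop := AmData
  { ad_d : has_partials D F Fa Fb;
    ad_ca : forall z, D z -> {for z, continuous Fa};
    ad_cb : forall z, D z -> {for z, continuous Fb};
    ad_eq : forall z, D z -> (Fb z).1 = - (Fa z).2 /\
      z.2 *: ((Fa z).1 - (Fb z).2) = 2 *: (F z).2 }.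

Lemma amdata_amH D F Fa Fb : open D -> amdata D F Fa Fb -> amH D F.
Proof. by move=> oD [h1 h2 h3 h4]; exact: amH_of_partials h4. Qed.

Lemma amH_amdata D F : open D -> amH D F -> amdata D F (pda F) (pdb F).
Proof.
move=> oD hF; have hp : has_partials D F (pda F) (pdb F).
  by move=> z Dz; have [h1 h2] := amH_da hF Dz; have [h3 h4] := amH_db hF Dz.
have ca z : D z -> {for z, continuous (pda F)}.
  move=> Dz; apply/continuous_pairP; split; apply/continuous_qco => l l4.
    rewrite (_ : (fun s => qco l _) = dx (c1 l F)); first exact: (am_cAx (hF l l4) Dz).
    by apply/funext => w; rewrite qco_qdx.
  rewrite (_ : (fun s => qco l _) = dx (c2 l F)); first exact: (am_cBx (hF l l4) Dz).
  by apply/funext => w; rewrite qco_qdx.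
have cb z : D z -> {for z, continuous (pdb F)}.
  move=> Dz; apply/continuous_pairP; split; apply/continuous_qco => l l4.
    rewrite (_ : (fun s => qco l _) = dy (c1 l F)); first exact: (am_cAy (hF l l4) Dz).
    by apply/funext => w; rewrite qco_qdy.
  rewrite (_ : (fun s => qco l _) = dy (c2 l F)); first exact: (am_cBy (hF l l4) Dz).
  by apply/funext => w; rewrite qco_qdy.
by split=> // z Dz; exact: (amH_eqs hF Dz).
Qed.

Lemma qdMr (f : R -> H) (t : R) (d : H) lambda : is_derive t 1 f d ->
  is_derive t 1 (fun s => f s * lambda) (d * lambda).
Proof. by move=> h; have := qdM h (qdC t lambda); rewrite mulr0 add0r. Qed.

Lemma continuous_lin (T : topologicalType) (f g : T -> HC) t lambda :
  {for t, continuous f} -> {for t, continuous g} ->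
  {for t, continuous (fun s => f s - rmulC (g s) lambda)}.
Proof.
move=> /continuous_pairP[f1 f2] /continuous_pairP[g1 g2]; apply/continuous_pairP; split.
  exact: (@continuousB _ _ _ (fun s => (f s).1) (fun s => (g s).1 * lambda) t f1
    (@continuous_qM _ _ (fun=> lambda) t g1 (@cst_continuous _ _ lambda t))).
exact: (@continuousB _ _ _ (fun s => (f s).2) (fun s => (g s).2 * lambda) t f2
  (@continuous_qM _ _ (fun=> lambda) t g2 (@cst_continuous _ _ lambda t))).
Qed.

Lemma amdata_lin D F Fa Fb G Ga Gb lambda : amdata D F Fa Fb -> amdata D G Ga Gb ->
  amdata D (fun z => F z - rmulC (G z) lambda) (fun z => Fa z - rmulC (Ga z) lambda)
    (fun z => Fb z - rmulC (Gb z) lambda).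
Proof.
move=> [f1 f2 f3 f4] [g1 g2 g3 g4]; split=> z Dz.
- have [a1 a2 b1 b2] := f1 z Dz; have [a1' a2' b1' b2'] := g1 z Dz.
  split.
  + exact: (qdD a1 (qdN (qdMr lambda a1'))).
  + exact: (qdD a2 (qdN (qdMr lambda a2'))).
  + exact: (qdD b1 (qdN (qdMr lambda b1'))).
  + exact: (qdD b2 (qdN (qdMr lambda b2'))).
- exact: (@continuous_lin _ _ _ _ lambda (f2 z Dz) (g2 z Dz)).
- exact: (@continuous_lin _ _ _ _ lambda (f3 z Dz) (g3 z Dz)).
- have [e1 e2] := f4 z Dz; have [e1' e2'] := g4 z Dz; rewrite /rmulC /=; split.
    by rewrite e1 e1' mulNr opprB opprK addrC.
  have -> : (Fa z).1 - (Ga z).1 * lambda - ((Fb z).2 - (Gb z).2 * lambda) =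
    ((Fa z).1 - (Fb z).2) - ((Ga z).1 - (Gb z).2) * lambda.
    by rewrite mulrBl; qlin.
  by rewrite scalerBr e2 scalerAl e2' -scalerAl -scalerBr.
Qed.

(** Monogenicity is asked of every term, so that stability under [dlam] reduces to stability under
    linear combinations. *)
Record amjet D Xs : Prop := AmJet
  { aj_stem : forall k, stem D (Xs k);
    aj_am : forall k, amH D (Xs k);
    aj_da : forall k z, D z -> is_derive z ((1, 0) : C) (Xs k) (Xs k.+1 z) }.

Lemma amjet_data D Xs k : open D -> amjet D Xs -> exists Fb, amdata D (Xs k) (Xs k.+1) Fb.
Proof.
move=> oD h; have [d ca cb e] := amH_amdata oD (aj_am h k).
have eq z : D z -> pda (Xs k) z = Xs k.+1 z.
  move=> Dz; have [d1 _] := amH_derive (aj_am h k) Dz.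
  exact: (is_derive_uniqV d1 (aj_da h k Dz)).
exists (pdb (Xs k)); split=> z Dz.
- by rewrite -(eq z Dz); exact: d.
- exact: (cont_ext oD Dz eq (ca z Dz)).
- exact: (cb z Dz).
- by rewrite -(eq z Dz); exact: e.
Qed.

Lemma stem_lin D F G lambda : stem D F -> stem D G ->
  stem D (fun z => F z - rmulC (G z) lambda).
Proof.
move=> sF sG z Dz; rewrite sF // sG // /qCconj /rmulC /=; congr pair.
by rewrite mulNr opprD.
Qed.

Lemma amjet_lin D Xs Ys lambda : open D -> amjet D Xs -> amjet D Ys ->
  amjet D (fun k z => Xs k z - rmulC (Ys k z) lambda).
Proof.
move=> oD hX hY; split=> k.
- exact: (stem_lin lambda (aj_stem hX k) (aj_stem hY k)).
- have [Fb d1] := amjet_data k oD hX; have [Gb d2] := amjet_data k oD hY.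
  exact: (amdata_amH oD (amdata_lin lambda d1 d2)).
- move=> z Dz; have [Fb [d1 _ _ _]] := amjet_data k oD hX.
  have [Gb [d2 _ _ _]] := amjet_data k oD hY.
  have [a1 a2 _ _] := d1 z Dz; have [a1' a2' _ _] := d2 z Dz.
  apply/is_derive_ea/is_derive_pair; split.
    exact: (qdD a1 (qdN (qdMr lambda a1'))).
  exact: (qdD a2 (qdN (qdMr lambda a2'))).
Qed.

Lemma amjet_dlam D Xs lambda : open D -> amjet D Xs -> amjet D (dlam lambda Xs).
Proof.
move=> oD h; apply: (amjet_lin lambda oD _ h); split=> k.
- exact: (aj_stem h k.+1).
- exact: (aj_am h k.+1).
- exact: (aj_da h k.+1).
Qed.

Lemma amjet_foldr D Xs Lambda : open D -> amjet D Xs -> amjet D (foldr dlam Xs Lambda).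
Proof. by move=> oD h; elim: Lambda => //= a s IH; exact: amjet_dlam. Qed.

Lemma dconj_dbar f x : dconj f x + dbar f x = pderiv ord0 f x.
Proof.
rewrite /dconj /dbar -scalerDr [X in _ + X](bigD1 ord0) //= qunit0 mul1r.
move: (\sum_(_ < _ | _) _) (pderiv _ _ _) => S p.
by apply: quat_eqP; rewrite ?(qcoD, qcoN, qcoZ); field.
Qed.

Lemma Lop_jet D Xs f lambda : open D -> conj_invariant D -> amjet D Xs ->
  induces D (Xs 0%N) f -> induces D (dlam lambda Xs 0%N) (Lop lambda f).
Proof.
move=> oD cD h hf z J Dz hJ.
have [_ am0] := amH_axmono oD cD (aj_stem h 0%N) (aj_am h 0%N) hf.
have := dconj_dbar f (z.1%:A + z.2 *: J); rewrite am0; last by exists z, J.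
rewrite addr0 /Lop => ->.
have [d1 d2] := proj1 (is_derive_pair _ _ _ _) (proj1 (is_derive_ea _ _ _) (aj_da h 0%N Dz)).
case: z Dz d1 d2 => a b Dz d1 d2.
have := pderiv0_slice oD hf Dz hJ d1 d2; rewrite /= /pderiv qunit0 => -[_ ->].
have := hf (a, b) J Dz hJ => /= ->; rewrite /dlam /rmulC /=.
by rewrite mulrDl mulrBr -mulrA opprD addrACA.
Qed.

Lemma Lop_foldr D Xs f Lambda : open D -> conj_invariant D -> amjet D Xs ->
  induces D (Xs 0%N) f -> induces D (foldr dlam Xs Lambda 0%N) (foldr (@Lop R) f Lambda).
Proof.
move=> oD cD h hf; elim: Lambda => //= a s IH.
by apply: Lop_jet => //; exact: amjet_foldr.
Qed.

Lemma amjet_solution D Xs f Lambda : open D -> conj_invariant D -> amjet D Xs ->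
  induces D (Xs 0%N) f -> (forall z, D z -> foldr dlam Xs Lambda 0%N z = 0) ->
  is_solution D Lambda f.
Proof.
move=> oD cD h hf h0; split.
  exact: (amH_axmono oD cD (aj_stem h 0%N) (aj_am h 0%N) hf).
move=> x [z [J [Dz hJ ->]]]; rewrite (Lop_foldr Lambda oD cD h hf Dz hJ) h0 //=.
by rewrite mulr0 addr0.
Qed.

(** [amsys_dx] supplies derivatives of all orders from a stem that is only $C^1$. Testing the
    equation with [J] and [- J] turns it into an equation between stems. *)
Lemma solution_jet D f Lambda : open D -> conj_invariant D -> is_solution D Lambda f ->
  exists Xs, [/\ amjet D Xs, induces D (Xs 0%N) f &
    forall z, D z -> foldr dlam Xs Lambda 0%N z = 0].
Proof.
move=> oD cD [[[F [sF cF hF]] hd] hL].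
have am0 := axmono_amH oD cD sF cF hF hd.
pose Xs k := iter k (@pda R) F.
have am k : amH D (Xs k).
  elim: k => //= k IH l l4; have hl := amsys_dx oD (IH l l4).
  by apply: (amsys_ext oD hl) => w _; rewrite /c1 /c2 /= qco_qdx.
have st k : stem D (Xs k).
  elim: k => //= k IH z Dz; have Dw := cD z Dz.
  have [a1 a2] := amH_da (am k) Dz; have [a1' a2'] := amH_da (am k) Dw.
  have e1 := is_derive_uniqV a1' (parity_x oD cD Dz (fun w Dw => stem1 IH Dw) a1).
  have e2 := is_derive_uniqV a2' (parity_x oD cD Dz (fun w Dw => stem2 IH Dw) a2).
  by rewrite [LHS]surjective_pairing e1 e2 scale1r scaleN1r.
have jet : amjet D Xs by split=> // k z Dz; have [] := amH_derive (am k) Dz.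
exists Xs; split=> // z Dz; have [J hJ] := imag_unit_ex R.
have h1 := Lop_foldr Lambda oD cD jet hF Dz hJ.
have h2 := Lop_foldr Lambda oD cD jet hF Dz (imag_unitN hJ).
rewrite hL in h1; last by exists z, J.
rewrite hL in h2; last by exists z, (- J); split=> //; exact: imag_unitN.
have [e1 e2] := add_imag_eq0 hJ (esym h1) (esym h2).
by rewrite [LHS]surjective_pairing e1 e2.
Qed.

End Jets.

(** * Fueter's map on jets *)

Section Fueter.
Variable R : realType.
Local Notation H := (quat R).
Local Notation HC := (quatC R).
Local Notation C := (cplx R).
Implicit Types (D : set C) (F : C -> HC) (G : C -> H) (f : H -> H) (x J lambda : H) (z w : C)
  (Xs Ys Fs : nat -> C -> HC) (Gs : nat -> C -> H) (Lambda : seq H) (k : nat).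

Definition qaxh D G := forall l, (l < 4)%N -> axh D (fun z => qco l (G z)).

Lemma qaxh_qdx D G : open D -> qaxh D G -> qaxh D (qdx G).
Proof.
move=> oD h l l4; rewrite (_ : (fun z => _) = dx (fun z => qco l (G z))).
  exact: (axh_dx oD (h l l4)).
by apply/funext => z; rewrite qco_qdx.
Qed.

Lemma qaxh_a D G z : qaxh D G -> D z -> is_derive z.1 1 (fun t => G (t, z.2)) (qdx G z).
Proof. by move=> h Dz; apply: qdx_is => l l4; exact: (ah_a (h l l4) Dz). Qed.

Lemma qaxh_b D G z : qaxh D G -> D z -> is_derive z.2 1 (fun t => G (z.1, t)) (qdy G z).
Proof. by move=> h Dz; apply: qdy_is => l l4; exact: (ah_b (h l l4) Dz). Qed.

Lemma qaxh_ba D G z : open D -> qaxh D G -> D z ->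
  is_derive z.1 1 (fun t => qdy G (t, z.2)) (qdy (qdx G) z).
Proof.
move=> oD h Dz; apply/is_derive_qco => l l4.
rewrite (_ : (fun t => _) = fun t => dy (fun z => qco l (G z)) (t, z.2)); last first.
  by apply/funext => t; rewrite qco_qdy.
rewrite qco_qdy // (_ : (fun w => qco l (qdx G w)) = dx (fun z => qco l (G z))).
  exact: (axh_dxy oD (h l l4) Dz).
by apply/funext => w; rewrite qco_qdx.
Qed.

Lemma qaxh_bb D G z : qaxh D G -> D z ->
  is_derive z.2 1 (fun t => qdy G (z.1, t)) (qdy (qdy G) z).
Proof.
move=> h Dz; apply: qdy_is => l l4.
rewrite (_ : (fun w => qco l (qdy G w)) = dy (fun z => qco l (G z))).
  exact: (ah_bb (h l l4) Dz).
by apply/funext => w; rewrite qco_qdy.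
Qed.

Lemma qaxh_eq D G z : qaxh D G -> D z ->
  z.2 *: (qdx (qdx G) z + qdy (qdy G) z) + 2 *: qdy G z = 0.
Proof.
move=> h Dz; apply/rowP => l; rewrite -(inord_val l) -[LHS]/(qco l _) -[RHS]/(qco l _).
pose u w := qco l (G w).
have u1 : (fun w => qco l (qdx G w)) = dx u by apply/funext => w; exact: qco_qdx.
have u2 : (fun w => qco l (qdy G w)) = dy u by apply/funext => w; exact: qco_qdy.
have e1 : qco l (qdx (qdx G) z) = dx (dx u) z by rewrite -u1; exact: qco_qdx.
have e2 : qco l (qdy (qdy G) z) = dy (dy u) z by rewrite -u2; exact: qco_qdy.
have e3 : qco l (qdy G z) = dy u z by exact: qco_qdy.
have main (q1 q2 q3 : H) (r1 r2 r3 : R) : qco l q1 = r1 -> qco l q2 = r2 -> qco l q3 = r3 ->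
    z.2 * (r1 + r2) + 2 * r3 = 0 -> qco l (z.2 *: (q1 + q2) + 2 *: q3) = qco l 0.
  by move=> <- <- <- e; rewrite [RHS]qco0 -[RHS]e qcoD !qcoZ qcoD.
exact: (main _ _ _ _ _ _ e1 e2 e3 (ah_eq (h l (ltn_ord l)) Dz)).
Qed.

Record holjet D Fs : Prop := HolJet
  { hj_stem : forall k, stem D (Fs k);
    hj_cont : forall k z, D z -> {for z, continuous (Fs k)};
    hj_a : forall k z, D z -> is_derive z ((1, 0) : C) (Fs k) (Fs k.+1 z);
    hj_b : forall k z, D z -> is_derive z ((0, 1) : C) (Fs k) (qCmul (iota_ R) (Fs k.+1 z)) }.

Lemma iota_mul (u : HC) : qCmul (iota_ R) u = (- u.2, u.1).
Proof. by rewrite /qCmul /iota_ /= !mul0r !mul1r sub0r add0r. Qed.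

Lemma holjet_partials D Fs k : holjet D Fs ->
  has_partials D (Fs k) (Fs k.+1) (fun z => (- (Fs k.+1 z).2, (Fs k.+1 z).1)).
Proof.
move=> h z Dz; have d1 := hj_a h k Dz; have d2 := hj_b h k Dz; rewrite iota_mul in d2.
have [e1 e2] := proj1 (is_derive_pair _ _ _ _) (proj1 (is_derive_ea _ _ _) d1).
have [e3 e4] := proj1 (is_derive_pair _ _ _ _) (proj1 (is_derive_eb _ _ _) d2).
by split; [exact: e1|exact: e2|exact: e3|exact: e4].
Qed.

Definition fueter_stem G z : HC := ((-2) *: qdx G z, 2 *: qdy G z).

Lemma fueter_stem_amH D G : open D -> qaxh D G -> amH D (fueter_stem G).
Proof.
move=> oD h l l4; apply: (amsys_ext oD (axh_amsys oD (h l l4))) => z _.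
  by rewrite /c1 /= qcoZ qco_qdx.
by rewrite /c2 /= qcoZ qco_qdy.
Qed.

Section Jet.
Variables (D : set C) (Fs : nat -> C -> HC) (G : C -> H).
Hypotheses (oD : open D) (cD : conj_invariant D) (hF : holjet D Fs) (hG : qaxh D G)
  (FG : forall z, D z -> (Fs 0%N z).2 = z.2 *: G z).

Let Gs k := iter k (@qdx R) G.

Let hGs k : qaxh D (Gs k).
Proof. by elim: k => [|k IH]; [exact: hG|exact: (qaxh_qdx oD IH)]. Qed.

Let FGs k z : D z -> (Fs k z).2 = z.2 *: Gs k z.
Proof.
elim: k z => [|k IH] z Dz; first exact: FG.
have [_ h _ _] := holjet_partials k hF Dz.
have [r r0 [h1 _]] := open_lines oD Dz.
have d := qdZ (derC z.1 z.2) (qaxh_a (hGs k) Dz); rewrite scale0r addr0 in d.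
apply: (is_derive_uniqV h); apply: (qd_near r0 _ d) => s /h1 Ds.
by rewrite (IH _ Ds).
Qed.

Let data k : fueter_data D (Fs k) (Gs k) (Gs k.+1) (qdy (Gs k)) (Gs k.+2)
  (qdy (Gs k.+1)) (qdy (qdy (Gs k))).
Proof.
have hk := hGs k.
split=> [|z Dz|z Dz|z Dz|z Dz|z Dz|z Dz|z Dz|z Dz|z Dz|z Dz].
- exact: (hj_stem hF).
- exact: FGs.
- have [e1 _ _ e4] := holjet_partials k hF Dz; apply: (is_derive_eq e1).
  have [r r0 [_ h1]] := open_lines oD Dz.
  have d := qdZ (derI z.2) (qaxh_b hk Dz); rewrite scale1r addrC -surjective_pairing in d.
  apply: (is_derive_uniqV e4); apply: (qd_near r0 _ d) => s /h1 Ds.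
  by rewrite (FGs k Ds).
- have [_ _ e3 _] := holjet_partials k hF Dz; apply: (is_derive_eq e3).
  by rewrite /= (FGs k.+1 Dz) scaleNr.
- exact: (qaxh_a hk Dz).
- exact: (qaxh_b hk Dz).
- exact: (qaxh_a (hGs k.+1) Dz).
- exact: (qaxh_b (hGs k.+1) Dz).
- exact: (qaxh_ba oD hk Dz).
- exact: (qaxh_bb hk Dz).
- exact: (qaxh_eq hk Dz).
Qed.

Let Xs k := fueter_stem (Gs k).

Let Gs_even k z : D z -> Gs k (cconj z) = 1 *: Gs k z.
Proof.
move=> Dz; rewrite scale1r; have [z0|z0] := eqVneq z.2 0.
  by rewrite /cconj z0 oppr0 -z0 -surjective_pairing.
apply: (@scalerI _ _ (- z.2)); first by rewrite oppr_eq0.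
have := stem2 (hj_stem hF k) Dz; rewrite (FGs k Dz) (FGs k (cD Dz)) /= => ->.
by rewrite scaleN1r scaleNr.
Qed.

Let Xs_stem k : stem D (Xs k).
Proof.
move=> z Dz; have Dw := cD Dz.
have e1 := is_derive_uniqV (qaxh_a (hGs k) Dw)
  (parity_x oD cD Dz (fun w Dw => Gs_even k Dw) (qaxh_a (hGs k) Dz)).
have e2 := is_derive_uniqV (qaxh_b (hGs k) Dw)
  (parity_y oD cD Dz (fun w Dw => Gs_even k Dw) (qaxh_b (hGs k) Dz)).
by rewrite /Xs /fueter_stem e1 e2 /qCconj /= scale1r scaleN1r scalerN.
Qed.

Lemma fueter_jet : amjet D Xs.
Proof.
split=> k; [exact: Xs_stem|exact: (fueter_stem_amH oD (hGs k))|].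
move=> z Dz; apply/is_derive_ea/is_derive_pair; split.
  have := qdZ (derC z.1 (-2)) (qaxh_a (hGs k.+1) Dz).
  by rewrite scale0r addr0; exact.
have := qdZ (derC z.1 2) (qaxh_ba oD (hGs k) Dz).
by rewrite scale0r addr0; exact.
Qed.

(** For $b<0$ the point $a+bJ$ is $a+(-b)(-J)$, and the parity of the image stem [Xs 0] makes both
    readings agree. *)
Lemma fueter_induces f : induces D (Fs 0%N) f -> induces D (Xs 0%N) (laplacian f).
Proof.
move=> hf [a b] J Dz hJ.
change (laplacian f (a%:A + b *: J) = (Xs 0%N (a, b)).1 + J * (Xs 0%N (a, b)).2).
have pos b' J' : D (a, b') -> 0 <= b' -> imag_unit J' ->
    laplacian f (a%:A + b' *: J') = (Xs 0%N (a, b')).1 + J' * (Xs 0%N (a, b')).2.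
  by move=> Dz' b0 hJ'; rewrite (fueter_laplacian oD (data 0%N) hf Dz' b0 hJ').
have [b0|b0] := leP 0 b; first exact: pos.
have := pos (- b) (- J) (cD Dz) _ (imag_unitN hJ); rewrite oppr_ge0 => /(_ (ltW b0)).
rewrite scaleNr scalerN opprK => ->; have := Xs_stem 0%N Dz.
by move: (Xs 0%N) => X; rewrite /cconj /= => ->; rewrite /= mulrNN.
Qed.

Definition dlamH lambda (Ys : nat -> C -> H) k z : H := Ys k.+1 z - Ys k z * lambda.

(** The operators act alike on [Fs], on the quotients [Gs] and on the images. From $bY=0$ one gets
    $Y=0$ off the axis; on the axis $Y$ is the derivative of $bY$ in $b$, so it vanishes as well. *)
Lemma fueter_fold Lambda :
  (forall k z, D z -> foldr (@dlam R) Fs Lambda k z = 0) ->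
  forall k z, D z -> foldr (@dlam R) Xs Lambda k z = 0.
Proof.
pose Ys := foldr dlamH Gs Lambda.
have main k z : D z -> [/\ (foldr (@dlam R) Fs Lambda k z).2 = z.2 *: Ys k z,
    foldr (@dlam R) Xs Lambda k z = ((-2) *: Ys k.+1 z, 2 *: qdy (Ys k) z) &
    is_derive z.2 1 (fun t => Ys k (z.1, t)) (qdy (Ys k) z)].
  rewrite /Ys; elim: Lambda k z {Ys} => [|lambda s IH] k z Dz /=.
    by split=> //; [exact: FGs|exact: (qaxh_b (hGs k) Dz)].
  have [a1 a2 a3] := IH k.+1 z Dz; have [b1 b2 b3] := IH k z Dz.
  have d := qdD a3 (qdN (qdMr lambda b3)).
  have e : qdy (dlamH lambda (foldr dlamH Gs s) k) z =
      qdy (foldr dlamH Gs s k.+1) z - qdy (foldr dlamH Gs s k) z * lambda.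
    exact: (qdy_eq d).
  rewrite e; split=> //.
    by rewrite /dlam /rmulC /= a1 b1 -scalerAl -scalerBr.
  rewrite /dlam /rmulC a2 b2 /=; congr pair; rewrite /dlamH scalerBr scalerAl //.
move=> h0; have Y0 k z : D z -> Ys k z = 0.
  move=> Dz; have [/eqP] := main k z Dz; rewrite h0 //= eq_sym scaler_eq0.
  move=> /orP[/eqP z0|/eqP //] _ d.
  have [r r0 [_ h1]] := open_lines oD Dz.
  have d2 := qdZ (derI z.2) d; rewrite z0 scale0r add0r scale1r -z0 -surjective_pairing in d2.
  apply: (is_derive_uniqV d2); apply: (qd_near r0 _ (qdC z.2 0)) => s /h1 Ds.
  by have [<- _ _] := main k _ Ds; rewrite h0.
move=> k z Dz; have [_ -> d] := main k z Dz; rewrite Y0 // scaler0.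
have -> : qdy (Ys k) z = 0; last by rewrite scaler0.
have [r r0 [_ h1]] := open_lines oD Dz.
apply: (is_derive_uniqV d); apply: (qd_near r0 _ (qdC z.2 0)) => s /h1 Ds.
by rewrite Y0.
Qed.

End Jet.

End Fueter.

(** * The generalized exponentials *)

Section ZPowers.
Variable R : realType.
Local Notation C := (R * R)%type.
Implicit Types (P T : jet R) (z : C) (n N : nat) (a b : nat -> R) (w v : nat -> C -> R).

Record isjet P : Prop := IsJet
  { ij_a : forall z, xder (j0 P) z (ja P z);
    ij_b : forall z, yder (j0 P) z (jb P z);
    ij_aa : forall z, xder (ja P) z (jaa P z);
    ij_bb : forall z, yder (jb P) z (jbb P z);
    ij_c0 : forall z, {for z, continuous (j0 P)};
    ij_ca : forall z, {for z, continuous (ja P)};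
    ij_cb : forall z, {for z, continuous (jb P)};
    ij_caa : forall z, {for z, continuous (jaa P)};
    ij_cbb : forall z, {for z, continuous (jbb P)} }.

(** The real polynomials [p], [s] with [(a + i b) ^ n = p (a, b) + i b s (a, b)]. *)
Fixpoint zjet n : jet R * jet R := if n is n'.+1 then
    let: (P, T) := zjet n' in
    (Jet (fun z => z.1 * j0 P z - z.2 ^+ 2 * j0 T z)
         (fun z => j0 P z + z.1 * ja P z - z.2 ^+ 2 * ja T z)
         (fun z => z.1 * jb P z - 2 * z.2 * j0 T z - z.2 ^+ 2 * jb T z)
         (fun z => 2 * ja P z + z.1 * jaa P z - z.2 ^+ 2 * jaa T z)
         (fun z => z.1 * jbb P z - 2 * j0 T z - 4 * z.2 * jb T z - z.2 ^+ 2 * jbb T z),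
     Jet (fun z => z.1 * j0 T z + j0 P z)
         (fun z => j0 T z + z.1 * ja T z + ja P z)
         (fun z => z.1 * jb T z + jb P z)
         (fun z => 2 * ja T z + z.1 * jaa T z + jaa P z)
         (fun z => z.1 * jbb T z + jbb P z))
  else (Jet (fun=> 1) (fun=> 0) (fun=> 0) (fun=> 0) (fun=> 0),
        Jet (fun=> 0) (fun=> 0) (fun=> 0) (fun=> 0) (fun=> 0)).

Definition zre n : C -> R := j0 (zjet n).1.
(** The imaginary part of $z^n$ divided by [b], again a polynomial: it yields the quotient [G] of
    the exponentials without any division. *)
Definition zim1 n : C -> R := j0 (zjet n).2.
Definition zim n z : R := z.2 * zim1 n z.

Lemma isjet_zjet n : isjet (zjet n).1 /\ isjet (zjet n).2.
Proof.
elim: n => [|n IH] /=.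
  by split; split=> z /=; try exact: cst_continuous; exact: derC.
case: (zjet n) IH => P T /= [hP hT].
have c1 z : {for z, continuous (fun z : C => z.1)} by exact: cvg_fst.
have c2 z : {for z, continuous (fun z : C => z.2)} by exact: cvg_snd.
split; split=> z; have P1 := ij_a hP z; have P2 := ij_b hP z; have P3 := ij_aa hP z;
  have P4 := ij_bb hP z; have P5 := @ij_c0 _ hP z; have P6 := @ij_ca _ hP z; have P7 := @ij_cb _ hP z;
  have P8 := @ij_caa _ hP z; have P9 := @ij_cbb _ hP z;
  have T1 := ij_a hT z; have T2 := ij_b hT z; have T3 := ij_aa hT z;
  have T4 := ij_bb hT z; have T5 := @ij_c0 _ hT z; have T6 := @ij_ca _ hT z; have T7 := @ij_cb _ hT z;
  have T8 := @ij_caa _ hT z; have T9 := @ij_cbb _ hT z;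
  have C1 := c1 z; have C2 := c2 z; rewrite /xder /yder /= in P1 P2 P3 P4 T1 T2 T3 T4;
  rewrite /xder /yder /=; try solve [cnt | der; rewrite /= -?surjective_pairing; ring].
Qed.

(** Cauchy-Riemann for $p+ibs$, harmonicity of $p$ and the axial equation of $s$. They are proved
    together since one step of the recursion mixes [p] and [s]. *)
Lemma zjet_eqs n z : let: (P, T) := zjet n in
  [/\ ja P z = j0 T z + z.2 * jb T z, jb P z = - z.2 * ja T z,
      jaa P z + jbb P z = 0 & z.2 * (jaa T z + jbb T z) + 2 * jb T z = 0].
Proof.
elim: n => [|n] /=; first by split; ring.
case: (zjet n) => P T /= [e1 e2 e3 e4].
have e5 : jbb P z = - jaa P z by rewrite -[LHS]subr0 -e3; ring.
have e6 : jb T z *+ 2 = - (z.2 * (jaa T z + jbb T z)).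
  by rewrite -[RHS]addr0 -e4; ring.
split; rewrite ?e1 ?e2 ?e5 //.
- by ring.
- by ring.
- by rewrite -[RHS](mulr0 (- z.2)) -e4; ring.
- by rewrite -[RHS](mulr0 z.1) -e4; ring.
Qed.

Lemma zjet_der n z : let: (P, T) := zjet n.+1 in
  ja P z = n.+1%:R * zre n z /\ ja T z = n.+1%:R * zim1 n z.
Proof.
rewrite /zre /zim1; elim: n => [|n] /=; first by split; ring.
case: (zjet n) => P T /= [-> ->]; rewrite -(natr1 n.+1).
by split; ring.
Qed.

Lemma zim1_axharm Q n : axharm Q (zjet n).2.
Proof.
have [_ [*]] := isjet_zjet n; split=> // z _.
by have := zjet_eqs n z; case: (zjet n) => P T [].
Qed.

End ZPowers.

(** * Exponential-type power series with real coefficients *)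

Section RealSeries.
Variable R : realType.
Local Notation C := (R * R)%type.
Implicit Types (z t : C) (n N : nat) (a b : nat -> R) (w v : nat -> C -> R) (K : R).

(** The summand 1 leaves room for [zim1], whose size is of the order of $nr^{n-1}$ and not of
    $r^n$. *)
Definition tame w := forall n z, `|w n z| <= (`|z.1| + `|z.2| + 1) ^+ n.

Lemma zreS n z : zre n.+1 z = z.1 * zre n z - z.2 * zim n z.
Proof. by rewrite /zim /zre /zim1 /=; case: (zjet R n) => P T /=; ring. Qed.

Lemma zim1S n z : zim1 n.+1 z = z.1 * zim1 n z + zre n z.
Proof. by rewrite /zre /zim1 /=; case: (zjet R n) => P T /=. Qed.

Lemma zimS n z : zim n.+1 z = z.1 * zim n z + z.2 * zre n z.
Proof. by rewrite /zim zim1S; ring. Qed.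

Lemma zpow_tame n z : `|zre n z| + `|zim n z| <= (`|z.1| + `|z.2|) ^+ n.
Proof.
elim: n => [|n IH]; first by rewrite /zim /zre /zim1 /= mulr0 normr0 normr1 addr0.
rewrite zreS zimS exprS.
have h1 : `|z.1 * zre n z - z.2 * zim n z| <= `|z.1| * `|zre n z| + `|z.2| * `|zim n z|.
  by rewrite (le_trans (ler_normB _ _)) // !normrM.
have h2 : `|z.1 * zim n z + z.2 * zre n z| <= `|z.1| * `|zim n z| + `|z.2| * `|zre n z|.
  by rewrite (le_trans (ler_normD _ _)) // !normrM.
apply: le_trans (lerD h1 h2) _; apply: le_trans (ler_wpM2l _ IH); first by lra.
by rewrite addr_ge0.
Qed.

Lemma zre_tame : tame (@zre R).
Proof.
move=> n z; have h := zpow_tame n z.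
apply: (@le_trans _ _ ((`|z.1| + `|z.2|) ^+ n)); first by have := normr_ge0 (zim n z); lra.
by rewrite lerXn2r ?nnegrE ?addr_ge0 // lerDl.
Qed.

Lemma zim_tame : tame (@zim R).
Proof.
move=> n z; have h := zpow_tame n z.
apply: (@le_trans _ _ ((`|z.1| + `|z.2|) ^+ n)); first by have := normr_ge0 (zre n z); lra.
by rewrite lerXn2r ?nnegrE ?addr_ge0 // lerDl.
Qed.

Lemma zim1_tame : tame (@zim1 R).
Proof.
elim=> [|n IH] z; first by rewrite /zim1 /= normr0.
rewrite zim1S exprS (le_trans (ler_normD _ _)) // normrM.
have h1 := IH z; have h2 := zre_tame n z.
have h3 := ler_wpM2l (normr_ge0 z.1) h1.
have h4 : 0 <= `|z.2| * (`|z.1| + `|z.2| + 1) ^+ n by rewrite mulr_ge0 // exprn_ge0 // !addr_ge0.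
by move: h2 h3 h4; set M := _ ^+ n => *; rewrite !mulrDl mul1r; lra.
Qed.

Definition term a w n z := a n / n`!%:R * w n z.

Definition ser a w z : R := limn (fun N => \sum_(0 <= n < N) term a w n z).

(** Up to squaring [K], this growth is stable under a shift of the sequence, which is what
    differentiation does to the coefficients. *)
Definition geom K a := forall n, `|a n| <= K * K ^+ n.

Lemma geom_shift K a : 1 <= K -> geom K a -> geom (K ^+ 2) a /\ geom (K ^+ 2) (fun n => a n.+1).
Proof.
move=> K1 ha; have K0 : 0 <= K by lra.
have h n : K * K ^+ n.+1 <= K ^+ 2 * (K ^+ 2) ^+ n.
  rewrite -!exprS -exprM; apply: ler_weXn2l => //; rewrite mul2n doubleS !ltnS -addnn leq_addr //.
split=> n; last exact: le_trans (ha _) (h _).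
apply: le_trans (ha n) _; apply: le_trans (h n); rewrite ler_wpM2l //.
by apply: ler_weXn2l.
Qed.

(** Comparison with the exponential series of [K * M]. One error sequence serves all coefficients
    and all tame functions, hence a series and its derived series at once, as [limit_derive]
    requires. *)
Lemma ser_tail K z : 0 < K -> exists e, [/\ forall n, 0 < e n, vanishing e,
  (forall n, e n.+1 <= e n) & forall a w N t, geom K a -> tame w -> box z 1 t ->
    `|\sum_(0 <= n < N) term a w n t - ser a w t| <= e N].
Proof.
(* On the unit box around [z] one has $|t_1|+|t_2|+1\le M$, the base of the growth allowed by
   [tame]. *)
move=> K0; pose M := `|z.1| + `|z.2| + 3; pose x := K * M.
have M0 : 0 < M by rewrite /M; have := normr_ge0 z.1; have := normr_ge0 z.2; lra.
have x0 : 0 < x by rewrite mulr_gt0.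
pose s N : R := \sum_(0 <= n < N) x ^+ n / n`!%:R.
have sE : s = series (exp_coeff x) by [].
have inc n : s n < s n.+1.
  by rewrite /s big_nat_recr //= ltrDl mulr_gt0 ?exprn_gt0 // invr_gt0 ltr0n fact_gt0.
have sc : s @ \oo --> expR x by rewrite sE; exact: is_cvg_series_exp_coeff.
have incW n m : (n <= m)%N -> s n <= s m.
  move=> /subnK <-; elim: (m - n)%N => // k IH; apply: le_trans IH _.
  by rewrite addSn ltW.
have lt n : s n < expR x.
  apply: lt_le_trans (inc n) _; rewrite -(cvg_lim (@Rhausdorff R) sc).
  apply: limr_ge; first by apply/cvg_ex; exists (expR x).
  by exists n.+1 => // m /=; exact: incW.
pose e N := K * (expR x - s N).
have eW n m : (n <= m)%N -> e m <= e n.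
  by move=> nm; rewrite ler_pM2l // lerD2l lerN2 incW.
have ve : vanishing e.
  apply: vanishingZ => // d d0; move/cvgrPdist_lt: sc => /(_ d d0)[n _ hn].
  by exists n; apply: le_lt_trans (hn n (leqnn n)); exact: ler_norm.
exists e; split=> //.
- by move=> n; rewrite mulr_gt0 // subr_gt0.
- by move=> n; exact: eW.
move=> a w N t ha hw [t1 t2].
have tM : `|t.1| + `|t.2| + 1 <= M.
  have h1 := ler_normD (t.1 - z.1) z.1; have h2 := ler_normD (t.2 - z.2) z.2.
  by move: h1 h2 t1 t2; rewrite !subrK /M; lra.
have ht n : `|term a w n t| <= K * (x ^+ n / n`!%:R).
  have f0 : 0 < n`!%:R^-1 :> R by rewrite invr_gt0 ltr0n fact_gt0.
  rewrite /term !normrM (ger0_norm (ltW f0)).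
  have h : `|w n t| <= M ^+ n.
    apply: le_trans (hw n t) _; rewrite lerXn2r ?nnegrE ?(ltW M0) // !addr_ge0 //.
  have := ler_pM (normr_ge0 _) (normr_ge0 _) (ha n) h.
  rewrite /x exprMn => hh; rewrite mulrAC [leRHS]mulrA ler_pM2r // (le_trans hh) //.
  by rewrite mulrA.
pose S N := \sum_(0 <= n < N) term a w n t.
have cauchy n m : (n <= m)%N -> `|S m - S n| <= K * (s m - s n).
  move=> /subnK <-; elim: (m - n)%N => [|k IH]; first by rewrite add0n !subrr normr0 mulr0.
  rewrite addSn /S /s !big_nat_recr //= -/(S _) -/(s _) -addrA [_ - S n]addrC addrA.
  rewrite (addrAC (s _)) mulrDr.
  by apply: le_trans (ler_normD _ _) _; rewrite lerD.
have c2 n m : `|S n - S m| <= e n + e m.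
  have eg k : 0 <= e k by rewrite mulr_ge0 ?(ltW K0) // subr_ge0 ltW.
  have [nm|/ltnW nm] := leqP n m.
    rewrite distrC (le_trans (cauchy _ _ nm)) //; apply: (@le_trans _ _ (e n)); last by rewrite lerDl.
    by rewrite ler_pM2l // lerD2r ltW.
  rewrite (le_trans (cauchy _ _ nm)) //; apply: (@le_trans _ _ (e m)); last by rewrite lerDr.
  by rewrite ler_pM2l // lerD2r ltW.
have [l hl] := sup_limit c2.
suff -> : ser a w t = l by exact: hl.
apply: cvg_lim; first exact: Rhausdorff.
apply/cvgrPdist_le => d /ve[n hn]; exists n => // m /= nm.
by rewrite distrC (le_trans (hl m)) // (le_trans (eW _ _ nm)) // ltW.
Qed.

Lemma box_self z : box z 1 z.
Proof. by split; rewrite subrr normr0. Qed.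

Lemma ser_cvg K a w z : 0 < K -> geom K a -> tame w ->
  (fun N => \sum_(0 <= n < N) term a w n z) @ \oo --> ser a w z.
Proof.
move=> K0 ha hw; have [e [e0 ve einc he]] := ser_tail z K0.
have eW n m : (n <= m)%N -> e m <= e n.
  by move=> /subnK <-; elim: (m - n)%N => // k IH; rewrite addSn (le_trans (einc _)).
apply/cvgrPdist_le => d /ve[n hn]; exists n => // m /= nm.
rewrite distrC (le_trans (he a w m z ha hw (box_self z))) //.
by rewrite (le_trans (eW _ _ nm)) // ltW.
Qed.

Lemma ser_scale K a w v z t (k : R) : 0 < K -> geom K a -> tame w -> tame v ->
  (forall n, w n z = k * v n t) -> ser a w z = k * ser a v t.
Proof.
move=> K0 ha hw hv e; apply: (cvg_unique (@Rhausdorff R) (ser_cvg K0 ha hw)).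
rewrite (_ : (fun N => _) = fun N => k * \sum_(0 <= n < N) term a v n t).
  exact: (cvgM (cvg_cst k) (ser_cvg (z := t) K0 ha hv)).
apply/funext => N; rewrite mulr_sumr; apply: eq_bigr => n _.
by rewrite /term e mulrCA.
Qed.

Lemma ser_der K a w v (L : R -> C) (x : R) : 1 <= K -> geom K a -> tame w -> tame v ->
  (forall s, `|s - x| < 1 -> box (L x) 1 (L s)) ->
  (forall s : R, is_derive s 1 (fun s => w 0%N (L s)) 0) ->
  (forall n (s : R), is_derive s 1 (fun s => w n.+1 (L s)) (n.+1%:R * v n (L s))) ->
  is_derive x 1 (fun s => ser a w (L s)) (ser (fun n => a n.+1) v (L x)).
Proof.
move=> K1 ha hw hv hL d0 dS; have [ha1 ha2] := geom_shift K1 ha.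
have K2 : 0 < K ^+ 2 by rewrite exprn_gt0 //; lra.
have [e [e0 ve einc he]] := ser_tail (L x) K2.
(* The partial sums of the series have one more term than those of the derivative, so that
   differentiation termwise is exact; [einc] absorbs the shift. *)
apply: (@limit_derive _ (fun N s => \sum_(0 <= n < N.+1) term a w n (L s))
  (fun N s => \sum_(0 <= n < N) term (fun n => a n.+1) v n (L s))
  _ (fun s => ser (fun n => a n.+1) v (L s)) x 1 e) => //.
- move=> N s _; elim: N => [|N IH].
    rewrite big_geq // (_ : (fun s => _) = fun s => a 0%N / 0`!%:R * w 0%N (L s)).
      by have h := d0 s; der; ring.
    by apply/funext => y; rewrite big_nat1.
  rewrite (_ : (fun s => _) = fun s => \sum_(0 <= n < N.+1) term a w n (L s) +
      a N.+1 / N.+1`!%:R * w N.+1 (L s)); last first.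
    by apply/funext => y; rewrite big_nat_recr.
  rewrite [in X in is_derive _ _ _ X]big_nat_recr //=.
  have h := dS N s; der; rewrite /term factS natrM; congr (_ + _).
  have f0 : N`!%:R != 0 :> R by rewrite pnatr_eq0 -lt0n fact_gt0.
  have N0 : N.+1%:R != 0 :> R by rewrite pnatr_eq0.
  by move: f0 N0; move: N`!%:R N.+1%:R => f M f0 N0; field; rewrite f0 N0.
- by move=> N s sx; apply: le_trans (einc N); apply: he => //; exact: hL.
- by move=> N s sx; apply: he => //; exact: hL.
Qed.

Lemma ser_cont K a w z : 0 < K -> geom K a -> tame w ->
  (forall n t, {for t, continuous (w n)}) -> {for z, continuous (ser a w)}.
Proof.
move=> K0 ha hw cw; have [e [e0 ve einc he]] := ser_tail z K0.
apply: (@limit_continuous _ _ (fun N t => \sum_(0 <= n < N) term a w n t) _ z (box z 1) e) => //.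
- by apply: open_nbhs_nbhs; split; [exact: open_box|exact: box_self].
- elim=> [|N IH].
    rewrite (_ : (fun t => _) = fun=> 0); first exact: cst_continuous.
    by apply/funext => t; rewrite big_geq.
  rewrite (_ : (fun t => _) = fun t => \sum_(0 <= n < N) term a w n t + a N / N`!%:R * w N t).
    by have h := cw N z; cnt.
  by apply/funext => t; rewrite big_nat_recr.
- by move=> N t bt; exact: he.
Qed.

Lemma ser_axh K a Q : open Q -> 0 < K -> geom K a -> axh Q (ser a (@zim1 R)).
Proof.
move=> oQ K0 ha.
pose U N : jet R := iteri N (fun n V => jlin 1 (a n / n`!%:R) V (zjet R n).2) (zjet R 0).2.
have j0U N z : j0 (U N) z = \sum_(0 <= n < N) term a (@zim1 R) n z.
  elim: N => [|N IH]; first by rewrite big_geq.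
  by rewrite big_nat_recr //= -IH mul1r.
apply: (@axh_limit _ Q U) => // [N|z Qz].
  by elim: N => [|N IH] /=; [exact: (zim1_axharm Q 0)|apply: axharm_lin => //; exact: zim1_axharm].
have [e [e0 ve einc he]] := ser_tail z K0; exists 1, e; split=> // N w bw.
by rewrite j0U; apply: he => //; exact: zim1_tame.
Qed.

End RealSeries.

(** * Complete sums of noncommuting quaternions *)

Section CompleteSums.
Variable R : realType.
Local Notation H := (quat R).
Implicit Types (mu : seq H) (lambda x y : H) (d n : nat).

Fixpoint csum mu d : H := if mu is x :: s then \sum_(k < d.+1) x ^+ k * csum s (d - k)
  else (d == 0%N)%:R.

Definition geom_poly (B : nat) x : {poly H} := \sum_(j < B) (x ^+ j)%:P * 'X^j.

Lemma coef_geom_poly B x k : (k < B)%N -> (geom_poly B x)`_k = x ^+ k.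
Proof.
move=> kB; rewrite coef_sum (bigD1 (Ordinal kB)) //= coefCM coefXn eqxx mulr1.
rewrite big1 ?addr0 // => j; rewrite -val_eqE /= => /negPf jk.
by rewrite coefCM coefXn eq_sym jk mulr0.
Qed.

Lemma coef_prod_geom B mu d : (d < B)%N -> (\prod_(x <- mu) geom_poly B x)`_d = csum mu d.
Proof.
elim: mu d => [|x s IH] d dB; first by rewrite big_nil coef1.
rewrite big_cons coefM /=; apply: eq_bigr => k _.
rewrite coef_geom_poly ?IH //; first by apply: leq_ltn_trans dB; exact: leq_subr.
by apply: leq_ltn_trans dB; rewrite -ltnS.
Qed.

(** Both sides are the coefficient of $X^d$ in the product of the geometric series of the entries.
    The indeterminate commutes with quaternions, so the order of the factors is respected, and
    truncation beyond degree [d] leaves this coefficient unchanged. *)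
Lemma cplt_sumE mu d : cplt_sum mu d = csum mu d.
Proof.
rewrite -(@coef_prod_geom d.+1) // (big_nth 0) big_mkord.
rewrite /geom_poly (bigA_distr_bigA (fun (i : 'I_(size mu)) (j : 'I_d.+1) => (mu`_i ^+ j)%:P * 'X^j)) coef_sum /cplt_sum.
rewrite big_mkcond; apply: eq_bigr => k _.
have -> : \prod_(i < size mu) ((mu`_i ^+ k i)%:P * 'X^(k i)) =
    (\prod_(i < size mu) mu`_i ^+ k i)%:P * 'X^(\sum_i k i).
  elim/big_ind3: _ => [|u1 u2 v1 v2 w1 w2 -> ->|//]; first by rewrite mulr1.
  rewrite exprD polyCM -!mulrA; congr (_ * _); rewrite !mulrA; congr (_ * _).
  exact: esym (commr_polyXn _ _).
by rewrite coefCM coefXn eq_sym; case: eqP; rewrite ?mulr1 ?mulr0.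
Qed.

Lemma csum0 mu : csum mu 0 = 1.
Proof. by elim: mu => //= x s IH; rewrite big_ord1 expr0 mul1r IH. Qed.

(** Either the exponent of the last entry is 0, or one factor [lambda] comes off on the right. For
    want of commutativity the induction consumes [mu] from the left and leaves the right end
    untouched. *)
Lemma csum_rcons mu lambda d :
  csum (rcons mu lambda) d.+1 = csum mu d.+1 + csum (rcons mu lambda) d * lambda.
Proof.
elim: mu d => [|x s IH] d.
  have e k : csum [:: lambda] k = lambda ^+ k.
    rewrite /= big_ord_recr /= subnn eqxx mulr1 big1 ?add0r // => j _.
    by rewrite subn_eq0 leqNgt ltn_ord mulr0.
  by rewrite [rcons _ _]/= !e add0r exprSr.
rewrite [rcons _ _]/= [LHS]/= big_ord_recr [csum (x :: s) _]/= [in RHS]big_ord_recr /= subnn !csum0.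
rewrite addrAC; congr (_ + _); rewrite mulr_suml -big_split /=; apply: eq_bigr => k _.
by rewrite subSn ?IH ?mulrDr ?mulrA // -ltnS.
Qed.

(** The coefficient of [x ^ n / n!] in [gen_exp mu]. *)
Definition ecoef mu n : H := if (n.+1 < size mu)%N then 0 else csum mu (n.+1 - size mu).

Lemma ecoef_nil n : ecoef [::] n = 0.
Proof. by []. Qed.

Lemma ecoef_rcons mu lambda n :
  ecoef (rcons mu lambda) n.+1 - ecoef (rcons mu lambda) n * lambda = ecoef mu n.
Proof.
rewrite /ecoef size_rcons !ltnS !subSS.
have [nm|mn|nm] := ltngtP n.+1 (size mu).
- by rewrite mul0r subr0.
- have mn' : (size mu <= n)%N by rewrite -ltnS.
  by rewrite subSn // csum_rcons addrK.
- by rewrite -nm subnn !csum0 mul0r subr0.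
Qed.

Lemma ecoef1 lambda n : ecoef [:: lambda] n = lambda ^+ n.
Proof.
elim: n => [|n IH]; first by rewrite /ecoef [size _]/= subnn csum0.
by apply/eqP; rewrite exprSr -IH -subr_eq0; apply/eqP; exact: (ecoef_rcons [::] lambda n).
Qed.

(** The sum norm is submultiplicative for the quaternion product; the inherited sup norm is not. *)
Definition qn x : R := `|qco 0 x| + `|qco 1 x| + `|qco 2 x| + `|qco 3 x|.

Lemma qn_ge0 x : 0 <= qn x.
Proof. by rewrite /qn !addr_ge0. Qed.

Lemma qco_qn l x : (l < 4)%N -> `|qco l x| <= qn x.
Proof.
have h0 := normr_ge0 (qco 0 x); have h1 := normr_ge0 (qco 1 x).
have h2 := normr_ge0 (qco 2 x); have h3 := normr_ge0 (qco 3 x).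
by rewrite /qn; case: l => [|[|[|[|//]]]] _; lra.
Qed.

Lemma qnD x y : qn (x + y) <= qn x + qn y.
Proof.
rewrite /qn !qcoD.
have h0 := ler_normD (qco 0 x) (qco 0 y); have h1 := ler_normD (qco 1 x) (qco 1 y).
have h2 := ler_normD (qco 2 x) (qco 2 y); have h3 := ler_normD (qco 3 x) (qco 3 y).
by lra.
Qed.

Lemma qnM x y : qn (x * y) <= qn x * qn y.
Proof.
have n4 (a b c e : R) : `|a + b + c + e| <= `|a| + `|b| + `|c| + `|e|.
  have h1 := ler_normD (a + b + c) e; have h2 := ler_normD (a + b) c.
  by have h3 := ler_normD a b; lra.
have [e0 e1 e2 e3] := qcoM x y.
have h0 := n4 (qco 0 x * qco 0 y) (- (qco 1 x * qco 1 y)) (- (qco 2 x * qco 2 y)) (- (qco 3 x * qco 3 y)).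
have h1 := n4 (qco 0 x * qco 1 y) (qco 1 x * qco 0 y) (qco 2 x * qco 3 y) (- (qco 3 x * qco 2 y)).
have h2 := n4 (qco 0 x * qco 2 y) (- (qco 1 x * qco 3 y)) (qco 2 x * qco 0 y) (qco 3 x * qco 1 y).
have h3 := n4 (qco 0 x * qco 3 y) (qco 1 x * qco 2 y) (- (qco 2 x * qco 1 y)) (qco 3 x * qco 0 y).
rewrite -e0 in h0; rewrite -e1 in h1; rewrite -e2 in h2; rewrite -e3 in h3.
apply: (le_trans (lerD (lerD (lerD h0 h1) h2) h3)); rewrite !normrN !normrM /qn.
by rewrite le_eqVlt; apply/orP; left; apply/eqP; ring.
Qed.

Lemma qn1 : qn 1 = 1.
Proof. by have [h0 h1 h2 h3] := qco1 R; rewrite /qn h0 h1 h2 h3 normr1 normr0 !addr0. Qed.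

Lemma qn0 : qn 0 = 0.
Proof. by rewrite /qn !qco0 normr0 !addr0. Qed.

Definition growth (c : nat -> H) := exists2 K, 1 <= K & forall n, qn (c n) <= K * K ^+ n.

Lemma growth_shift c : growth c -> growth (fun n => c n.+1).
Proof.
move=> [K K1 h]; exists (K ^+ 2); first exact: exprn_ege1.
move=> n; apply: le_trans (h _) _; rewrite -!exprS -exprM.
by apply: ler_weXn2l => //; rewrite mul2n doubleS !ltnS -addnn leq_addr.
Qed.

(** [ecoef_rcons] is a first order recurrence with a source of rate [K]; its solution grows at rate
    [K + qn lambda]. *)
Lemma growth_ecoef mu : growth (ecoef mu).
Proof.
elim/last_ind: mu => [|mu lambda [K K1 h]].
  by exists 1 => // n; rewrite ecoef_nil qn0 expr1n mulr1.
have n0 := qn_ge0 lambda.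
pose M := K + qn lambda; have M1 : 1 <= M by rewrite /M; lra.
exists M => //; elim=> [|n IH].
  rewrite expr0 mulr1; apply: le_trans M1; rewrite /ecoef size_rcons ltnS subSS sub0n csum0.
  by case: ifP => _; rewrite ?qn0 ?qn1.
have -> : ecoef (rcons mu lambda) n.+1 = ecoef mu n + ecoef (rcons mu lambda) n * lambda.
  by rewrite -(ecoef_rcons mu lambda n) subrK.
apply: le_trans (qnD _ _) _; rewrite exprS {2}/M mulrCA mulrDl.
have h1 : K * K ^+ n <= K * M ^+ n.
  by rewrite ler_wpM2l //; [lra|rewrite lerXn2r ?nnegrE //; rewrite ?/M; lra].
have Mn : 0 <= M ^+ n by rewrite exprn_ge0 //; lra.
have h2 : qn (ecoef (rcons mu lambda) n) * qn lambda <= M * M ^+ n * qn lambda by rewrite ler_wpM2r.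
have h3 : K * M ^+ n <= K * (M * M ^+ n) by rewrite ler_wpM2l //; [lra|rewrite ler_peMl].
by have := h n; have := qnM (ecoef (rcons mu lambda) n) lambda; lra.
Qed.

End CompleteSums.

(** * The generalized exponentials as holomorphic jets *)

Section QuaternionSeries.
Variable R : realType.
Local Notation H := (quat R).
Local Notation HC := (quatC R).
Local Notation C := (cplx R).
Implicit Types (z : C) (n N k : nat) (c : nat -> H) (w : nat -> C -> R) (lambda x y J : H) (mu : seq H).

Lemma cvg_qco (f : nat -> H) y :
  (forall l, (l < 4)%N -> (fun n => qco l (f n)) @ \oo --> qco l y) -> f @ \oo --> y.
Proof.
move=> h; apply/cvgrPdist_le => e e0; near=> s.
rewrite /Num.Def.normr/= mx_normrE (bigmax_le _ (ltW e0)) //= => -[i j] _.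
rewrite (ord1 i) -(inord_val j) !mxE /=.
have : forall l : 'I_4, `|qco l y - qco l (f s)| <= e.
  near: s; apply: filter_forall => l; have := h l (ltn_ord l).
  by move=> /cvgrPdist_le/(_ e e0).
by move=> /(_ j); rewrite /qco inord_val.
Unshelve. all: by end_near. Qed.

Lemma qco_sum l (I : Type) (r : seq I) (F : I -> H) :
  qco l (\sum_(i <- r) F i) = \sum_(i <- r) qco l (F i).
Proof.
elim: r => [|i r IH]; first by rewrite !big_nil qco0.
by rewrite !big_cons qcoD IH.
Qed.

Definition qser c w z : H := limn (fun N => \sum_(0 <= n < N) (w n z / n`!%:R) *: c n).

Lemma growth_geom c : growth c ->
  exists2 K, 1 <= K & forall l, (l < 4)%N -> geom K (fun n => qco l (c n)).
Proof.
move=> [K K1 h]; exists K => // l l4 n; apply: le_trans (h n); exact: qco_qn.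
Qed.

Definition qvec c w z : H := \row_(l < 4) ser (fun n => qco l (c n)) w z.

Lemma qvec_cvg c w z : growth c -> tame w ->
  (fun N => \sum_(0 <= n < N) (w n z / n`!%:R) *: c n) @ \oo --> qvec c w z.
Proof.
move=> /growth_geom[K K1 hK] hw; apply: cvg_qco => l l4.
rewrite (_ : qco l (qvec c w z) = ser (fun n => qco l (c n)) w z); last by rewrite /qco mxE inordK.
rewrite (_ : (fun N => _) = fun N => \sum_(0 <= n < N) term (fun n => qco l (c n)) w n z).
  exact: (ser_cvg (lt_le_trans ltr01 K1) (hK l l4) hw).
by apply/funext => N; rewrite qco_sum; apply: eq_bigr => n _; rewrite qcoZ /term; ring.
Qed.

Lemma qserE c w z : growth c -> tame w -> qser c w z = qvec c w z.
Proof. by move=> hc hw; apply: cvg_lim; [exact: norm_hausdorff|exact: qvec_cvg]. Qed.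

Lemma qser_cvg c w z : growth c -> tame w ->
  (fun N => \sum_(0 <= n < N) (w n z / n`!%:R) *: c n) @ \oo --> qser c w z.
Proof. by move=> hc hw; rewrite qserE //; exact: qvec_cvg. Qed.

Lemma qco_qser l c w z : growth c -> tame w -> (l < 4)%N ->
  qco l (qser c w z) = ser (fun n => qco l (c n)) w z.
Proof. by move=> hc hw l4; rewrite qserE // /qco mxE inordK. Qed.

Lemma qser_map (f : H -> H) c w z : growth c -> tame w ->
  (forall x y, f (x + y) = f x + f y) -> (forall (k : R) x, f (k *: x) = k *: f x) ->
  (forall x, {for x, continuous f}) ->
  (fun N => \sum_(0 <= n < N) (w n z / n`!%:R) *: f (c n)) @ \oo --> f (qser c w z).
Proof.
move=> hc hw fD fZ fc.
rewrite (_ : (fun N => _) = f \o fun N => \sum_(0 <= n < N) (w n z / n`!%:R) *: c n).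
  by apply: continuous_cvg; [exact: fc|exact: qser_cvg].
apply/funext => N; rewrite /=; elim: N => [|N IH].
  by rewrite !big_geq // -[X in f X](scale0r (0 : H)) fZ scale0r.
by rewrite !big_nat_recr //= fD fZ IH.
Qed.

Lemma continuous_mulr lambda x : {for x, continuous (fun y : H => y * lambda)}.
Proof. by apply: continuous_qM => //; exact: cst_continuous. Qed.

Lemma continuous_mull lambda x : {for x, continuous (fun y : H => lambda * y)}.
Proof. by apply: continuous_qM => //; exact: cst_continuous. Qed.

Lemma qser_mull c w z lambda : growth c -> tame w ->
  qser (fun n => lambda * c n) w z = lambda * qser c w z.
Proof.
move=> hc hw; apply: cvg_lim; first exact: norm_hausdorff.
exact: (@qser_map (fun y => lambda * y) c w z hc hw (fun x y => mulrDr lambda x y)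
  (fun (a : R) x => esym (scalerAr a lambda x)) (fun x => @continuous_mull lambda x)).
Qed.

Lemma qser_dlam c w z lambda : growth c -> tame w ->
  qser (fun n => c n.+1 - c n * lambda) w z = qser (fun n => c n.+1) w z - qser c w z * lambda.
Proof.
move=> hc hw; apply: cvg_lim; first exact: norm_hausdorff.
have h1 := qser_cvg (z := z) (growth_shift hc) hw.
have h2 : (fun N => \sum_(0 <= n < N) (w n z / n`!%:R) *: (c n * lambda)) @ \oo -->
    qser c w z * lambda.
  exact: (@qser_map (fun y => y * lambda) c w z hc hw (fun x y => mulrDl x y lambda)
    (fun (a : R) x => esym (scalerAl a x lambda)) (fun x => @continuous_mulr lambda x)).
rewrite (_ : (fun N => _) = (fun N => \sum_(0 <= n < N) (w n z / n`!%:R) *: c n.+1) -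
    (fun N => \sum_(0 <= n < N) (w n z / n`!%:R) *: (c n * lambda))); first exact: cvgB h1 h2.
apply/funext => N; rewrite /= [RHS]/GRing.add /= -sumrB; apply: eq_bigr => n _.
by rewrite scalerBr.
Qed.

Definition exp_stem c z : HC := (qser c (@zre R) z, qser c (@zim R) z).

Definition exp_jet c k : C -> HC := exp_stem (iter k (fun c n => c n.+1) c).

Lemma zre0 z : zre 0 z = 1. Proof. by []. Qed.
Lemma zim0 z : zim 0 z = 0. Proof. by rewrite /zim mulr0. Qed.

Lemma zre_dx n z : xder (zre n.+1) z (n.+1%:R * zre n z).
Proof.
have [h _] := isjet_zjet R n.+1; have := ij_a h z; have := zjet_der n z.
by rewrite /zre; case: (zjet R n.+1) => P T [-> _].
Qed.

Lemma zim_dx n z : xder (zim n.+1) z (n.+1%:R * zim n z).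
Proof.
have d : xder (zim1 n.+1) z (n.+1%:R * zim1 n z).
  have [_ h] := isjet_zjet R n.+1; have := ij_a h z; have := zjet_der n z.
  rewrite -[zim1 n.+1]/(j0 (zjet R n.+1).2).
  by case: (zjet R n.+1) => P T [_ ->].
rewrite /xder in d *; rewrite /zim.
have e := derM (derC z.1 z.2) d.
by apply: (is_derive_eq e); ring.
Qed.

Lemma zre_dy n z : yder (zre n.+1) z (n.+1%:R * - zim n z).
Proof.
have [h _] := isjet_zjet R n.+1; have := ij_b h z; have := zjet_der n z; have := zjet_eqs n.+1 z.
rewrite -[zre n.+1]/(j0 (zjet R n.+1).1) /zim.
case: (zjet R n.+1) => P T [_ e1 _ _] [_ e2] d.
by apply: (is_derive_eq d); rewrite e1 e2; ring.
Qed.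

Lemma zim_dy n z : yder (zim n.+1) z (n.+1%:R * zre n z).
Proof.
have [_ h] := isjet_zjet R n.+1; have := ij_b h z; have := zjet_der n z; have := zjet_eqs n.+1 z.
rewrite /yder /zim -[zim1 n.+1]/(j0 (zjet R n.+1).2).
case: (zjet R n.+1) => P T [e1 _ _ _] [e2 _] d.
have e := derM (derI z.2) d.
apply: (is_derive_eq e); rewrite -e2 e1 -surjective_pairing; ring.
Qed.

Lemma zre_cont n z : {for z, continuous (zre n : C -> R)}.
Proof. by have [h _] := isjet_zjet R n; exact: (@ij_c0 _ _ h z). Qed.

Lemma zim_cont n z : {for z, continuous (zim n : C -> R)}.
Proof.
have [_ h] := isjet_zjet R n; have h1 := @ij_c0 _ _ h z.
have h2 : {for z, continuous (fun z : C => z.2)} by exact: cvg_snd.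
by rewrite /zim /zim1; cnt.
Qed.

Lemma line_a_box z s : `|s - z.1| < 1 -> box (z.1, z.2) 1 (s, z.2).
Proof. by move=> h; split=> //=; rewrite subrr normr0. Qed.

Lemma line_b_box z s : `|s - z.2| < 1 -> box (z.1, z.2) 1 (z.1, s).
Proof. by move=> h; split=> //=; rewrite subrr normr0. Qed.

Lemma tameN w : tame w -> tame (fun n z => - w n z).
Proof. by move=> h n z; rewrite normrN. Qed.

Lemma qser_dx c w v z : growth c -> tame w -> tame v ->
  (forall z z', w 0%N z = w 0%N z') -> (forall n z, xder (w n.+1) z (n.+1%:R * v n z)) ->
  is_derive z.1 1 (fun t => qser c w (t, z.2)) (qser (fun n => c n.+1) v z).
Proof.
move=> hc hw hv w0 wd; apply/is_derive_qco => l l4.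
have [K K1 hK] := growth_geom hc.
rewrite (qco_qser _ (growth_shift hc) hv l4) [X in ser _ _ X]surjective_pairing.
rewrite (_ : (fun s => _) = fun s => ser (fun n => qco l (c n)) w (s, z.2)); last first.
  by apply/funext => s; rewrite qco_qser.
apply: (@ser_der _ K _ w v (fun s => (s, z.2))) => // [|s|s|n s]; first exact: hK.
- exact: line_a_box.
- rewrite (_ : (fun s => _) = fun=> w 0%N z); first exact: derC.
  by apply/funext => y; exact: w0.
- exact: (wd n (s, z.2)).
Qed.

Lemma qser_dy c w v z : growth c -> tame w -> tame v ->
  (forall z z', w 0%N z = w 0%N z') -> (forall n z, yder (w n.+1) z (n.+1%:R * v n z)) ->
  is_derive z.2 1 (fun t => qser c w (z.1, t)) (qser (fun n => c n.+1) v z).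
Proof.
move=> hc hw hv w0 wd; apply/is_derive_qco => l l4.
have [K K1 hK] := growth_geom hc.
rewrite (qco_qser _ (growth_shift hc) hv l4) [X in ser _ _ X]surjective_pairing.
rewrite (_ : (fun s => _) = fun s => ser (fun n => qco l (c n)) w (z.1, s)); last first.
  by apply/funext => s; rewrite qco_qser.
apply: (@ser_der _ K _ w v (fun s => (z.1, s))) => // [|s|s|n s]; first exact: hK.
- exact: line_b_box.
- rewrite (_ : (fun s => _) = fun=> w 0%N z); first exact: derC.
  by apply/funext => y; exact: w0.
- exact: (wd n (z.1, s)).
Qed.

Lemma qser_scale c w v z z' (k : R) : growth c -> tame w -> tame v ->
  (forall n, w n z = k * v n z') -> qser c w z = k *: qser c v z'.
Proof.
move=> hc hw hv e; have [K K1 hK] := growth_geom hc.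
have K0 : 0 < K by exact: lt_le_trans ltr01 K1.
have el l : (l < 4)%N -> qco l (qser c w z) = qco l (k *: qser c v z').
  move=> l4; rewrite qcoZ !qco_qser //.
  exact: (ser_scale K0 (hK l l4) hw hv e).
by apply: quat_eqP; exact: el.
Qed.

Lemma qser_cont c w z : growth c -> tame w -> (forall n t, {for t, continuous (w n : C -> R)}) ->
  {for z, continuous (qser c w)}.
Proof.
move=> hc hw cw; apply/continuous_qco => l l4; have [K K1 hK] := growth_geom hc.
rewrite (_ : (fun s => _) = ser (fun n => qco l (c n)) w).
  exact: (@ser_cont _ K _ w z (lt_le_trans ltr01 K1) (hK l l4) hw cw).
by apply/funext => s; rewrite qco_qser.
Qed.

Lemma zpow_cconj n z : zre n (cconj z) = zre n z /\ zim1 n (cconj z) = zim1 n z.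
Proof.
elim: n => // n [IH1 IH2]; rewrite !zreS !zim1S /zim IH1 IH2 /cconj /=.
by split=> //; ring.
Qed.

Lemma exp_jetS c k z : exp_jet c k.+1 z = exp_jet (fun n => c n.+1) k z.
Proof. by rewrite /exp_jet iterSr. Qed.

Lemma growth_iter c k : growth c -> growth (iter k (fun c n => c n.+1) c).
Proof. by move=> hc; elim: k => // k; exact: growth_shift. Qed.

Lemma exp_stem_stem c : growth c -> stem setT (exp_stem c).
Proof.
move=> hc z _; rewrite /exp_stem /qCconj /=; congr pair.
  rewrite -[RHS]scale1r; apply: qser_scale => //; [exact: zre_tame|exact: zre_tame|].
  by move=> n; have [-> _] := zpow_cconj n z; rewrite mul1r.
rewrite -scaleN1r; apply: qser_scale => //; [exact: zim_tame|exact: zim_tame|].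
by move=> n; have [_] := zpow_cconj n z; rewrite /zim => ->; rewrite mulN1r mulNr.
Qed.

Lemma exp_holjet c : growth c -> holjet setT (exp_jet c).
Proof.
move=> hc; have hk k := growth_iter k hc.
have t1 := @zre_tame R; have t2 := @zim_tame R.
split=> k; first exact: exp_stem_stem.
- move=> z _; apply/continuous_pairP; split.
    by apply: qser_cont => // n t; exact: zre_cont.
  by apply: qser_cont => // n t; exact: zim_cont.
- move=> z _; apply/is_derive_ea/is_derive_pair; split.
    by apply: (qser_dx _ (hk k) t1 t1) => // n y; exact: zre_dx.
  apply: (qser_dx _ (hk k) t2 t2) => // [y y'|n y]; first by rewrite !zim0.
  exact: zim_dx.
- move=> z _; rewrite iota_mul; apply/is_derive_eb/is_derive_pair; split=> /=.
    rewrite -scaleN1r -(qser_scale (w := fun n z => - zim n z) (z := z) _ _ t2); first last.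
    + by move=> n; rewrite mulN1r.
    + exact: tameN.
    + exact: (hk k.+1).
    by apply: (qser_dy _ (hk k) t1 (tameN t2)) => // n y; exact: zre_dy.
  apply: (qser_dy _ (hk k) t2 t1) => // [y y'|n y]; first by rewrite !zim0.
  exact: zim_dy.
Qed.

Lemma exp_axh c Q : open Q -> growth c -> qaxh Q (qser c (@zim1 R)).
Proof.
move=> oQ hc l l4; have [K K1 hK] := growth_geom hc.
rewrite (_ : (fun z => _) = ser (fun n => qco l (c n)) (@zim1 R)).
  exact: (ser_axh oQ (lt_le_trans ltr01 K1) (hK l l4)).
by apply/funext => z; rewrite qco_qser //; exact: zim1_tame.
Qed.

Lemma exp_stem2 c z : growth c -> (exp_stem c z).2 = z.2 *: qser c (@zim1 R) z.
Proof.
by move=> hc; apply: (qser_scale hc (@zim_tame R) (@zim1_tame R)).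
Qed.

Lemma exp_jet_dlam c k z lambda : growth c ->
  dlam lambda (exp_jet c) k z = exp_jet (fun n => c n.+1 - c n * lambda) k z.
Proof.
move=> hc; elim: k c hc => [|k IH] c hc.
  by rewrite /dlam /exp_jet /= /exp_stem /rmulC /= !qser_dlam //; [exact: zim_tame|exact: zre_tame].
by rewrite /dlam !exp_jetS -(IH _ (growth_shift hc)) /dlam !exp_jetS.
Qed.

Lemma slice_pow n z J : imag_unit J ->
  (z.1%:A + z.2 *: J) ^+ n = (zre n z)%:A + zim n z *: J.
Proof.
move=> JJ; elim: n => [|n IH]; first by rewrite zre0 zim0 scale0r addr0 scale1r.
rewrite exprS IH zreS zimS mulrDl !mulrDr !mulr_algr mulr_algl.
have -> : z.2 *: J * (zim n z *: J) = - (z.2 * zim n z)%:A.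
  by rewrite -scalerAl -scalerAr JJ scalerA scalerN.
by rewrite !scalerA; qlin.
Qed.

Lemma exp_induces mu : induces setT (exp_stem (ecoef mu)) (gen_exp mu).
Proof.
move=> z J _ hJ; apply: cvg_lim; first exact: norm_hausdorff.
have hc := growth_ecoef mu.
have h1 := qser_cvg (z := z) hc (@zre_tame R).
have h2 := @qser_map (fun y => J * y) _ _ z hc (@zim_tame R) (fun x y => mulrDr J x y)
  (fun (a : R) x => esym (scalerAr a J x)) (fun x => @continuous_mull J x).
rewrite (_ : (fun N => _) = (fun N => \sum_(0 <= n < N) (zre n z / n`!%:R) *: ecoef mu n) +
    (fun N => \sum_(0 <= n < N) (zim n z / n`!%:R) *: (J * ecoef mu n))); first exact: cvgD h1 h2.
(* [gen_exp] starts at [(size mu).-1]; the sum is widened to start at 0, the added terms being those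
   where [ecoef] is 0. *)
apply/funext => N; rewrite [RHS]/GRing.add /= -big_split /= (big_nat_widenl _ 0%N) //.
rewrite big_mkcond; apply: eq_bigr => n _; rewrite slice_pow //= cplt_sumE.
rewrite /ecoef ltnNge; case: (size mu) => [|m] /=.
  rewrite scalerDr mulrDl !scalerA ![_ / _]mulrC.
  by rewrite -!scalerAl mul1r.
rewrite ltnS; case: ifP => _ /=; last by rewrite mulr0 !scaler0 addr0.
by rewrite scalerDr mulrDl !scalerA ![_ / _]mulrC -!scalerAl mul1r.
Qed.

End QuaternionSeries.

(** * Slice constants and slice products *)

Section SliceConstants.
Variable R : realType.
Local Notation H := (quat R).
Local Notation HC := (quatC R).
Local Notation C := (cplx R).
Implicit Types (D : set C) (F G h : C -> HC) (f g : H -> H) (x J lambda : H) (z w : C)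
  (Xs Fs : nat -> C -> HC) (u v : HC) (k : nat).

Lemma qCmulA u v u' : qCmul u (qCmul v u') = qCmul (qCmul u v) u'.
Proof.
rewrite /qCmul /=; congr pair; rewrite !mulrDl !mulrDr !mulrN !mulNr !mulrA.
  by qlin.
by qlin.
Qed.

Lemma qCmulDr u v u' : qCmul u (v + u') = qCmul u v + qCmul u u'.
Proof. by rewrite /qCmul /=; congr pair; rewrite !mulrDr; qlin. Qed.

Lemma qCmulDl u v u' : qCmul (u + v) u' = qCmul u u' + qCmul v u'.
Proof. by rewrite /qCmul /=; congr pair; rewrite !mulrDl; qlin. Qed.

Lemma qCmulNr u v : qCmul u (- v) = - qCmul u v.
Proof. by rewrite /qCmul /=; congr pair; rewrite !mulrN ?opprD ?opprK. Qed.

Lemma qCmul0r u : qCmul u 0 = 0.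
Proof. by rewrite /qCmul /= !mulr0 subr0 addr0. Qed.

Lemma qCmul0l u : qCmul 0 u = 0.
Proof. by rewrite /qCmul /= !mul0r subr0 addr0. Qed.

Lemma qCmul1r u : qCmul u (1, 0) = u.
Proof. by rewrite /qCmul /= !mulr1 !mulr0 subr0 add0r -surjective_pairing. Qed.

Lemma qCmul_rmulC u v lambda : qCmul u (rmulC v lambda) = rmulC (qCmul u v) lambda.
Proof. by rewrite /qCmul /rmulC /=; congr pair; rewrite ?mulrDl ?mulNr !mulrA. Qed.

Lemma qCmul_iota u v : qCmul u (qCmul (iota_ R) v) = qCmul (iota_ R) (qCmul u v).
Proof.
by rewrite !iota_mul /qCmul /=; congr pair; rewrite ?mulrN ?opprK ?opprD // addrC.
Qed.

Lemma qCconj_mul u v : qCmul (qCconj u) (qCconj v) = qCconj (qCmul u v).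
Proof.
by rewrite /qCmul /qCconj /=; congr pair; rewrite ?mulrN ?mulNr ?opprK ?opprD.
Qed.

Lemma iota_inj u : qCmul (iota_ R) u = 0 -> u = 0.
Proof.
rewrite iota_mul => e; have e1 := congr1 fst e; have e2 := congr1 snd e; rewrite /= in e1 e2.
by rewrite [LHS]surjective_pairing e2 -[u.2]opprK e1 oppr0.
Qed.

Lemma qCd_mul (F G : R -> HC) (t : R) d e :
  is_derive t 1 F d -> is_derive t 1 G e ->
  is_derive t 1 (fun s => qCmul (F s) (G s)) (qCmul d (G t) + qCmul (F t) e).
Proof.
move=> /is_derive_pair[f1 f2] /is_derive_pair[g1 g2]; apply/is_derive_pair; split.
  apply: (is_derive_eq (qdD (qdM f1 g1) (qdN (qdM f2 g2)))).
  by rewrite /qCmul /=; qlin.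
by apply: (is_derive_eq (qdD (qdM f1 g2) (qdM f2 g1))); rewrite /qCmul /=; qlin.
Qed.

Lemma qCd_mul_a F G z d e : is_derive z ((1, 0) : C) F d -> is_derive z ((1, 0) : C) G e ->
  is_derive z ((1, 0) : C) (fun w => qCmul (F w) (G w)) (qCmul d (G z) + qCmul (F z) e).
Proof.
move=> /is_derive_ea h1 /is_derive_ea h2; apply/is_derive_ea.
by apply: (is_derive_eq (qCd_mul h1 h2)); rewrite -surjective_pairing.
Qed.

Lemma qCd_mul_b F G z d e : is_derive z ((0, 1) : C) F d -> is_derive z ((0, 1) : C) G e ->
  is_derive z ((0, 1) : C) (fun w => qCmul (F w) (G w)) (qCmul d (G z) + qCmul (F z) e).
Proof.
move=> /is_derive_eb h1 /is_derive_eb h2; apply/is_derive_eb.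
by apply: (is_derive_eq (qCd_mul h1 h2)); rewrite -surjective_pairing.
Qed.

Lemma qCcont_mul (T : topologicalType) (F G : T -> HC) t :
  {for t, continuous F} -> {for t, continuous G} ->
  {for t, continuous (fun s => qCmul (F s) (G s))}.
Proof.
move=> /continuous_pairP[f1 f2] /continuous_pairP[g1 g2]; apply/continuous_pairP; split.
  exact: (@continuousB _ _ _ (fun s => (F s).1 * (G s).1) (fun s => (F s).2 * (G s).2) t
    (@continuous_qM _ _ _ _ t f1 g1) (@continuous_qM _ _ _ _ t f2 g2)).
exact: (@continuousD _ _ _ (fun s => (F s).1 * (G s).2) (fun s => (F s).2 * (G s).1) t
  (@continuous_qM _ _ _ _ t f1 g2) (@continuous_qM _ _ _ _ t f2 g1)).
Qed.

(** Only local constancy: if [D] consists of two conjugate components, the second component of [h]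
    may be a nonzero constant on one and its opposite on the other. *)
Record sconst D h : Prop := SConst
  { sc_stem : stem D h;
    sc_a : forall z, D z -> is_derive z ((1, 0) : C) h 0;
    sc_b : forall z, D z -> is_derive z ((0, 1) : C) h 0 }.

Lemma line_const (f : R -> H) (t r : R) : (forall s, `|s - t| < r -> is_derive s 1 f 0) ->
  forall s, `|s - t| < r -> f s = f t.
Proof.
move=> h s hs; have el l : (l < 4)%N -> qco l (f s) = qco l (f t).
  move=> l4; have d y : between t s y -> is_derive y 1 (fun y => qco l (f y)) 0.
    move=> tys; have := proj1 (is_derive_qco _ _ _ _) (h y _) l l4; rewrite qco0; apply.
    exact: le_lt_trans (between_le_norm tys) hs.
  have [c _ /eqP] := @mvt _ (fun s => qco l (f s)) (fun=> 0) t s d.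
  by rewrite mul0r subr_eq0 => /eqP.
by apply: quat_eqP; exact: el.
Qed.

Lemma sconst_box D h z : open D -> sconst D h -> D z ->
  exists2 r, 0 < r & box z r `<=` D /\ forall w, box z r w -> h w = h z.
Proof.
move=> oD hh Dz; have [r r0 sub] := open_box_sub oD Dz; exists r => //; split=> //.
have da w : box z r w -> is_derive w.1 1 (fun t => (h (t, w.2)).1) 0 /\
    is_derive w.1 1 (fun t => (h (t, w.2)).2) 0.
  move=> bw; have := sc_a hh (sub w bw) => /is_derive_ea/is_derive_pair; exact.
have db w : box z r w -> is_derive w.2 1 (fun t => (h (w.1, t)).1) 0 /\
    is_derive w.2 1 (fun t => (h (w.1, t)).2) 0.
  move=> bw; have := sc_b hh (sub w bw) => /is_derive_eb/is_derive_pair; exact.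
move=> [a b] [/= ha hb].
have cz (t : R) : `|t - z.1| < r -> box z r (t, z.2).
  by move=> ht; split=> //=; rewrite subrr normr0.
have ca (t : R) : `|t - z.2| < r -> box z r (a, t) by [].
have e1 := @line_const (fun t => (h (a, t)).1) z.2 r (fun s hs => proj1 (db _ (ca s hs))) b hb.
have e2 := @line_const (fun t => (h (a, t)).2) z.2 r (fun s hs => proj2 (db _ (ca s hs))) b hb.
have e3 := @line_const (fun t => (h (t, z.2)).1) z.1 r (fun s hs => proj1 (da _ (cz s hs))) a ha.
have e4 := @line_const (fun t => (h (t, z.2)).2) z.1 r (fun s hs => proj2 (da _ (cz s hs))) a ha.
by rewrite /= -surjective_pairing in e1 e2 e3 e4; rewrite [LHS]surjective_pairing e1 e2 e3 e4 -surjective_pairing.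
Qed.

Lemma is_derive_ext D F G z (v : C) (d : HC) : open D -> D z -> (forall w, D w -> F w = G w) ->
  is_derive z v F d -> is_derive z v G d.
Proof.
move=> oD Dz e; apply: near_eq_is_derive.
by apply: filterS (open_nbhs_nbhs (conj oD Dz)) => w Dw; exact: e.
Qed.

Lemma dz_zero F z : dz F z = 0 -> dzbar F z = 0 -> dalpha F z = 0 /\ dbeta F z = 0.
Proof.
have half u : (2^-1 : R) *: u = 0 -> u = 0.
  by move=> /eqP; rewrite scaler_eq0 invr_eq0 pnatr_eq0 /= => /eqP.
rewrite /dz /dzbar => /half e1 /half e2.
have ea : dalpha F z = 0.
  move: e2; rewrite -(subr0_eq e1) -mulr2n -scaler_nat => /eqP.
  by rewrite scaler_eq0 pnatr_eq0 /= => /eqP.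
by split; [exact: ea|apply: iota_inj; rewrite ea add0r in e2; exact: e2].
Qed.

End SliceConstants.

Section SliceConstantFunctions.
Variable R : realType.
Local Notation H := (quat R).
Local Notation HC := (quatC R).
Local Notation C := (cplx R).
Implicit Types (D : set C) (F G h : C -> HC) (f g : H -> H) (x J lambda : H) (z w : C).

Lemma stem_partials D F z (Fa Fb : C -> HC) : open D -> conj_invariant D -> stem D F ->
  (forall z, D z -> is_derive z ((1, 0) : C) F (Fa z)) ->
  (forall z, D z -> is_derive z ((0, 1) : C) F (Fb z)) -> D z ->
  Fa (cconj z) = qCconj (Fa z) /\ Fb (cconj z) = - qCconj (Fb z).
Proof.
move=> oD cD sF da db Dz; have Dw := cD z Dz.
have [a1 a2] := proj1 (is_derive_pair _ _ _ _) (proj1 (is_derive_ea _ _ _) (da _ Dz)).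
have [b1 b2] := proj1 (is_derive_pair _ _ _ _) (proj1 (is_derive_eb _ _ _) (db _ Dz)).
have [a1' a2'] := proj1 (is_derive_pair _ _ _ _) (proj1 (is_derive_ea _ _ _) (da _ Dw)).
have [b1' b2'] := proj1 (is_derive_pair _ _ _ _) (proj1 (is_derive_eb _ _ _) (db _ Dw)).
have e1 := is_derive_uniqV a1' (parity_x oD cD Dz (fun w Dw => stem1 sF Dw) a1).
have e2 := is_derive_uniqV a2' (parity_x oD cD Dz (fun w Dw => stem2 sF Dw) a2).
have e3 := is_derive_uniqV b1' (parity_y oD cD Dz (fun w Dw => stem1 sF Dw) b1).
have e4 := is_derive_uniqV b2' (parity_y oD cD Dz (fun w Dw => stem2 sF Dw) b2).
split; [rewrite [LHS]surjective_pairing e1 e2|rewrite [LHS]surjective_pairing e3 e4].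
  by rewrite /qCconj scale1r scaleN1r.
by rewrite /qCconj opprK scale1r scaleN1r [RHS]surjective_pairing /= opprK.
Qed.

Lemma dz_eq F z (a b : HC) : dalpha F z = a -> dbeta F z = b ->
  dz F z = 2^-1 *: (a - qCmul (iota_ R) b) /\ dzbar F z = 2^-1 *: (a + qCmul (iota_ R) b).
Proof. by move=> <- <-; split; reflexivity. Qed.

(** The slice derivative is defined through chosen stems and chosen functions. Uniqueness of stems
    identifies them with [F]; then $\partial F/\partial z=\partial F/\partial\overline z=0$ leaves
    both partial derivatives 0. *)
Lemma slice_constant_sconst D f : open D -> conj_invariant D -> slice_constant D f ->
  exists2 h, sconst D h & induces D h f.
Proof.
move=> oD cD [[F [sF cF hF reg]] sd].
pose Fa := dalpha F; pose Fb := dbeta F.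
have da z : D z -> is_derive z ((1, 0) : C) F (Fa z).
  by move=> /cF[d1 _ _ _]; exact: derivableP.
have db z : D z -> is_derive z ((0, 1) : C) F (Fb z).
  by move=> /cF[_ d2 _ _]; exact: derivableP.
have par z Dz := @stem_partials D F z Fa Fb oD cD sF da db Dz.
have SF z : D z -> F z = stem_of D f z by move=> Dz; rewrite (stem_ofP sF hF Dz).
have Sa z : D z -> dalpha (stem_of D f) z = Fa z.
  by move=> Dz; have [_ e] := is_derive_ext oD Dz SF (da z Dz).
have Sb z : D z -> dbeta (stem_of D f) z = Fb z.
  by move=> Dz; have [_ e] := is_derive_ext oD Dz SF (db z Dz).
have dzE z : D z -> dz (stem_of D f) z = 2^-1 *: (Fa z - qCmul (iota_ R) (Fb z)).
  by move=> Dz; exact: (proj1 (dz_eq (Sa z Dz) (Sb z Dz))).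
(* This parity is what makes [slice_ind] return an induced function instead of its default 0. *)
have st : stem D (dz (stem_of D f)).
  move=> z Dz; have [e1 e2] := par z Dz.
  rewrite (dzE z Dz) (dzE _ (cD z Dz)) e1 e2 !iota_mul /qCconj.
  move: (Fa z) (Fb z) => [p1 p2] [q1 q2] /=; congr pair; rewrite /=; last by qlin.
  by qlin.
have i1 := slice_indP cD st.
have i0 : induces D (fun=> 0) (slice_deriv D f).
  by move=> z J Dz hJ; rewrite sd ?mulr0 ?addr0 //; exists z, J.
have z0 z : D z -> Fa z = 0 /\ Fb z = 0.
  move=> Dz; apply: (@dz_zero _ F z); last exact: reg.
  by have := induces_uniq i1 i0 Dz; rewrite (dzE z Dz).
exists F; last exact: hF.
split=> [|z Dz|z Dz]; first exact: sF.
- by have [<- _] := z0 z Dz; exact: da.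
- by have [_ <-] := z0 z Dz; exact: db.
Qed.

Lemma sconst_slice_constant D h : open D -> conj_invariant D -> sconst D h ->
  slice_constant D (slice_ind D h).
Proof.
move=> oD cD [sh ha hb]; have ih := slice_indP cD sh.
have a0 F z : D z -> (forall w, D w -> h w = F w) -> dalpha F z = 0 /\ dbeta F z = 0.
  move=> Dz e; have [_ e1] := is_derive_ext oD Dz e (ha z Dz).
  have [_ e2] := is_derive_ext oD Dz e (hb z Dz).
  by split; [exact: e1|exact: e2].
have dz0 F z : D z -> (forall w, D w -> h w = F w) -> dz F z = 0 /\ dzbar F z = 0.
  move=> Dz e; have [e1 e2] := a0 F z Dz e; have [-> ->] := dz_eq e1 e2.
  by rewrite qCmul0r subr0 addr0 scaler0.
split.
  exists h; split; [exact: sh| |exact: ih|].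
    have c0 z : {for z, continuous (fun _ : C => 0 : HC)} by exact: cst_continuous.
    move=> z Dz; split; [by have [] := ha z Dz|by have [] := hb z Dz| |].
      have e w : D w -> (fun _ : C => 0 : HC) w = dalpha h w by move=> Dw; have [-> _] := a0 h w Dw (fun w _ => erefl).
      exact: (cont_ext oD Dz e (@c0 z)).
    have e w : D w -> (fun _ : C => 0 : HC) w = dbeta h w by move=> Dw; have [_ ->] := a0 h w Dw (fun w _ => erefl).
    exact: (cont_ext oD Dz e (@c0 z)).
  by move=> z Dz; have [] := dz0 h z Dz (fun w _ => erefl).
have e w : D w -> h w = stem_of D (slice_ind D h) w.
  by move=> Dw; rewrite (stem_ofP sh ih Dw).
have st : stem D (dz (stem_of D (slice_ind D h))).
  move=> z Dz; have [-> _] := dz0 _ _ (cD z Dz) e; have [-> _] := dz0 _ _ Dz e.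
  by rewrite /qCconj /= oppr0.
move=> x [z [J [Dz hJ ->]]]; rewrite /slice_deriv (slice_indP cD st Dz hJ).
by have [-> _] := dz0 _ _ Dz e; rewrite mulr0 addr0.
Qed.

Lemma slice_mul_induces D f g F G : conj_invariant D -> stem D F -> stem D G ->
  induces D F f -> induces D G g -> induces D (fun z => qCmul (F z) (G z)) (slice_mul D f g).
Proof.
move=> cD sF sG hF hG z J Dz hJ.
have st : stem D (fun z => qCmul (stem_of D f z) (stem_of D g z)).
  move=> w Dw; have Dw' := cD w Dw.
  by rewrite !(stem_ofP sF hF) // !(stem_ofP sG hG) // sF // sG // qCconj_mul.
by rewrite /slice_mul (slice_indP cD st Dz hJ) (stem_ofP sF hF) // (stem_ofP sG hG).
Qed.

End SliceConstantFunctions.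

(** * Products of slice constants with holomorphic jets *)

Section Products.
Variable R : realType.
Local Notation H := (quat R).
Local Notation HC := (quatC R).
Local Notation C := (cplx R).
Implicit Types (D Q : set C) (h : C -> HC) (f g : H -> H) (x J lambda : H) (z w : C)
  (Xs Ys Fs : nat -> C -> HC) (G U : C -> H) (mu Lambda : seq H).

Lemma axh_ext Q (u v : C -> R) : open Q -> (forall z, Q z -> u z = v z) -> axh Q u -> axh Q v.
Proof. by move=> oQ e hu; have [] := @axharm_canon _ Q (canon u) v oQ hu e. Qed.

Lemma axh_lin Q (k l : R) (u v : C -> R) : open Q -> axh Q u -> axh Q v ->
  axh Q (fun z => k * u z + l * v z).
Proof.
move=> oQ hu hv.
by have [] := axharm_canon oQ (axharm_lin k l hu hv) (fun z _ => erefl (k * u z + l * v z)).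
Qed.

Lemma qaxh_ext Q U G : open Q -> (forall z, Q z -> U z = G z) -> qaxh Q U -> qaxh Q G.
Proof.
move=> oQ e hU l l4; apply: (axh_ext oQ _ (hU l l4)) => z Qz.
by rewrite e.
Qed.

Lemma qaxh_local D G : (forall z, D z -> exists Q, Q z /\ qaxh Q G) -> qaxh D G.
Proof.
by move=> h l l4; apply: axh_local => z /h[Q [Qz hQ]]; exists Q; split=> //; exact: hQ.
Qed.

Lemma qaxh_mull Q x G : open Q -> qaxh Q G -> qaxh Q (fun z => x * G z).
Proof.
move=> oQ hG l l4.
have main (a b c d : R) : axh Q (fun z => 1 * (a * qco 0 (G z) + b * qco 1 (G z)) +
    1 * (c * qco 2 (G z) + d * qco 3 (G z))).
  exact: (axh_lin 1 1 oQ (axh_lin a b oQ (hG 0%N isT) (hG 1%N isT))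
    (axh_lin c d oQ (hG 2%N isT) (hG 3%N isT))).
case: l l4 => [|[|[|[|//]]]] _.
- apply: (axh_ext oQ _ (main (qco 0 x) (- qco 1 x) (- qco 2 x) (- qco 3 x))) => z _.
  by have [-> _ _ _] := qcoM x (G z); ring.
- apply: (axh_ext oQ _ (main (qco 1 x) (qco 0 x) (- qco 3 x) (qco 2 x))) => z _.
  by have [_ -> _ _] := qcoM x (G z); ring.
- apply: (axh_ext oQ _ (main (qco 2 x) (qco 3 x) (qco 0 x) (- qco 1 x))) => z _.
  by have [_ _ -> _] := qcoM x (G z); ring.
- apply: (axh_ext oQ _ (main (qco 3 x) (- qco 2 x) (qco 1 x) (qco 0 x))) => z _.
  by have [_ _ _ ->] := qcoM x (G z); ring.
Qed.

Lemma qaxhB Q U G : open Q -> qaxh Q U -> qaxh Q G -> qaxh Q (fun z => U z - G z).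
Proof.
move=> oQ hU hG l l4; apply: (axh_ext oQ _ (axh_lin 1 (-1) oQ (hU l l4) (hG l l4))) => z _.
by rewrite qcoD qcoN; ring.
Qed.

Lemma holjetS D Q Fs : Q `<=` D -> holjet D Fs -> holjet Q Fs.
Proof.
move=> s [h1 h2 h3 h4]; split=> k z /s Dz; [exact: h1|exact: h2|exact: h3|exact: h4].
Qed.

Lemma continuous_invb z : z.2 != 0 -> {for z, continuous (fun w : C => w.2^-1)}.
Proof.
by move=> z0; exact: (@continuousV _ _ (fun w : C => w.2) z z0 cvg_snd).
Qed.

(** Off the axis the axial equation of $F_2/b$ is the harmonicity of $F_2$. Derivatives in [b] are
    expressed by terms of the jet through Cauchy-Riemann, so the second order ones are again
    explicit. *)
Lemma holjet_div Q Fs : open Q -> holjet Q Fs -> (forall z, Q z -> z.2 != 0) ->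
  qaxh Q (fun z => z.2^-1 *: (Fs 0%N z).2).
Proof.
move=> oQ hF Q0 l l4.
pose v k z := qco l (Fs k z).2; pose w k z := qco l (Fs k z).1.
have cv k z : Q z -> {for z, continuous (v k)}.
  move=> Qz; have [_ c2] := proj1 (continuous_pairP _ _) (@hj_cont _ _ _ hF k z Qz).
  exact: (proj1 (continuous_qco _ _) c2 l l4).
have cw k z : Q z -> {for z, continuous (w k)}.
  move=> Qz; have [c1 _] := proj1 (continuous_pairP _ _) (@hj_cont _ _ _ hF k z Qz).
  exact: (proj1 (continuous_qco _ _) c1 l l4).
have dva k z : Q z -> xder (v k) z (v k.+1 z).
  move=> Qz; have [_ d _ _] := holjet_partials k hF Qz.
  exact: (proj1 (is_derive_qco _ _ _ _) d l l4).
have dvb k z : Q z -> yder (v k) z (w k.+1 z).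
  move=> Qz; have [_ _ _ d] := holjet_partials k hF Qz.
  exact: (proj1 (is_derive_qco _ _ _ _) d l l4).
have dwb k z : Q z -> yder (w k) z (- v k.+1 z).
  move=> Qz; have [_ _ d _] := holjet_partials k hF Qz.
  by have := proj1 (is_derive_qco _ _ _ _) d l l4; rewrite /= qcoN.
pose U := Jet (fun z => z.2^-1 * v 0%N z) (fun z => z.2^-1 * v 1%N z)
  (fun z => z.2^-1 * w 1%N z - z.2^-1 ^+ 2 * v 0%N z) (fun z => z.2^-1 * v 2 z)
  (fun z => - (z.2^-1 * v 2 z) - 2 * z.2^-1 ^+ 2 * w 1%N z + 2 * (z.2^-1 * z.2^-1 ^+ 2) * v 0%N z).
suff hU : axharm Q U.
  by have [] := @axharm_canon _ Q U _ oQ hU (fun z _ => esym (qcoZ l z.2^-1 (Fs 0%N z).2)).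
have dinv z : Q z -> is_derive z.2 1 (fun t : R => t^-1) (- z.2 ^- 2).
  by move=> Qz; have := derV (f := fun t => t) (Q0 z Qz) (derI z.2); rewrite mulr1.
move: (v) (w) cv cw dva dvb dwb @U => v' w' cv cw dva dvb dwb U.
split=> z Qz; have ci := continuous_invb (Q0 z Qz);
  have c0 := cv 0%N z Qz; have c1 := cv 1%N z Qz; have c2 := cv 2 z Qz; have c3 := cw 1%N z Qz;
  have d1 := dva 0%N z Qz; have d2 := dva 1%N z Qz; have d3 := dvb 0%N z Qz; have d4 := dwb 1%N z Qz;
  have d5 := dinv z Qz; have z0 := Q0 z Qz; rewrite /xder /yder /= in d1 d2 d3 d4 d5;
  rewrite /xder /yder /=; try solve [cnt].
- by der; rewrite /= -?surjective_pairing; field.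
- by der; rewrite /= -?surjective_pairing; field.
- by der; rewrite /= -?surjective_pairing; field.
- by der; rewrite /= -?surjective_pairing; field.
- by field.
Qed.

Lemma sconst_cont D h z : open D -> sconst D h -> D z -> {for z, continuous h}.
Proof.
move=> oD hh Dz; have [r r0 [_ hr]] := sconst_box oD hh Dz.
have c0 : {for z, continuous (fun _ : C => h z)} by exact: cst_continuous.
apply: (cont_ext (@open_box _ z r) (box_center _ r0) _ c0) => w bw.
by rewrite (hr w bw).
Qed.

Lemma holjet_mul D h Fs : open D -> conj_invariant D -> sconst D h -> holjet D Fs ->
  holjet D (fun k z => qCmul (h z) (Fs k z)).
Proof.
move=> oD cD hh hF; split=> k z Dz.
- by rewrite (sc_stem hh Dz) (hj_stem hF k Dz) qCconj_mul.
- exact: (@qCcont_mul _ _ h (Fs k) z (@sconst_cont D h z oD hh Dz) (@hj_cont _ _ _ hF k z Dz)).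
- by have := qCd_mul_a (sc_a hh Dz) (hj_a hF k Dz); rewrite qCmul0l add0r.
- by have := qCd_mul_b (sc_b hh Dz) (hj_b hF k Dz); rewrite qCmul0l add0r qCmul_iota.
Qed.

(** Around a point of the axis [h] is a constant with second component 0, so the quotient by [b] is
    that quaternion times [U]. Around any other point it is a plain quotient. The two descriptions
    agree, and the equation is local. *)
Lemma product_qaxh D h Fs U : open D -> conj_invariant D -> sconst D h -> holjet D Fs -> qaxh D U ->
  (forall z, D z -> (Fs 0%N z).2 = z.2 *: U z) ->
  exists2 G, qaxh D G & forall z, D z -> (qCmul (h z) (Fs 0%N z)).2 = z.2 *: G z.
Proof.
move=> oD cD hh hF hU FU.
pose P k z := qCmul (h z) (Fs k z).
have hP : holjet D P by exact: holjet_mul.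
have h2 z : D z -> z.2 = 0 -> (h z).2 = 0.
  by case: z => a b Dz /= b0; rewrite b0 in Dz *; exact: (stem_real (sc_stem hh)).
exists (fun z => if z.2 == 0 then (h z).1 * U z else z.2^-1 *: (P 0%N z).2); last first.
  move=> z Dz; case: eqP => [z0|/eqP z0]; last by rewrite scalerA mulfV // scale1r.
  by rewrite /qCmul /= FU // h2 // z0 !scale0r mulr0 mul0r addr0.
apply: qaxh_local => z Dz.
have [r1 r10 [s1 hr1]] := sconst_box oD hh Dz.
have [r2 r20 [s2 hr2]] := good_box oD Dz.
pose r := Num.min r1 r2; have r0 : 0 < r by rewrite lt_min r10.
have b1 w : box z r w -> box z r1 w by apply: box_le; rewrite ge_min lexx.
have b2 w : box z r w -> box z r2 w by apply: box_le; rewrite ge_min lexx orbT.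
have bD : box z r `<=` D by move=> w /b1/s1.
have oB : open (box z r) by exact: open_box.
exists (box z r); split; first exact: box_center.
case: hr2 => [z0|rz].
  apply: (qaxh_ext oB _ (qaxh_mull (h z).1 oB (fun l l4 => axharmS bD (hU l l4)))) => w bw.
  rewrite (hr1 w (b1 w bw)); case: eqP => // /eqP w0.
  rewrite /P /qCmul /= (hr1 w (b1 w bw)) (h2 z Dz z0) mul0r addr0 (FU w (bD w bw)).
  by rewrite -scalerAr scalerA mulVf // scale1r.
have w0 w : box z r w -> w.2 != 0.
  move=> /b2[_ hw]; apply/eqP => e; rewrite e sub0r normrN in hw.
  by have := lt_le_trans hw rz; rewrite ltxx.
apply: (qaxh_ext oB _ (holjet_div oB (holjetS bD hP) w0)) => w /w0 /negPf ->.
by [].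
Qed.

End Products.

(** * The exponential formulas are solutions *)

Section Solutions.
Variable R : realType.
Local Notation H := (quat R).
Local Notation HC := (quatC R).
Local Notation C := (cplx R).
Implicit Types (D Q : set C) (h : C -> HC) (f g : H -> H) (x J lambda : H) (z w : C)
  (Xs Ys Fs : nat -> C -> HC) (G U : C -> H) (mu Lambda : seq H).

Lemma dlam_mul h Fs lambda :
  dlam lambda (fun k z => qCmul (h z) (Fs k z)) = fun k z => qCmul (h z) (dlam lambda Fs k z).
Proof.
apply/funext => k; apply/funext => z.
by rewrite /dlam qCmulDr qCmulNr qCmul_rmulC.
Qed.

Lemma foldr_mul h Fs Lambda : foldr (@dlam R) (fun k z => qCmul (h z) (Fs k z)) Lambda =
  fun k z => qCmul (h z) (foldr (@dlam R) Fs Lambda k z).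
Proof. by elim: Lambda => //= a s ->; rewrite dlam_mul. Qed.

Lemma foldr_dlam0 Lambda : foldr (@dlam R) (fun _ _ => 0) Lambda = fun _ _ => 0.
Proof.
elim: Lambda => //= a s ->; apply/funext => k; apply/funext => z.
by rewrite /dlam /rmulC !mul0r subr0.
Qed.

Lemma exp_jet_nil : exp_jet (@ecoef R [::]) = fun _ _ => 0.
Proof.
apply/funext => k; apply/funext => z; rewrite /exp_jet.
have -> : iter k (fun (c : nat -> H) n => c n.+1) (ecoef [::]) = fun=> 0.
  by elim: k => [|k IH]; [exact/funext|rewrite iterS IH].
have q0 (u : nat -> C -> R) : qser (fun=> 0 : H) u z = 0.
  rewrite /qser (_ : (fun N => _) = fun=> 0); first exact: (lim_cst (@norm_hausdorff _ _)).
  by apply/funext => N; rewrite big1 // => n _; rewrite scaler0.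
by rewrite /exp_stem !q0.
Qed.

(** [foldr] applies the operator of the last entry first, and this is the entry that [ecoef_rcons]
    removes. *)
Lemma exp_jet_foldr mu Lambda :
  foldr (@dlam R) (exp_jet (ecoef (mu ++ Lambda))) Lambda = exp_jet (ecoef mu).
Proof.
elim/last_ind: Lambda => [|s lambda IH]; first by rewrite cats0.
rewrite foldr_rcons -rcons_cat (_ : dlam lambda _ = exp_jet (ecoef (mu ++ s))) //.
apply/funext => k; apply/funext => z; rewrite exp_jet_dlam; last exact: growth_ecoef.
by congr (exp_jet _ k z); apply/funext => n; rewrite ecoef_rcons.
Qed.

Lemma exp_data D mu : open D -> [/\ holjet D (exp_jet (ecoef mu)),
  qaxh D (qser (ecoef mu) (@zim1 R)) &
  forall z, D z -> (exp_jet (ecoef mu) 0%N z).2 = z.2 *: qser (ecoef mu) (@zim1 R) z].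
Proof.
move=> oD; have hc := growth_ecoef mu; split.
- exact: (holjetS (@subsetT _ D) (exp_holjet hc)).
- exact: exp_axh.
- by move=> z _; exact: exp_stem2.
Qed.

Lemma product_data D f mu : open D -> conj_invariant D -> slice_constant D f ->
  exists h G, [/\ sconst D h /\ qaxh D G, holjet D (fun k z => qCmul (h z) (exp_jet (ecoef mu) k z)),
    forall z, D z -> (qCmul (h z) (exp_jet (ecoef mu) 0%N z)).2 = z.2 *: G z,
    induces D h f &
    induces D (fun z => qCmul (h z) (exp_jet (ecoef mu) 0%N z)) (slice_mul D f (gen_exp mu))].
Proof.
move=> oD cD hf; have [h hh ih] := slice_constant_sconst oD cD hf.
have [hE hU EU] := exp_data mu oD.
have [G hG PG] := product_qaxh oD cD hh hE hU EU; exists h, G; split.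
- by split; [exact: hh|exact: hG].
- exact: (holjet_mul oD cD hh hE).
- exact: PG.
- exact: ih.
- apply: (slice_mul_induces cD (sc_stem hh) (hj_stem hE 0%N) ih) => z J _ hJ.
  exact: exp_induces.
Qed.

(** All derivatives of the equation are recorded for one witness jet. Witnesses can be added, which
    makes this notion stable under sums. *)
Definition jet_solution D Lambda f := exists Xs, [/\ amjet D Xs, induces D (Xs 0%N) f &
  forall k z, D z -> foldr (@dlam R) Xs Lambda k z = 0].

Lemma jet_solution_is D Lambda f : open D -> conj_invariant D ->
  jet_solution D Lambda f -> is_solution D Lambda f.
Proof. by move=> oD cD [Xs [h1 h2 h3]]; apply: (amjet_solution oD cD h1 h2) => z; exact: h3. Qed.

Lemma fueter_solution D Fs G f Lambda : open D -> conj_invariant D -> holjet D Fs -> qaxh D G ->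
  (forall z, D z -> (Fs 0%N z).2 = z.2 *: G z) -> induces D (Fs 0%N) f ->
  (forall k z, D z -> foldr (@dlam R) Fs Lambda k z = 0) ->
  jet_solution D Lambda (laplacian f).
Proof.
move=> oD cD hF hG FG hf h0; exists (fun k => fueter_stem (iter k (@qdx R) G)); split.
- exact: (fueter_jet oD cD hF hG FG).
- exact: (fueter_induces oD cD hF hG FG hf).
- exact: (fueter_fold oD hF hG FG h0).
Qed.

Lemma gen_exp_solution D Lambda : open D -> conj_invariant D ->
  jet_solution D Lambda (laplacian (gen_exp Lambda)).
Proof.
move=> oD cD; have [hE hU EU] := exp_data Lambda oD.
apply: (fueter_solution oD cD hE hU EU) => [z J _ hJ|k z _]; first exact: exp_induces.
by rewrite -[Lambda in ecoef Lambda]/([::] ++ Lambda) exp_jet_foldr exp_jet_nil.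
Qed.

(** Slice constants multiply on the left and the [lambda]s on the right, so [h] passes through the
    operators; those of [drop i Lambda] act first and already annihilate the exponential. *)
Lemma product_solution D Lambda f i : open D -> conj_invariant D -> slice_constant D f ->
  jet_solution D Lambda (laplacian (slice_mul D f (gen_exp (drop i Lambda)))).
Proof.
move=> oD cD hf; have [h [G [[hh hG] hP PG _ iP]]] := product_data (drop i Lambda) oD cD hf.
apply: (fueter_solution oD cD hP hG PG iP) => k z _.
rewrite -{2}(cat_take_drop i Lambda) foldr_cat foldr_mul.
rewrite -{1}[drop i Lambda]/([::] ++ drop i Lambda) exp_jet_foldr exp_jet_nil.
rewrite (_ : (fun _ _ => _) = fun _ _ => 0) ?foldr_dlam0 //.
by apply/funext => j; apply/funext => w; rewrite qCmul0r.
Qed.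

Lemma rmulC1 (u : HC) : rmulC u 1 = u.
Proof. by rewrite /rmulC !mulr1 -surjective_pairing. Qed.

Lemma amjet_sub D Xs Ys : open D -> amjet D Xs -> amjet D Ys -> amjet D (fun k z => Xs k z - Ys k z).
Proof.
move=> oD hX hY; have := amjet_lin 1 oD hX hY; congr amjet.
by apply/funext => k; apply/funext => z; rewrite rmulC1.
Qed.

Lemma amjet0 D : open D -> conj_invariant D -> amjet D (fun _ _ => 0).
Proof.
move=> oD cD; have [Xs [hX _ _]] := gen_exp_solution [::] oD cD.
have := amjet_sub oD hX hX; congr amjet.
by apply/funext => k; apply/funext => z; rewrite subrr.
Qed.

Lemma amjet_add D Xs Ys : open D -> conj_invariant D -> amjet D Xs -> amjet D Ys ->
  amjet D (fun k z => Xs k z + Ys k z).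
Proof.
move=> oD cD hX hY; have := amjet_sub oD hX (amjet_sub oD (amjet0 oD cD) hY).
congr amjet; apply/funext => k; apply/funext => z.
by rewrite sub0r opprK.
Qed.

Lemma foldr_dlamD Xs Ys Lambda : foldr (@dlam R) (fun k z => Xs k z + Ys k z) Lambda =
  fun k z => foldr (@dlam R) Xs Lambda k z + foldr (@dlam R) Ys Lambda k z.
Proof.
elim: Lambda => //= a s ->; apply/funext => k; apply/funext => z; rewrite /dlam.
rewrite addrACA -opprD; congr (_ - _).
by rewrite /rmulC /=; congr pair; rewrite mulrDl.
Qed.

Lemma jet_solution_sum D Lambda n (f : nat -> H -> H) : open D -> conj_invariant D ->
  (forall i, (i < n)%N -> jet_solution D Lambda (f i)) ->
  jet_solution D Lambda (fun x => \sum_(i < n) f i x).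
Proof.
move=> oD cD; elim: n => [|n IH] hf.
  exists (fun _ _ => 0); split; first exact: amjet0.
    by move=> z J _ _; rewrite big_ord0 /= mulr0 addr0.
  by move=> k z _; rewrite foldr_dlam0.
have [Xs [X1 X2 X3]] := IH (fun i hi => hf i (leqW hi)).
have [Ys [Y1 Y2 Y3]] := hf n (ltnSn n).
exists (fun k z => Xs k z + Ys k z); split; first exact: amjet_add.
  move=> z J Dz hJ; rewrite big_ord_recr /= (X2 z J Dz hJ) (Y2 z J Dz hJ).
  by rewrite mulrDr addrACA.
by move=> k z Dz; rewrite foldr_dlamD X3 // Y3 // addr0.
Qed.

End Solutions.

(** * The inverse of Fueter's map *)

Section AllSolutions.
Variable R : realType.
Local Notation H := (quat R).
Local Notation HC := (quatC R).
Local Notation C := (cplx R).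
Implicit Types (D Q : set C) (h : C -> HC) (f g : H -> H) (x J lambda : H) (z w : C)
  (Xs Ys Fs : nat -> C -> HC) (G U : C -> H) (mu Lambda : seq H).

Lemma quat_inverse lambda : lambda != 0 -> exists x, lambda * x = 1 /\ x * lambda = 1.
Proof.
move=> l0; pose N := qco 0 lambda ^+ 2 + qco 1 lambda ^+ 2 + qco 2 lambda ^+ 2 + qco 3 lambda ^+ 2.
have N0 : N != 0.
  apply: contra_neq l0 => N0.
  have h0 := sqr_ge0 (qco 0 lambda); have h1 := sqr_ge0 (qco 1 lambda).
  have h2 := sqr_ge0 (qco 2 lambda); have h3 := sqr_ge0 (qco 3 lambda).
  by apply: quat_eqP; rewrite qco0; apply/eqP; rewrite -sqrf_eq0; apply/eqP; rewrite /N in N0; lra.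
exists (mkquat (qco 0 lambda / N) (- qco 1 lambda / N) (- qco 2 lambda / N) (- qco 3 lambda / N)).
have [u0 u1 u2 u3] := qco1 R.
set x := mkquat _ _ _ _.
have [x0 x1 x2 x3] : [/\ qco 0 x = qco 0 lambda / N, qco 1 x = - qco 1 lambda / N,
    qco 2 x = - qco 2 lambda / N & qco 3 x = - qco 3 lambda / N].
  by rewrite /x !qco_mkquat.
have [a0 a1 a2 a3] := qcoM lambda x; have [b0 b1 b2 b3] := qcoM x lambda.
split; apply: quat_eqP; rewrite ?(a0, a1, a2, a3, b0, b1, b2, b3) x0 x1 x2 x3 ?(u0, u1, u2, u3);
  move: N0; rewrite /N; move: (qco 0 lambda) (qco 1 lambda) (qco 2 lambda) (qco 3 lambda) => a b c d N0;
  by field.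
Qed.

Lemma rmulCA (u : HC) x lambda : rmulC (rmulC u x) lambda = rmulC u (x * lambda).
Proof. by rewrite /rmulC /= !mulrA. Qed.

Lemma rmulCB (u v : HC) lambda : rmulC (u - v) lambda = rmulC u lambda - rmulC v lambda.
Proof. by rewrite /rmulC /=; congr pair; rewrite mulrBl. Qed.

(** Let $\lambda$ be the first entry and $Z$ the result of the other operators on $X$. From
    $W'=Z'-Z\lambda$ the jet $V=(Z-W)\lambda^{-1}$ satisfies $V'=Z$, so the shorter product has a
    primitive and the induction goes on. Nothing is integrated, so holes of [D] are harmless. *)
Lemma amjet_lift D Lambda : open D -> conj_invariant D -> (forall x, x \in Lambda -> x != 0) ->
  forall Xs Ws, amjet D Xs -> amjet D Ws ->
  (forall k z, D z -> Ws k.+1 z = foldr (@dlam R) Xs Lambda k z) ->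
  exists Ys, [/\ amjet D Ys, forall k z, D z -> Ys k.+1 z = Xs k z &
    forall k z, D z -> foldr (@dlam R) Ys Lambda k z = Ws k z].
Proof.
move=> oD cD; elim: Lambda => [|lambda s IH] l0 Xs Ws hX hW e.
  by exists Ws; split.
have [x [lx xl]] := quat_inverse (l0 _ (mem_head _ _)).
pose Z := foldr (@dlam R) Xs s; have hZ : amjet D Z by exact: amjet_foldr.
pose V k z := rmulC (Z k z - Ws k z) x.
have hV : amjet D V.
  have := amjet_lin (- x) oD (amjet0 oD cD) (amjet_sub oD hZ hW); congr amjet.
  apply/funext => k; apply/funext => z.
  by rewrite /V /rmulC; congr pair; rewrite /= mulrN add0r opprK.
have l0' y : y \in s -> y != 0 by move=> ys; apply: l0; rewrite in_cons ys orbT.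
have VX k z : D z -> V k.+1 z = foldr (@dlam R) Xs s k z.
  move=> Dz; rewrite /V (e k z Dz) /= /dlam -/Z.
  by rewrite opprB addrCA subrr addr0 rmulCA lx rmulC1.
have [Ys [Y1 Y2 Y3]] := IH l0' Xs V hX hV VX.
exists Ys; split=> // k z Dz.
(* With $V'=Z$ and $V\lambda=Z-W$, the outermost operator gives $V'-V\lambda=W$. *)
rewrite /= /dlam (Y3 k.+1 z Dz) (Y3 k z Dz) /V rmulCA xl rmulC1 (e k z Dz) /= /dlam -/Z.
rewrite opprB addrCA subrr addr0 rmulCA lx rmulC1.
by rewrite opprB addrCA subrr addr0.
Qed.

Lemma jet_zero D Xs : open D -> amjet D Xs -> (forall z, D z -> Xs 0%N z = 0) ->
  forall k z, D z -> Xs k z = 0.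
Proof.
move=> oD hX h0; elim=> [|k IH] // z Dz.
have d0 : is_derive z ((1, 0) : C) (fun _ : C => 0 : HC) 0 by exact: is_derive_cst.
apply: (is_derive_uniqV (aj_da hX k Dz)); apply: (is_derive_ext oD Dz _ d0) => w Dw.
by rewrite IH.
Qed.

(** If [Ys 2] is an axially monogenic stem, [fueter_lift Ys 0] is a holomorphic
    stem which Fueter's theorem maps to it. *)
Definition fueter_lift Ys k z : HC :=
  ((- 2^-1) *: (Ys k z).1 + (z.2 / 2) *: (Ys k.+1 z).2, (- (z.2 / 2)) *: (Ys k.+1 z).1).

Lemma amjet_cont D Ys k z : open D -> amjet D Ys -> D z -> {for z, continuous (Ys k)}.
Proof.
move=> oD hY Dz; have hk := aj_am hY k.
apply/continuous_pairP; split; apply/continuous_qco => l l4.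
  exact: (am_cA oD (hk l l4) Dz).
exact: (am_cB oD (hk l l4) Dz).
Qed.

(** Cauchy-Riemann uses $A_b=-B_a$ for the stems [Ys k] and [Ys k.+1], and $b(A_a-B_b)=2B$ for
    [Ys k.+1], which cancels the term produced by differentiating the factor [b / 2]. *)
Lemma fueter_lift_holjet D Ys : open D -> amjet D Ys -> holjet D (fueter_lift Ys).
Proof.
move=> oD hY; split=> k z Dz.
- rewrite /fueter_lift (aj_stem hY k Dz) (aj_stem hY k.+1 Dz) /qCconj /cconj /=.
  by congr pair; rewrite !(mulNr, scaleNr, scalerN, opprK).
- have [c1 c2] := proj1 (continuous_pairP _ _) (@amjet_cont D Ys k z oD hY Dz).
  have [c3 c4] := proj1 (continuous_pairP _ _) (@amjet_cont D Ys k.+1 z oD hY Dz).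
  have cz : {for z, continuous (fun w : C => w.2)} by exact: cvg_snd.
  apply/continuous_pairP; split; apply/continuous_qco => l l4.
    have e1 := proj1 (continuous_qco _ _) c1 l l4; have e4 := proj1 (continuous_qco _ _) c4 l l4.
    rewrite (_ : (fun s => _) = fun s : C => (- 2^-1) * qco l (Ys k s).1 +
      s.2 * 2^-1 * qco l (Ys k.+1 s).2); first by cnt.
    by apply/funext => w; rewrite /fueter_lift qcoD !qcoZ.
  have e3 := proj1 (continuous_qco _ _) c3 l l4.
  rewrite (_ : (fun s => _) = fun s : C => - (s.2 * 2^-1) * qco l (Ys k.+1 s).1); first by cnt.
  by apply/funext => w; rewrite /fueter_lift qcoZ.
- have [Fb [d1 _ _ _]] := amjet_data k oD hY; have [Gb [d2 _ _ _]] := amjet_data k.+1 oD hY.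
  have [a1 a2 _ _] := d1 z Dz; have [a1' a2' _ _] := d2 z Dz.
  apply/is_derive_ea/is_derive_pair; split.
    apply: (is_derive_eq (qdD (qdZ (derC z.1 (- 2^-1)) a1) (qdZ (derC z.1 (z.2 / 2)) a2'))).
    by rewrite /fueter_lift /= !scale0r !addr0.
  apply: (is_derive_eq (qdZ (derC z.1 (- (z.2 / 2))) a1')).
  by rewrite /fueter_lift /= scale0r addr0.
- have [Fb [d1 _ _ q1]] := amjet_data k oD hY; have [Gb [d2 _ _ q2]] := amjet_data k.+1 oD hY.
  have [_ _ b1 b2] := d1 z Dz; have [_ _ b1' b2'] := d2 z Dz.
  have [e1 _] := q1 z Dz; have [e2 e3] := q2 z Dz.
  rewrite iota_mul; apply/is_derive_eb/is_derive_pair; split.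
    have dz : is_derive z.2 1 (fun t : R => t / 2) (2^-1).
      have e := derM (derI z.2) (derC z.2 (2^-1 : R)).
      by apply: (is_derive_eq e); rewrite mulr0 mulr1 add0r.
    apply: (is_derive_eq (qdD (qdZ (derC z.2 (- 2^-1)) b1) (qdZ dz b2'))).
    rewrite /fueter_lift /= scale0r addr0 e1 -surjective_pairing.
    have e3' : (z.2 / 2) *: (Gb z).2 = (z.2 / 2) *: (Ys k.+2 z).1 - (Ys k.+1 z).2.
      have -> : (Ys k.+1 z).2 = 2^-1 *: (z.2 *: (Ys k.+2 z).1 - z.2 *: (Gb z).2).
        by rewrite -scalerBr e3 scalerA mulVf ?pnatr_eq0 // scale1r.
      by apply: quat_eqP; rewrite ?(qcoD, qcoN, qcoZ); field.
    by rewrite e3'; apply: quat_eqP; rewrite ?(qcoD, qcoN, qcoZ); field.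
  have dz : is_derive z.2 1 (fun t : R => - (t / 2)) (- 2^-1).
    have e := derN (derM (derI z.2) (derC z.2 (2^-1 : R))).
    by apply: (is_derive_eq e); rewrite mulr0 mulr1 add0r.
  apply: (is_derive_eq (qdZ dz b1')).
  by rewrite /fueter_lift /= -surjective_pairing e2; qlin.
Qed.

Lemma fueter_lift_dlam Ys lambda :
  dlam lambda (fueter_lift Ys) = fueter_lift (dlam lambda Ys).
Proof.
apply/funext => k; apply/funext => z; rewrite /dlam /fueter_lift /rmulC /=.
congr pair; rewrite /= ?mulrDl -?scalerAl.
  by qlin.
by qlin.
Qed.

Lemma fueter_lift_foldr Ys Lambda :
  foldr (@dlam R) (fueter_lift Ys) Lambda = fueter_lift (foldr (@dlam R) Ys Lambda).
Proof. by elim: Lambda => //= a s ->; exact: fueter_lift_dlam. Qed.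

(** For the first component $A$ one has $A_b=-B_a$ and $A_{bb}=-(B_a)_b$: its axial equation is the
    second equation of the system of the derived stem. *)
Lemma amjet_qaxh D Ys k : open D -> amjet D Ys -> qaxh D (fun z => (Ys k z).1).
Proof.
move=> oD hY l l4.
have [Fb [d1 _ _ q1]] := amjet_data k oD hY; have [Gb [d2 ca cb q2]] := amjet_data k.+1 oD hY.
have cY j z : D z -> {for z, continuous (fun w => qco l (Ys j w).1)} /\
    {for z, continuous (fun w => qco l (Ys j w).2)}.
  move=> Dz; have [c1 c2] := proj1 (continuous_pairP _ _) (@amjet_cont D Ys j z oD hY Dz).
  by split; [exact: (proj1 (continuous_qco _ _) c1 l l4)|exact: (proj1 (continuous_qco _ _) c2 l l4)].
have cN (u : C -> H) z : {for z, continuous (fun w => qco l (u w))} ->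
    {for z, continuous (fun w => - qco l (u w))}.
  by move=> c; cnt.
pose U := Jet (fun z => qco l (Ys k z).1) (fun z => qco l (Ys k.+1 z).1)
  (fun z => - qco l (Ys k.+1 z).2) (fun z => qco l (Ys k.+2 z).1) (fun z => - qco l (Gb z).2).
suff hU : axharm D U by have [] := @axharm_canon _ D U _ oD hU (fun z _ => erefl).
split=> z Dz; rewrite /xder /yder /=.
- have [a _ _ _] := d1 z Dz; exact: (proj1 (is_derive_qco _ _ _ _) a l l4).
- have [_ _ b _] := d1 z Dz; have [e _] := q1 z Dz; rewrite e in b.
  by have := proj1 (is_derive_qco _ _ _ _) b l l4; rewrite qcoN.
- have [a _ _ _] := d2 z Dz; exact: (proj1 (is_derive_qco _ _ _ _) a l l4).
- have [_ _ _ b] := d2 z Dz; have := proj1 (is_derive_qco _ _ _ _) b l l4; exact: derN.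
- have [_ e] := q2 z Dz; have := congr1 (qco l) e; rewrite !qcoZ qcoD qcoN => ->.
  by rewrite mulrN subrr.
- exact: (proj1 (@cY k z Dz)).
- exact: (proj1 (@cY k.+1 z Dz)).
- exact: (@cN (fun w => (Ys k.+1 w).2) z (proj2 (@cY k.+1 z Dz))).
- exact: (proj1 (@cY k.+2 z Dz)).
- have [_ c2] := proj1 (continuous_pairP _ _) (@cb z Dz).
  exact: (@cN (fun w => (Gb w).2) z (proj1 (continuous_qco _ _) c2 l l4)).
Qed.

(** The quotient is $G=-\frac12Y_{a,1}$. Then $-2G_a=Y_{aa,1}$, and $2G_b=-(Y_{a,1})_b=Y_{aa,2}$ by
    the first equation of the system. *)
Lemma fueter_lift_data D Ys : open D -> amjet D Ys -> exists G, [/\ qaxh D G,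
  forall z, D z -> (fueter_lift Ys 0%N z).2 = z.2 *: G z &
  forall z, D z -> fueter_stem G z = Ys 2 z].
Proof.
move=> oD hY; exists (fun z => (- 2^-1) *: (Ys 1%N z).1); split.
- apply: (qaxh_ext oD _ (qaxh_mull (- 2^-1)%:A oD (amjet_qaxh 1 oD hY))) => z _.
  exact: mulr_algl.
- by move=> z _; rewrite /fueter_lift /= scalerA mulrN.
move=> z Dz; have [Fb [d1 _ _ q1]] := amjet_data 1 oD hY.
have [a _ b _] := d1 z Dz; have [e _] := q1 z Dz.
have da := qdZ (derC z.1 (- 2^-1)) a; have db := qdZ (derC z.2 (- 2^-1)) b.
have e1 : qdx (fun z => (- 2^-1) *: (Ys 1%N z).1) z = (- 2^-1) *: (Ys 2 z).1.
  by apply: qdx_eq; apply: (is_derive_eq da); rewrite scale0r addr0.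
have e2 : qdy (fun z => (- 2^-1) *: (Ys 1%N z).1) z = 2^-1 *: (Ys 2 z).2.
  by apply: qdy_eq; apply: (is_derive_eq db); rewrite scale0r addr0 e scalerN scaleNr opprK.
rewrite /fueter_stem e1 e2 !scalerA mulrNN mulfV ?pnatr_eq0 // !scale1r.
by rewrite -surjective_pairing.
Qed.

End AllSolutions.

(** * Splitting a holomorphic solution into exponentials *)

Section Decomposition.
Variable R : realType.
Local Notation H := (quat R).
Local Notation HC := (quatC R).
Local Notation C := (cplx R).
Implicit Types (D Q : set C) (h : C -> HC) (f g : H -> H) (x J lambda : H) (z w : C)
  (Xs Ys Fs : nat -> C -> HC) (G U : C -> H) (mu Lambda : seq H).

Lemma rmulC_qCmul (u : HC) lambda : rmulC u lambda = qCmul u (lambda, 0).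
Proof. by rewrite /rmulC /qCmul /= !mulr0 subr0 add0r. Qed.

Lemma exp1_right lambda k z :
  exp_jet (ecoef [:: lambda]) k.+1 z = rmulC (exp_jet (ecoef [:: lambda]) k z) lambda.
Proof.
have := exp_jet_foldr [::] [:: lambda]; rewrite exp_jet_nil /=.
by move=> /(congr1 (fun F => F k z)); rewrite /dlam => /subr0_eq.
Qed.

(** [lambda] commutes with its own powers, so it may be taken off on either side. Variation of
    constants needs it between the two factors of a product. *)
Lemma exp1_left lambda z :
  exp_jet (ecoef [:: lambda]) 1 z = qCmul (lambda, 0) (exp_jet (ecoef [:: lambda]) 0 z).
Proof.
have hc := growth_ecoef [:: lambda].
rewrite /exp_jet /= /exp_stem /qCmul /= !mul0r subr0 addr0.
have -> : (fun n => ecoef [:: lambda] n.+1) = fun n => lambda * ecoef [:: lambda] n.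
  by apply/funext => n; rewrite !ecoef1 exprS.
by rewrite !qser_mull //; [exact: zim_tame|exact: zre_tame].
Qed.

Lemma exp_stem_origin c : growth c -> exp_stem c ((0, 0) : C) = (c 0%N, 0).
Proof.
move=> hc; rewrite /exp_stem; congr pair; last first.
  rewrite -[RHS](scale0r (qser c (@zim R) ((0, 0) : C))).
  apply: qser_scale => //; [exact: zim_tame|exact: zim_tame|].
  by move=> n; rewrite mul0r /zim /= mul0r.
have z0 n : zre n.+1 ((0, 0) : C) = 0 by rewrite zreS /= !mul0r subr0.
apply: cvg_lim; first exact: norm_hausdorff.
apply: cvg_near_cst; exists 1%N => // -[|N] //= _.
rewrite big_nat_recl //= big1 => [|n _]; last by rewrite z0 mul0r scale0r.
by rewrite zre0 fact0 divr1 scale1r addr0.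
Qed.

Lemma sconst_plane h z : sconst setT h -> h z = h (0, 0).
Proof.
move=> hh; case: z => a b.
have ha (t : R) : is_derive t 1 (fun t => (h (t, b)).1) 0 /\ is_derive t 1 (fun t => (h (t, b)).2) 0.
  have := sc_a hh (z := (t, b)) I => /is_derive_ea/is_derive_pair; exact.
have hb (t : R) : is_derive t 1 (fun t => (h (0, t)).1) 0 /\ is_derive t 1 (fun t => (h (0, t)).2) 0.
  have := sc_b hh (z := (0, t)) I => /is_derive_eb/is_derive_pair; exact.
have lt (t : R) : `|t - 0| < `|t| + 1 by rewrite subr0 ltrDl.
have e1 := line_const (fun s _ => proj1 (ha s)) (lt a).
have e2 := line_const (fun s _ => proj2 (ha s)) (lt a).
have e3 := line_const (fun s _ => proj1 (hb s)) (lt b).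
have e4 := line_const (fun s _ => proj2 (hb s)) (lt b).
by rewrite [LHS]surjective_pairing e1 e2 e3 e4 -surjective_pairing.
Qed.

(** The derivative of the product is $E_{-\lambda}(-\lambda+\lambda)E_\lambda=0$; on the whole plane
    it is therefore constant, with value 1 at the origin. *)
Lemma exp1_inverse lambda z :
  qCmul (exp_jet (ecoef [:: - lambda]) 0 z) (exp_jet (ecoef [:: lambda]) 0 z) = (1, 0).
Proof.
have hm := exp_holjet (growth_ecoef [:: - lambda]); have hp := exp_holjet (growth_ecoef [:: lambda]).
set En := exp_jet _ in hm *; set Ep := exp_jet _ in hp *.
have s0 w : qCmul (En 1 w) (Ep 0 w) + qCmul (En 0 w) (Ep 1 w) = 0.
  rewrite /En exp1_right /Ep exp1_left rmulC_qCmul -qCmulA -qCmulDr -qCmulDl.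
  have -> : ((- lambda, 0) : HC) + (lambda, 0) = 0.
    by rewrite [LHS]/GRing.add /=; congr pair; rewrite ?addNr ?addr0.
  by rewrite qCmul0l qCmul0r.
have hh : sconst setT (fun w => qCmul (En 0 w) (Ep 0 w)).
  split=> w _.
  - by rewrite (hj_stem hm 0 I) (hj_stem hp 0 I) qCconj_mul.
  - apply: (is_derive_eq (qCd_mul_a (hj_a hm 0 I) (hj_a hp 0 I))); exact: s0.
  - apply: (is_derive_eq (qCd_mul_b (hj_b hm 0 I) (hj_b hp 0 I))).
    have -> : qCmul (qCmul (iota_ R) (En 1 w)) (Ep 0 w) = qCmul (iota_ R) (qCmul (En 1 w) (Ep 0 w)).
      by rewrite qCmulA.
    by rewrite qCmul_iota -qCmulDr s0 qCmul0r.
rewrite -/(En 0%N z) -/(Ep 0%N z) (sconst_plane z hh) /En /Ep /exp_jet /=.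
rewrite !exp_stem_origin; [|exact: growth_ecoef|exact: growth_ecoef].
by rewrite !ecoef1 !expr0 qCmul1r.
Qed.

Lemma holjetB D Xs Ys : holjet D Xs -> holjet D Ys -> holjet D (fun k z => Xs k z - Ys k z).
Proof.
move=> hX hY; split=> k z Dz.
- rewrite (hj_stem hX k Dz) (hj_stem hY k Dz) /qCconj /=.
  by rewrite [LHS]/GRing.add /=; congr pair; rewrite opprD.
- exact: (@continuousB _ _ _ (Xs k) (Ys k) z (@hj_cont _ _ _ hX k z Dz) (@hj_cont _ _ _ hY k z Dz)).
- exact: (is_deriveB (hj_a hX k Dz) (hj_a hY k Dz)).
- by apply: (is_derive_eq (is_deriveB (hj_b hX k Dz) (hj_b hY k Dz))); rewrite qCmulDr qCmulNr.
Qed.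

Lemma foldr_dlamB Xs Ys Lambda : foldr (@dlam R) (fun k z => Xs k z - Ys k z) Lambda =
  fun k z => foldr (@dlam R) Xs Lambda k z - foldr (@dlam R) Ys Lambda k z.
Proof.
elim: Lambda => //= a s ->; apply/funext => k; apply/funext => z; rewrite /dlam rmulCB.
by rewrite !opprD !opprK addrACA.
Qed.

Lemma holjet_dlam D Fs lambda : holjet D Fs -> holjet D (dlam lambda Fs).
Proof.
move=> hF; split=> k z Dz.
- exact: (stem_lin lambda (hj_stem hF k.+1) (hj_stem hF k) Dz).
- exact: (@continuous_lin _ _ _ _ z lambda (@hj_cont _ _ _ hF k.+1 z Dz) (@hj_cont _ _ _ hF k z Dz)).
- have [a1 a2 _ _] := holjet_partials k hF Dz; have [a1' a2' _ _] := holjet_partials k.+1 hF Dz.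
  apply/is_derive_ea/is_derive_pair; split; first exact: (qdD a1' (qdN (qdMr lambda a1))).
  exact: (qdD a2' (qdN (qdMr lambda a2))).
- have [_ _ b1 b2] := holjet_partials k hF Dz; have [_ _ b1' b2'] := holjet_partials k.+1 hF Dz.
  rewrite iota_mul; apply/is_derive_eb/is_derive_pair; split.
    apply: (is_derive_eq (qdD b1' (qdN (qdMr lambda b1)))).
    by rewrite /dlam /rmulC /= mulNr opprK opprB addrC.
  exact: (qdD b2' (qdN (qdMr lambda b2))).
Qed.

Lemma holjet_foldr D Fs Lambda : holjet D Fs -> holjet D (foldr (@dlam R) Fs Lambda).
Proof. by move=> hF; elim: Lambda => [|a s IH]; [exact: hF|exact: (holjet_dlam a IH)]. Qed.

(** [h] is $FE_{-\lambda}$: in its derivative $\lambda$ and $-\lambda$ meet in the middle and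
    cancel, and [exp1_inverse] recovers [F] from it. *)
Lemma exp_factor D Fs lambda : open D -> holjet D Fs ->
  (forall k z, D z -> Fs k.+1 z = rmulC (Fs k z) lambda) ->
  exists2 h, sconst D h & forall k z, D z -> Fs k z = qCmul (h z) (exp_jet (ecoef [:: lambda]) k z).
Proof.
move=> oD hF e; have hm := exp_holjet (growth_ecoef [:: - lambda]).
set En := exp_jet _ in hm.
have s0 z : D z -> qCmul (Fs 1%N z) (En 0 z) + qCmul (Fs 0%N z) (En 1 z) = 0.
  move=> Dz; rewrite (e 0%N z Dz) /En exp1_left rmulC_qCmul -qCmulA -qCmulDr -qCmulDl.
  have -> : ((lambda, 0) : HC) + (- lambda, 0) = 0.
    by rewrite [LHS]/GRing.add /=; congr pair; rewrite ?addrN ?addr0.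
  by rewrite qCmul0l qCmul0r.
exists (fun z => qCmul (Fs 0%N z) (En 0 z)).
  split=> z Dz.
  - by rewrite (hj_stem hF 0 Dz) (hj_stem hm 0 I) qCconj_mul.
  - apply: (is_derive_eq (qCd_mul_a (hj_a hF 0 Dz) (hj_a hm 0 I))); exact: s0.
  - apply: (is_derive_eq (qCd_mul_b (hj_b hF 0 Dz) (hj_b hm 0 I))).
    have -> : qCmul (qCmul (iota_ R) (Fs 1%N z)) (En 0 z) =
        qCmul (iota_ R) (qCmul (Fs 1%N z) (En 0 z)) by rewrite qCmulA.
    by rewrite qCmul_iota -qCmulDr s0 // qCmul0r.
elim=> [|k IH] z Dz; first by rewrite -qCmulA exp1_inverse qCmul1r.
by rewrite e // exp1_right qCmul_rmulC -IH.
Qed.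

Lemma fueter_stem0 D G : open D -> qaxh D G -> (forall z, D z -> z.2 *: G z = 0) ->
  forall z, D z -> fueter_stem G z = 0.
Proof.
move=> oD hG h0.
have G0 z : D z -> G z = 0.
  move=> Dz; have /eqP := h0 z Dz; rewrite scaler_eq0 => /orP[/eqP z0|/eqP //].
  have [r r0 [_ h1]] := open_lines oD Dz.
  have d := qdZ (derI z.2) (qaxh_b hG Dz).
  rewrite z0 scale0r add0r scale1r -z0 -surjective_pairing in d.
  by apply: (is_derive_uniqV d); apply: (qd_near r0 _ (qdC z.2 0)) => s /h1 /h0.
move=> z Dz; have [r r0 [h1 h2]] := open_lines oD Dz.
have e1 : qdx G z = 0.
  by apply: qdx_eq; apply: (qd_near r0 _ (qdC z.1 0)) => s /h1 /G0.
have e2 : qdy G z = 0.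
  by apply: qdy_eq; apply: (qd_near r0 _ (qdC z.2 0)) => s /h2 /G0.
by rewrite /fueter_stem e1 e2 !scaler0.
Qed.

Lemma fueter_stemB D G U z : qaxh D G -> qaxh D U -> D z ->
  fueter_stem (fun w => G w - U w) z = fueter_stem G z - fueter_stem U z.
Proof.
move=> hG hU Dz.
have e1 : qdx (fun w => G w - U w) z = qdx G z - qdx U z.
  by apply: qdx_eq; exact: (qdD (qaxh_a hG Dz) (qdN (qaxh_a hU Dz))).
have e2 : qdy (fun w => G w - U w) z = qdy G z - qdy U z.
  by apply: qdy_eq; exact: (qdD (qaxh_b hG Dz) (qdN (qaxh_b hU Dz))).
by rewrite /fueter_stem e1 e2 !scalerBr.
Qed.

(** The operators of [mu] reduce $hE_{(\lambda,\mu)}$ to $hE_\lambda$, which is what they make of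
    [F]; so the difference solves the equation of [mu]. The statement is about [fueter_stem G], as
    the remainders of the induction are stems with their quotients by [b] rather than functions. *)
Lemma fueter_decomposition D Lambda : open D -> conj_invariant D -> forall Fs G,
  holjet D Fs -> qaxh D G -> (forall z, D z -> (Fs 0%N z).2 = z.2 *: G z) ->
  (forall k z, D z -> foldr (@dlam R) Fs Lambda k z = 0) ->
  exists2 hs : nat -> H -> H, (forall i, slice_constant D (hs i)) &
    induces D (fueter_stem G) (fun x =>
      \sum_(i < size Lambda) laplacian (slice_mul D (hs i) (gen_exp (drop i Lambda))) x).
Proof.
move=> oD cD; elim: Lambda => [|lambda mu IH] Fs G hF hG FG h0.
  exists (fun=> slice_ind D (fun=> 0)) => [i|z J Dz hJ].
    apply: sconst_slice_constant => //; split=> z Dz.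
    - by rewrite /qCconj oppr0.
    - exact: is_derive_cst.
    - exact: is_derive_cst.
  rewrite big_ord0 (fueter_stem0 oD hG) //= ?mulr0 ?addr0 // => w Dw.
  by rewrite -FG //; have /= -> := h0 0%N w Dw.
have hZ := holjet_foldr mu hF.
have eZ k z : D z -> foldr (@dlam R) Fs mu k.+1 z = rmulC (foldr (@dlam R) Fs mu k z) lambda.
  by move=> Dz; apply: subr0_eq; exact: (h0 k z Dz).
have [h hh Zh] := exp_factor oD hZ eZ.
have hf := sconst_slice_constant oD cD hh.
have [h' [U [[hh' hU] hP PU ih' iP]]] := product_data (lambda :: mu) oD cD hf.
(* [product_data] chooses its own stem for the slice function of [h]; both induce it, so they
   coincide on [D]. *)
have hE z : D z -> h' z = h z.
  exact: (induces_uniq ih' (slice_indP cD (sc_stem hh))).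
have [||z Dz|k z Dz|hs hhs ihs] := IH (fun k z => Fs k z -
    qCmul (h' z) (exp_jet (ecoef (lambda :: mu)) k z)) (fun z => G z - U z).
- exact: holjetB.
- exact: qaxhB.
- by rewrite scalerBr -FG // -PU.
- rewrite foldr_dlamB foldr_mul -[lambda :: mu]/([:: lambda] ++ mu) exp_jet_foldr.
  by rewrite Zh // hE // subrr.
(* The new term has index 0, since it uses the whole list; the others are shifted by one, in step
   with [drop]. *)
exists (fun i => if i is j.+1 then hs j else slice_ind D h) => [[|i]|z J Dz hJ]; [exact: hf|exact: hhs|].
have e := ihs z J Dz hJ; rewrite (fueter_stemB hG hU Dz) in e.
have e0 : laplacian (slice_mul D (slice_ind D h) (gen_exp (lambda :: mu))) (z.1%:A + z.2 *: J) =
    (fueter_stem U z).1 + J * (fueter_stem U z).2.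
  exact: (fueter_induces oD cD hP hU PU iP Dz hJ).
move: e e0; move: (fueter_stem G z) (fueter_stem U z) => p q /= e e0.
rewrite big_ord_recl; apply: (etrans (congr2 +%R e0 e)).
by rewrite mulrBr addrACA [q.1 + _]addrC addrNK [J * q.2 + _]addrC addrNK.
Qed.

End Decomposition.

Theorem proposition32 (R : realType) (D : set (cplx R))
    (hD : axially_symmetric_domain D)
    (m : nat) (hm : (1 <= m)%N) (Lambda : m.-tuple (quat R)) :
  [/\ axially_monogenic setT (laplacian (gen_exp Lambda))
        /\ is_solution D Lambda (laplacian (gen_exp Lambda)),
      forall h : 'I_m -> quat R -> quat R,
        (forall i, slice_constant D (h i)) ->
        is_solution D Lambda (fun x : quat R =>
          \sum_(i < m) laplacian (slice_mul D (h i) (gen_exp (drop i Lambda))) x)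
    & (forall i : 'I_m, tnth Lambda i != 0) ->
      forall f : quat R -> quat R, is_solution D Lambda f ->
      exists2 h : 'I_m -> quat R -> quat R,
        (forall i, slice_constant D (h i)) &
        forall x : quat R, Omega D x ->
          f x = \sum_(i < m)
            laplacian (slice_mul D (h i) (gen_exp (drop i Lambda))) x].

Proof.
have [oD cD _ _] := hD; set La : seq (quat R) := Lambda.
have cT : conj_invariant (setT : set (cplx R)) by [].
split.
- split; last exact: (jet_solution_is oD cD (gen_exp_solution La oD cD)).
  by have [] := jet_solution_is openT cT (gen_exp_solution La openT cT).
- move=> h hh; apply: (jet_solution_is oD cD).
  (* Coefficients indexed by all naturals, as [jet_solution_sum] expects; the default [fun=> 0] lies
     outside the range of the sum. *)
  pose g i : quat R -> quat R := if insub i is Some j then h j else fun=> 0.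
  have gE (i : 'I_m) : g i = h i by rewrite /g valK.
  clearbody g.
  have -> : (fun x => \sum_(i < m) laplacian (slice_mul D (h i) (gen_exp (drop i La))) x) =
      fun x => \sum_(i < m) laplacian (slice_mul D (g i) (gen_exp (drop i La))) x.
    apply/funext => x; apply: eq_bigr => i _.
    by move: (gE i); move: (g i) (h i) => u v ->; reflexivity.
  apply: (@jet_solution_sum R D La m
    (fun i => laplacian (slice_mul D (g i) (gen_exp (drop i La)))) oD cD) => i im.
  have := product_solution La i oD cD (hh (Ordinal im)).
  by rewrite -gE.
move=> l0 f hf; have [Xs [hX iX X0]] := solution_jet oD cD hf.
have l0' x : x \in La -> x != 0 by move=> /tnthP[i ->]; exact: l0.
have killed := jet_zero oD (amjet_foldr La oD hX) X0.
(* The lift is applied twice, each time with the zero jet as right-hand side, so that [Vs] and then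
   [Ys] solve the same equation and the second derivative of [Ys] is [Xs]. *)
have [Vs [hV VX V0]] := amjet_lift oD cD l0' hX (amjet0 oD cD)
  (fun k z Dz => esym (killed k z Dz)).
have [Ys [hY YV Y0]] := amjet_lift oD cD l0' hV (amjet0 oD cD)
  (fun k z Dz => esym (V0 k z Dz)).
have [G [hG FG GY]] := fueter_lift_data oD hY.
have [k z Dz|hs hhs ihs] := fueter_decomposition oD cD (fueter_lift_holjet oD hY) hG FG (Lambda := La).
  by rewrite fueter_lift_foldr /fueter_lift !Y0 //= !scaler0 addr0.
exists (fun i => hs i) => [i|x [z [J [Dz hJ ->]]]]; first exact: hhs.
have := ihs z J Dz hJ; rewrite GY // YV // VX // -(iX z J Dz hJ) => <-.
pose F i := laplacian (slice_mul D (hs i) (gen_exp (drop i La))) (z.1%:A + z.2 *: J).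
rewrite -(big_mkord xpredT F) -[RHS](big_mkord xpredT F).
by rewrite /La size_tuple.
Qed.
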